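(* (i) Let $(G,\mathcal P,\delta)$ be a symmetric homogeneous Garside structure of finite type with set of atoms $\mathcal A$, let $k,l$ be positive integers, suppose that the Garside structure is square free if $\max(k,l)\ge2$, and let $x,y\in\mathcal A$. If $X\in(x^k)^G(y^l)^G$ and $\inf_sX<0$, then $\ell_s(X)=-2\inf_sX+k+l$. (ii) Let $(G,\mathcal P,\Delta)$ be the standard Garside structure on an Artin–Tits group of spherical type with set of atoms $\mathcal A$, let $k,l$ be positive integers and $x,y\in\mathcal A$. If $X\in(x^k)^G(y^l)^G$ and $\inf_sX<0$, then $\ell_s(X)=-2\inf_sX+k+l-2$.
   Context: Conjugation: $x^y=y^{-1}xy$, $x^G=\{x^z: z\in G\}$; $(x^k)^G(y^l)^G$ is the set of products of an element of $(x^k)^G$ and an element of $(y^l)^G$. A Garside structure $(G,\mathcal P,\Delta)$ (the Garside element is denoted $\delta$ in (i)) consists of a group $G$, a submonoid $\mathcal P$ with $\mathcal P\cap\mathcal P^{-1}=\{1\}$ and an element $\Delta\in\mathcal P$ such that: (G1) the partial order $a\preccurlyeq b\iff a^{-1}b\in\mathcal P$ is a lattice order on $G$ (lcm $\vee$, gcd $\wedge$); (G2) the set of simple elements $[1,\Delta]=\{a: 1\preccurlyeq a\preccurlyeq\Delta\}$ generates $G$; (G3) $X\in\mathcal P\Rightarrow\Delta^{-1}X\Delta\in\mathcal P$; (G4) for $X\in\mathcal P\setminus\{1\}$, $\|X\|=\sup\{k: X=a_1\cdots a_k,\ a_i\in\mathcal P\setminus\{1\}\}<\infty$ (and $\|1\|=0$).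 It is of finite type if $[1,\Delta]$ is finite. $]1,\Delta[\,=[1,\Delta]\setminus\{1,\Delta\}$. An atom is an $a\in\mathcal P\setminus\{1\}$ such that $a=bc$ with $b,c\in\mathcal P$ implies $b=1$ or $c=1$; $\mathcal A$ is the set of atoms. Write $a\succcurlyeq b\iff ab^{-1}\in\mathcal P$. The structure is homogeneous if $\|XY\|=\|X\|+\|Y\|$ for all $X,Y\in\mathcal P$; symmetric if for all simple $u,v$ one has $u\preccurlyeq v\iff v\succcurlyeq u$; square free if no simple element can be written $Ux^2V$ with $U,V\in\mathcal P$, $x\in\mathcal A$. Left normal form: for simple $A,B$ the product $A\cdot B$ is left weighted if $A=AB\wedge\Delta$; the left normal form of $X\in G$ is the (unique) decomposition $X=\Delta^p\cdot A_1\cdot\dots\cdot A_r$ with $p\in\mathbb Z$, $A_i\in\,]1,\Delta[$ and each $A_i\cdot A_{i+1}$ left weighted; $\inf X=p$, $\ell(X)=r$. Summit infimum and summit length: $\inf_sX=\max\{\inf Y: Y\in X^G\}$, $\ell_s(X)=\min\{\ell(Y):Y\in X^G\}$. Artin–Tits group of spherical type: $G$ is generated by $\mathcal A$ subject to $\langle a\,b\rangle^{m_{ab}}=\langle b\,a\rangle^{m_{ab}}$ for distinct $a,b\in\mathcal A$, where $\langle a\,b\rangle^m=abab\dots$ ($m$ letters), $\mathcal A$ is the set of vertices of a Coxeter graph (one of $A_n,B_n,D_n,E_6,E_7,E_8,F_4,G_2,H_3,H_4,I_2(p)$) and $(m_{ab})$ is its Coxeter matrix. In the standard Garside structure $\mathcal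 P$ is the submonoid generated by $\mathcal A$, $\Delta$ is the lcm of $\mathcal A$ for $\preccurlyeq$, and the atoms are the elements of $\mathcal A$. *)

(* Defs.v *)
From mathcomp Require Export all_boot all_order ssralg ssrnum ssrint.
From mathcomp Require Export boolp classical_sets cardinality.

Set Implicit Arguments.
Unset Strict Implicit.
Unset Printing Implicit Defensive.

Export Order.TTheory GRing.Theory Num.Theory.
Open Scope classical_set_scope.
Open Scope group_scope.

Section Groups.
Variable G : groupType.

Definition is_submonoid (M : set G) : Prop :=
  M 1 /\ forall a b, M a -> M b -> M (a * b).

Definition is_subgroup (H : set G) : Prop :=
  is_submonoid H /\ forall a, H a -> H a^-1.

Definition zexpg (x : G) (p : int) : G :=
  match p with
  | Posz n => x ^+ n
  | Negz n => x ^- n.+1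
  end.

Definition cclass (x : G) : set G := [set x ^ z | z in setT].

Definition setmulg (A B : set G) : set G := [set a * b | a in A & b in B].

(* alternating m a b = a b a b ..., with m letters *)
Fixpoint alternating (m : nat) (a b : G) : G :=
  if m is m'.+1 then a * alternating m' b a else 1.

End Groups.

(* The default value 0 is returned when there is no maximum (minimum). *)
Definition set_max (A : set int) : int := xget 0%R (A `&` ubound A).
Definition set_min (A : set nat) : nat := xget 0%N (A `&` lbound A).

Section Garside.
Variables (G : groupType) (P : set G) (D : G).

Definition lediv (a b : G) : Prop := P (a^-1 * b).
Definition gediv (a b : G) : Prop := P (a * b^-1).

Definition is_gcd (a b d : G) : Prop :=
  [/\ lediv d a, lediv d b & forall z, lediv z a -> lediv z b -> lediv z d].

Definition is_lcm_of (A : set G) (m : G) : Prop :=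
  (forall a, A a -> lediv a m) /\
  (forall z, (forall a, A a -> lediv a z) -> lediv m z).

Definition simple_elt : set G := [set a | lediv 1 a /\ lediv a D].
Definition proper_simple : set G :=
  [set a | [/\ simple_elt a, a <> 1 & a <> D]].

(* The k such that X is a product of k nontrivial elements of P. The empty
   product contributes k = 0 exactly for X = 1. *)
Definition fact_lengths (X : G) : set nat :=
  [set k | exists s : seq G,
    [/\ size s = k, (forall a, a \in s -> P a /\ a <> 1)
      & X = \prod_(a <- s) a]].

Definition gnorm (X : G) : nat := supremum 0%N (fact_lengths X).

Definition atom : set G :=
  [set a | [/\ P a, a <> 1
    & forall b c, P b -> P c -> a = b * c -> b = 1 \/ c = 1]].

(* P being a submonoid with P `&` P^-1 = [set 1], lediv is a partial order,
   and garside_lcm and garside_gcd say that it is a lattice order. *)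
Record garside_structure : Prop := GarsideStructure {
  garside_submonoid : is_submonoid P;
  garside_pointed : forall a, P a -> P a^-1 -> a = 1;
  garside_delta : P D;
  garside_lcm : forall a b, exists m, is_lcm_of [set a; b] m;
  garside_gcd : forall a b, exists d, is_gcd a b d;
  garside_gen : smallest (@is_subgroup G) simple_elt = setT;
  garside_conj : forall X, P X -> P (D^-1 * X * D);
  garside_norm : forall X, P X -> X <> 1 -> has_ubound (fact_lengths X)
}.

Definition finite_type : Prop := finite_set simple_elt.

Definition homogeneous : Prop :=
  forall X Y, P X -> P Y -> gnorm (X * Y) = (gnorm X + gnorm Y)%N.

Definition symmetric_structure : Prop :=
  forall u v, simple_elt u -> simple_elt v -> (lediv u v <-> gediv v u).

Definition square_free : Prop :=
  forall U x V, P U -> atom x -> P V -> ~ simple_elt (U * x ^+ 2 * V).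

Definition left_weighted (A B : G) : Prop := is_gcd (A * B) D A.

(* (p, [:: A_1; ...; A_r]) encodes the decomposition D^p . A_1 ... A_r. *)
Definition is_left_normal_form (X : G) (d : int * seq G) : Prop :=
  [/\ X = zexpg D d.1 * \prod_(a <- d.2) a,
      forall a, a \in d.2 -> proper_simple a
    & forall i, (i.+1 < size d.2)%N ->
        left_weighted (nth 1 d.2 i) (nth 1 d.2 i.+1)].

(* In a Garside structure with D <> 1 the left normal form exists and is
   unique, so the default value is irrelevant. *)
Definition left_normal_form (X : G) : int * seq G :=
  xget (0%R, [::]) (is_left_normal_form X).

Definition ginf (X : G) : int := (left_normal_form X).1.
Definition glen (X : G) : nat := size (left_normal_form X).2.

Definition summit_inf (X : G) : int := set_max [set ginf Y | Y in cclass X].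
Definition summit_len (X : G) : nat := set_min [set glen Y | Y in cclass X].

End Garside.

(* The standard list of connected spherical Coxeter graphs. I_2(3), I_2(4),
   I_2(6) duplicate A_2, B_2, G_2. *)
Inductive coxeter_type :=
  | CoxA of nat | CoxB of nat | CoxD of nat
  | CoxE6 | CoxE7 | CoxE8 | CoxF4 | CoxG2 | CoxH3 | CoxH4
  | CoxI2 of nat.

Definition coxeter_valid (t : coxeter_type) : bool :=
  match t with
  | CoxA n => 1 <= n
  | CoxB n => 2 <= n
  | CoxD n => 4 <= n
  | CoxI2 p => 3 <= p
  | _ => true
  end%N.

Definition coxeter_rank (t : coxeter_type) : nat :=
  match t with
  | CoxA n | CoxB n | CoxD n => n
  | CoxE6 => 6 | CoxE7 => 7 | CoxE8 => 8
  | CoxF4 => 4 | CoxG2 => 2 | CoxH3 => 3 | CoxH4 => 4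
  | CoxI2 _ => 2
  end%N.

(* An edge between i and j labelled m is the triple (i, j, m); vertices are
   numbered from 0. *)
Definition path_edges (n : nat) : seq (nat * nat * nat) :=
  [seq (i, i.+1, 3%N) | i <- iota 0%N n.-1].

Definition coxeter_edges (t : coxeter_type) : seq (nat * nat * nat) :=
  match t with
  | CoxA n => path_edges n
  | CoxB n => rcons (path_edges n.-1) (n - 2, n - 1, 4)
  | CoxD n => rcons (path_edges n.-1) (n - 3, n - 1, 3)
  | CoxE6 => rcons (path_edges 5) (2, 5, 3)
  | CoxE7 => rcons (path_edges 6) (2, 6, 3)
  | CoxE8 => rcons (path_edges 7) (2, 7, 3)
  | CoxF4 => [:: (0, 1, 3); (1, 2, 4); (2, 3, 3)]
  | CoxG2 => [:: (0, 1, 6)]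
  | CoxH3 => [:: (0, 1, 3); (1, 2, 5)]
  | CoxH4 => [:: (0, 1, 3); (1, 2, 3); (2, 3, 5)]
  | CoxI2 p => [:: (0, 1, p)]
  end%N.

Definition coxeter_matrix (t : coxeter_type) (i j : nat) : nat :=
  (if i == j then 1
  else if [seq e.2 | e <- coxeter_edges t & (e.1 == (i, j)) || (e.1 == (j, i))]
    is m :: _ then m else 2)%N.

Definition braid_relations (t : coxeter_type) (G : groupType)
    (a : 'I_(coxeter_rank t) -> G) : Prop :=
  forall i j : 'I_(coxeter_rank t), i != j ->
    alternating (coxeter_matrix t i j) (a i) (a j) =
    alternating (coxeter_matrix t i j) (a j) (a i).

(* G is the group presented by the generators a i and the braid relations,
   in the form of the universal property of the presentation; uniqueness of
   the morphism follows from artin_gen. *)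
Record artin_tits (t : coxeter_type) (G : groupType)
    (a : 'I_(coxeter_rank t) -> G) : Prop := ArtinTits {
  artin_gen : smallest (@is_subgroup G) (range a) = setT;
  artin_rel : braid_relations a;
  artin_univ : forall (H : groupType) (f : 'I_(coxeter_rank t) -> H),
    braid_relations f ->
    exists phi : {multiplicative G -> H}, forall i, phi (a i) = f i
}.

(* (G, P, D) is the standard Garside structure on the Artin-Tits group of
   type t with standard generators a i. *)
Record standard_garside (t : coxeter_type) (G : groupType)
    (a : 'I_(coxeter_rank t) -> G) (P : set G) (D : G) : Prop :=
  StandardGarside {
    standard_garside_structure : garside_structure P D;
    standard_artin : artin_tits a;
    standard_pos : P = smallest (@is_submonoid G) (range a);
    standard_delta : is_lcm_of P (range a) D
  }.

(* Main.v *)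
(* For a conjugate s of an atom, let C(s) be the set of the g such that
   g^-1 s g is positive, that is g <= s g. It is closed under meets and joins
   and under right multiplication by powers of Delta. Let X = s^k t^l and let r
   be least such that h <= g <= h Delta^r for some g in C(s) and h in C(t). If
   r = 0, then s and t have positive conjugates by the same element, and the
   summit infimum of X is nonnegative.

   If r > 0, projecting alternately onto C(s) and C(t) gives a descending
   sequence v_n in C(s), C(t), C(s), ... with quotients of canonical length r.
   The left normal forms of s^k v_n and of t^l v_n then glue into the left
   normal form of X^N v_0 for all N. Comparing X^N u with X^N v_0 for an
   arbitrary u shows that the infimum -r and the supremum r + k + l - 2e reached
   at v_1 are the best over the conjugacy class, where e = 0 in (i) and e = 1 in
   (ii). The term e comes from the junctions: at a junction the atom remains a
   separate letter in (i), whereas in (ii) its product with the next letter is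
   still simple. In (ii) a junction may fail to be left weighted, but only if
   r = 1 and inside the dihedral monoid generated by two atoms, where the
   sequence is explicit.

   In (ii) the argument uses of the Artin group that the lcm of two atoms a, b
   is the braid word of a and b, with no factorization into atoms other than its
   two alternating ones. A deformation of the reflection representation, read
   modulo 2 at the parameter q = 2, shows that no other atom occurs in such a
   factorization, and the reflections at q = 1 give the order of the product of
   a and b in the Coxeter group. In rank two the reflections of Z/m suffice. *)

From HB Require Import structures.
Require Import Defs.
From mathcomp Require Import all_algebra algC.
From mathcomp Require Import ring zify.

Set Implicit Arguments.
Unset Strict Implicit.
Unset Printing Implicit Defensive.

(** For a conjugator [u], the inequality [u <=| X * u * D ^+ m] says that the infimum of [X ^ u] is
    at least -m, and [X * u <=| u * D ^+ q] that its supremum is at most q. The bounds over the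
    conjugacy class thus become statements about all [u] in the lattice. Such a [u] is unrelated to
    the sequence [v], but it lies within some [D ^+ c] of [v 0] on both sides. This error stays
    constant when the inequality is iterated N times, whereas the normal form of [X ^+ N * v 0]
    grows linearly in N; the error is therefore absorbed for large N. In (ii) the exchange
    properties of simple elements are derived inside the monoid, by induction on length from the
    lcms of pairs of atoms. Their right-handed forms come from the anti-automorphism that reverses
    words. *)

Ltac gsimp := rewrite ?(invgM, invgK, mulgA, mulgV, mulVg, mul1g, mulg1, invg1, mulgK, mulgVK).

(** * Divisibility in a Garside structure with an additive length *)

Lemma lediv_mul2l (G : groupType) (P : set G) (c a b : G) :
  lediv P (c * a) (c * b) = lediv P a b.
Proof. by rewrite /lediv; gsimp. Qed.

(** The common ground of both parts: [nu] is [gnorm] in (i) and the word length in (ii). Axiom G3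
    gives one inclusion only; together with [gl_conjV], conjugation by [D] becomes an automorphism
    of the order. *)
Record garside_length (G : groupType) (P : set G) (D : G) (nu : G -> nat) : Prop :=
  GarsideLength {
    gl_structure :> garside_structure P D;
    gl_conjV : forall X, P X -> P (D * X * D^-1);
    gl_M : forall X Y, P X -> P Y -> nu (X * Y) = (nu X + nu Y)%N;
    gl_eq0 : forall X, P X -> nu X = 0%N -> X = 1
  }.

Section Order.
Variables (G : groupType) (P : set G) (D : G) (nu : G -> nat).
Hypothesis gl : garside_length P D nu.
Local Notation "a <=| b" := (lediv P a b) (at level 70, no associativity).

Lemma pos1 : P 1. Proof. by case: (garside_submonoid gl). Qed.

Lemma posM a b : P a -> P b -> P (a * b).
Proof. by have [_] := garside_submonoid gl; apply. Qed.

Lemma posD : P D. Proof. exact: garside_delta gl. Qed.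

Lemma posX a n : P a -> P (a ^+ n).
Proof.
move=> Pa; elim: n => [|n IH]; first by rewrite expg0; exact: pos1.
by rewrite expgS; apply: posM.
Qed.

Lemma pos_prod s : (forall a, a \in s -> P a) -> P (\prod_(a <- s) a).
Proof.
elim: s => [|a s IH] Ps; first by rewrite big_nil; exact: pos1.
rewrite big_cons; apply: posM; first by apply: Ps; rewrite mem_head.
by apply: IH => b bs; apply: Ps; rewrite in_cons bs orbT.
Qed.

Lemma pos_conjD X : P (D^-1 * X * D) <-> P X.
Proof.
split; last exact: garside_conj gl _.
by move/(gl_conjV gl); gsimp.
Qed.

Lemma pos_conjDn n X : P (D ^- n * X * D ^+ n) <-> P X.
Proof.
elim: n X => [|n IH] X; first by rewrite !expg0; gsimp.
by rewrite -(IH X) -(pos_conjD (D ^- n * X * D ^+ n)) expgSr; gsimp.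
Qed.

Lemma le_refl a : a <=| a. Proof. by rewrite /lediv mulVg; exact: pos1. Qed.

Lemma le_trans b a c : a <=| b -> b <=| c -> a <=| c.
Proof. by move=> ab bc; have := posM ab bc; rewrite /lediv; gsimp. Qed.

Lemma le_anti a b : a <=| b -> b <=| a -> a = b.
Proof.
move=> ab ba; have /(congr1 (fun x => a * x)) : a^-1 * b = 1.
  by apply: (garside_pointed gl) => //; gsimp.
by gsimp.
Qed.

Lemma le1P a : (1 <=| a) = P a. Proof. by rewrite /lediv; gsimp. Qed.

Lemma le_mulr a p : P p -> a <=| a * p. Proof. by rewrite /lediv; gsimp. Qed.

Lemma leE a b : a <=| b -> exists2 p, P p & b = a * p.
Proof. by move=> ab; exists (a^-1 * b) => //; gsimp. Qed.

(** The order is invariant under left multiplication by its definition; on the right it is invariant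
    under powers of [D] because these normalise [P]. *)
Lemma le_mulDn n a b : (a * D ^+ n <=| b * D ^+ n) <-> (a <=| b).
Proof. by rewrite /lediv -(pos_conjDn n (a^-1 * b)); gsimp. Qed.

Lemma le_divDnl n a b : a <=| b * D ^+ n -> a * D ^- n <=| b.
Proof. by move=> h; apply/(le_mulDn n); gsimp. Qed.

Lemma le_Dn n a : a <=| a * D ^+ n.
Proof. by apply: le_mulr; apply: posX; exact: posD. Qed.

Lemma le_Dleq m n a : (m <= n)%N -> a * D ^+ m <=| a * D ^+ n.
Proof. by move=> /subnK <-; rewrite addnC expgnDr mulgA; exact: le_Dn. Qed.

Lemma nu1 : nu 1 = 0%N.
Proof. have := gl_M gl pos1 pos1; rewrite mulg1; lia. Qed.

Lemma nu_gt0 a : P a -> a <> 1 -> (0 < nu a)%N.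
Proof. by move=> Pa a1; rewrite lt0n; apply/eqP => /(gl_eq0 gl Pa). Qed.

Lemma le_nu a b : P a -> a <=| b -> (nu a <= nu b)%N.
Proof. by move=> Pa /leE[p Pp ->]; rewrite (gl_M gl) // leq_addr. Qed.

Lemma le_nu_eq a b : P a -> a <=| b -> nu a = nu b -> a = b.
Proof.
move=> Pa /leE[p Pp ->]; rewrite (gl_M gl) // => e.
by rewrite (gl_eq0 gl Pp) ?mulg1 //; lia.
Qed.

Lemma pos_inv_eq1 a : P a -> a <=| 1 -> a = 1.
Proof. by move=> Pa a1; apply: le_anti => //; rewrite le1P. Qed.

Definition meet (a b : G) : G := projT1 (cid (garside_gcd gl a b)).
Definition join (a b : G) : G := projT1 (cid (garside_lcm gl a b)).

Lemma meetl a b : meet a b <=| a.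
Proof. by rewrite /meet; case: cid => d []. Qed.

Lemma meetr a b : meet a b <=| b.
Proof. by rewrite /meet; case: cid => d []. Qed.

Lemma le_meet z a b : z <=| a -> z <=| b -> z <=| meet a b.
Proof. by rewrite /meet; case: cid => d [? ? h] /= *; apply: h. Qed.

Lemma joinl a b : a <=| join a b.
Proof. by rewrite /join; case: cid => d [h _] /=; apply: h; left. Qed.

Lemma joinr a b : b <=| join a b.
Proof. by rewrite /join; case: cid => d [h _] /=; apply: h; right. Qed.

Lemma le_join z a b : a <=| z -> b <=| z -> join a b <=| z.
Proof. by rewrite /join; case: cid => d [_ h] /= az bz; apply: h => _ [->|->]. Qed.

Lemma pos_meet a b : P a -> P b -> P (meet a b).
Proof. by rewrite -!le1P; exact: le_meet. Qed.

(** [r] is the residue of [b] after [a]. Following such residues along a normal form is the basic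
    technique of the carry lemmas. *)
Lemma joinE a b : exists r, [/\ P r, join a b = a * r
  & forall w, b <=| a * w -> P w -> r <=| w].
Proof.
have [r Pr jE] := leE (joinl a b); exists r; split=> // w bw Pw.
by rewrite -(lediv_mul2l P a) -jE; apply: le_join => //; apply: le_mulr.
Qed.

(** The elements enclosed in this way form a subgroup, since powers of [D] normalise [P], and this
    subgroup contains the simple elements. *)
Lemma le_Dbound u : exists n, D ^- n <=| u /\ u <=| D ^+ n.
Proof.
pose S := [set u | exists n, D ^- n <=| u /\ u <=| D ^+ n].
suff SG : is_subgroup S /\ simple_elt P D `<=` S.
  have : smallest (@is_subgroup G) (simple_elt P D) u by rewrite (garside_gen gl).
  by apply: (smallest_sub SG.1 SG.2).
have DE n : (D ^- n = D ^- n * 1)%g by rewrite mulg1.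
split; last first.
  move=> a [a1 aD]; exists 1%N; rewrite expg1; split => //.
  apply: le_trans a1; rewrite /lediv; gsimp; exact: posD.
split; first split.
- by exists 0%N; rewrite expg0 invg1; split; exact: le_refl.
- move=> a b [m [m1 m2]] [n [n1 n2]]; exists (n + m)%N; split.
    have -> : D ^- (n + m) = D ^- m * D ^- n by rewrite expgnDr invgM.
    apply: (@le_trans (a * D ^- n)); last by rewrite lediv_mul2l.
    by apply/(le_mulDn n); gsimp.
  apply: (@le_trans (a * D ^+ n)); first by rewrite lediv_mul2l.
  by rewrite addnC expgnDr; apply/le_mulDn.
- move=> a [m [m1 m2]]; exists m; split.
    have := m2; rewrite /lediv => /(pos_conjDn m) ; gsimp.
    by move=> h; apply/(pos_conjDn m); gsimp.
  have := m1; rewrite /lediv => /(pos_conjDn m); gsimp.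
  by [].
Qed.

End Order.

Definition prods (G : groupType) (s : seq G) : G := \prod_(a <- s) a.

Lemma prods_nil (G : groupType) : prods [::] = 1 :> G.
Proof. by rewrite /prods big_nil. Qed.

Lemma prods_cons (G : groupType) (a : G) s : prods (a :: s) = a * prods s.
Proof. by rewrite /prods big_cons. Qed.

Lemma prods_cat (G : groupType) (s t : seq G) : prods (s ++ t) = prods s * prods t.
Proof. by rewrite /prods big_cat. Qed.

Lemma prods_nseq (G : groupType) (a : G) n : prods (nseq n a) = a ^+ n.
Proof.
by elim: n => [|n IH]; rewrite ?prods_nil ?expg0 //= prods_cons IH expgS.
Qed.

(** * Normal forms *)

Section NormalForms.
Variables (G : groupType) (P : set G) (D : G) (nu : G -> nat).
Hypothesis gl : garside_length P D nu.
Local Notation "a <=| b" := (lediv P a b) (at level 70, no associativity).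

Definition letter (a : G) : Prop := [/\ P a, a <> 1 & a <=| D].

Definition letters (s : seq G) : Prop := forall a, a \in s -> letter a.

(** The gcd condition of [left_weighted] expressed through the prefixes of [b]; [left_weighted_lw]
    proves the equivalence. *)
Definition lw (a b : G) : Prop :=
  forall p, P p -> p <=| b -> a * p <=| D -> p = 1.

Fixpoint lwchain (s : seq G) : Prop :=
  if s is a :: s' then (if s' is b :: _ then lw a b else True) /\ lwchain s'
  else True.

Lemma letters_cons a s : letters (a :: s) <-> letter a /\ letters s.
Proof.
split=> [h|[ha hs] b]; last by rewrite in_cons => /orP[/eqP->//|/hs].
by split=> [|b bs]; apply: h; rewrite in_cons ?eqxx // bs orbT.
Qed.

Lemma letters_cat s t : letters (s ++ t) <-> letters s /\ letters t.
Proof.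
split=> [h|[hs ht] b]; last by rewrite mem_cat => /orP[/hs|/ht].
by split=> b bs; apply: h; rewrite mem_cat bs ?orbT.
Qed.

Lemma letters_pos s : letters s -> P (prods s).
Proof. by move=> hs; apply: (pos_prod gl) => a /hs[]. Qed.

Lemma lwchain_cat3 s t u : t <> [::] ->
  lwchain (s ++ t) -> lwchain (t ++ u) -> lwchain (s ++ t ++ u).
Proof.
move=> t0; elim: s => [|a s IH] //=.
by case: s IH => [|b s] IH /=; case: t t0 IH => // c t _ IH [ac hs] hu; split => //; apply: IH.
Qed.

Lemma lwchain_tail a s : lwchain (a :: s) -> lwchain s.
Proof. by case. Qed.

Lemma simple_factor a p : P a -> a * p <=| D -> p <=| D.
Proof.
move=> Pa apD; apply: (@le_trans _ _ _ _ gl (a^-1 * D)).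
  by move: apD; rewrite /lediv; gsimp.
by rewrite /lediv; gsimp; apply/(pos_conjD gl).
Qed.

(** The residue of [z] after [a] divides the remaining product, hence its first letter by induction,
    and left weightedness makes it trivial. In [lwchain_tail_le] the element [z] is a quotient by a
    power of [D], which may fail to be positive. *)
Lemma lwchain_head a s z :
  letters (a :: s) -> lwchain (a :: s) ->
  z <=| D -> z <=| prods (a :: s) -> z <=| a.
Proof.
elim: s a z => [|b s IH] a z ls; first by rewrite prods_cons prods_nil mulg1.
have /letters_cons[[Pa _ aD] ls'] := ls.
move=> ch zD zs.
have [p Pp jE] := leE (joinl gl a z).
have apD : a * p <=| D by rewrite -jE; apply: le_join.
have ps : p <=| prods (b :: s).
  rewrite -(lediv_mul2l P a) -jE -prods_cons; apply: le_join => //.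
  rewrite prods_cons; apply: (le_mulr); exact: letters_pos.
have pb : p <=| b.
  apply: IH => //; first exact: lwchain_tail ch.
  exact: simple_factor apD.
have p1 : p = 1 by case: ch => h _; apply: h.
by have := joinr gl a z; rewrite jE p1 mulg1.
Qed.

Lemma lwchain_tail_le a s n :
  letters (a :: s) -> lwchain (a :: s) ->
  prods (a :: s) <=| D ^+ n.+1 -> prods s <=| D ^+ n.
Proof.
move=> ls ch h; rewrite -(lediv_mul2l P a) -prods_cons.
suff /(le_mulDn gl n) : prods (a :: s) * D ^- n <=| a by gsimp.
apply: (lwchain_head ls ch); apply: (le_divDnl gl); first by rewrite -expgS.
exact: (le_Dn gl).
Qed.

Lemma lwchain_size s n :
  letters s -> lwchain s -> prods s <=| D ^+ n -> (size s <= n)%N.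
Proof.
elim: s n => [|a s IH] [|n] // ls ch h; last first.
  apply: IH; first by have /letters_cons[] := ls.
    exact: lwchain_tail ch.
  exact: lwchain_tail_le h.
have /letters_cons[[Pa a1 aD] ls'] := ls.
case: a1; apply: (pos_inv_eq1 gl) => //; rewrite expg0 in h.
apply: (le_trans gl _ h).
by rewrite prods_cons; apply: le_mulr; apply: letters_pos.
Qed.

(** Greedy construction: the first letter is the gcd of [E] and [D]. The rest is below [D ^+ n]
    because [E * D ^- n] lies below both [E] and [D]. *)
Lemma normal_form n E : P E -> E <=| D ^+ n ->
  exists s, [/\ letters s, lwchain s, prods s = E & (size s <= n)%N].
Proof.
elim: n E => [|n IH] E PE; rewrite ?expg0 => ED.
  exists [::]; split => //; rewrite prods_nil; apply/esym.
  exact: (pos_inv_eq1 gl).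
pose a := meet gl E D.
have Pa : P a by apply: pos_meet => //; exact: posD gl.
have [E' PE' EE] := leE (meetl gl E D : a <=| E).
have E'D : E' <=| D ^+ n.
  rewrite -(lediv_mul2l P a) -EE.
  suff /(le_mulDn gl n) : E * D ^- n <=| a by gsimp.
  apply: le_meet; apply: (le_divDnl gl); first exact: (le_Dn gl).
  by rewrite -expgS.
have [s [ls ch sE sn]] := IH _ PE' E'D.
have [a1|a1] := EM (a = 1); first by exists s; split=> //; rewrite ?EE ?a1 ?mul1g // ltnW.
exists (a :: s); split => //.
- by apply/letters_cons; split => //; split => //; exact: meetr.
- split=> //; case: s ls ch sE {sn} => // b s ls ch sE p Pp pb apD.
  apply/(mulgI a); rewrite mulg1; apply: (le_anti gl); last exact: le_mulr.
  apply: le_meet => //; rewrite EE lediv_mul2l -sE prods_cons.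
  apply: (le_trans gl pb); apply: le_mulr.
  by apply: letters_pos; have /letters_cons[] := ls.
- by rewrite prods_cons sE.
Qed.

End NormalForms.

Lemma nat_argmin (T : Type) (Q : T -> Prop) (phi : T -> nat) :
  (exists x, Q x) -> exists2 x, Q x & forall y, Q y -> (phi x <= phi y)%N.
Proof.
move=> [x Qx]; have [n] := ubnP (phi x); elim: n x Qx => // n IH x Qx xn.
have [[y [Qy yx]]|h] := EM (exists y, Q y /\ (phi y < phi x)%N).
  by apply: (IH y) => //; apply: leq_trans yx _.
by exists x => // y Qy; rewrite leqNgt; apply/negP => yx; apply: h; exists y.
Qed.

(** * Descending sequences *)

Section Descent.
Variables (G : groupType) (P : set G) (D : G) (nu : G -> nat).
Hypothesis gl : garside_length P D nu.
Local Notation "a <=| b" := (lediv P a b) (at level 70, no associativity).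

(* The g such that the conjugate of x by g is positive. *)
Definition cset (x : G) : set G := [set g | g <=| x * g].

(** Left multiplication by [x] is an automorphism of the lattice, so it commutes with meets. *)
Lemma cset_meet x g h : cset x g -> cset x h -> cset x (meet gl g h).
Proof.
rewrite /cset /= => xg xh; rewrite -(lediv_mul2l P x^-1); gsimp.
apply: le_meet; rewrite -(lediv_mul2l P x); gsimp.
  exact: (le_trans gl (meetl gl g h)).
exact: (le_trans gl (meetr gl g h)).
Qed.

Lemma cset_join x g h : cset x g -> cset x h -> cset x (join gl g h).
Proof.
rewrite /cset /= => xg xh; apply: le_join.
  by apply: (le_trans gl xg); rewrite lediv_mul2l; exact: joinl.
by apply: (le_trans gl xh); rewrite lediv_mul2l; exact: joinr.
Qed.

Lemma cset_Dn x g n : cset x g -> cset x (g * D ^+ n).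
Proof. by rewrite /cset /= mulgA; move/(le_mulDn gl n). Qed.

Lemma cset_DVn x g n : cset x g -> cset x (g * D ^- n).
Proof. by rewrite /cset /= => h; apply/(le_mulDn gl n); gsimp. Qed.

Lemma cset_X x g k : cset x g -> g <=| x ^+ k * g.
Proof.
move=> xg; elim: k => [|k IH]; first by rewrite expg0 mul1g; exact: (le_refl gl).
apply: (le_trans gl xg); rewrite expgS -mulgA.
by rewrite lediv_mul2l.
Qed.

Lemma two_sided_bound u w : exists n, u <=| w * D ^+ n /\ w <=| u * D ^+ n.
Proof.
have [n [n1 n2]] := le_Dbound gl (w^-1 * u); exists n; split.
  by rewrite -(lediv_mul2l P w^-1); gsimp.
rewrite -(lediv_mul2l P u^-1); gsimp.
by move: n1; rewrite /lediv => /(pos_conjDn gl n); gsimp.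
Qed.

Lemma iter_le X u m N : u <=| X * u * D ^+ m -> u <=| X ^+ N * u * D ^+ (m * N).
Proof.
move=> uX; elim: N => [|N IH]; first by rewrite muln0 !expg0; gsimp; exact: (le_refl gl).
apply: (le_trans gl uX); rewrite expgS mulnS addnC expgnDr !mulgA.
by apply/(le_mulDn gl m); rewrite -!mulgA lediv_mul2l !mulgA.
Qed.

Lemma iter_ge X u m N : X * u <=| u * D ^+ m -> X ^+ N * u <=| u * D ^+ (m * N).
Proof.
move=> uX; elim: N => [|N IH]; first by rewrite muln0 !expg0; gsimp; exact: (le_refl gl).
rewrite expgS mulnS expgnDr !mulgA; apply: (@le_trans _ _ _ _ gl (X * u * D ^+ (m * N))).
  by rewrite -!mulgA lediv_mul2l.
by apply/(le_mulDn gl).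
Qed.

Fixpoint bigmeet (f : nat -> G) (n : nat) : G :=
  if n is m.+1 then meet gl (bigmeet f m) (f n) else f 0%N.

Lemma bigmeet_le f i n : (i <= n)%N -> bigmeet f n <=| f i.
Proof.
elim: n => [|n IH] /=; first by rewrite leqn0 => /eqP ->; exact: (le_refl gl).
rewrite leq_eqVlt => /orP[/eqP -> |/IH h]; first exact: meetr.
exact: (le_trans gl (meetl gl _ _)).
Qed.

Lemma le_bigmeet f z n : (forall i, z <=| f i) -> z <=| bigmeet f n.
Proof. by move=> zf; elim: n => [|n IH] //=; apply: le_meet. Qed.

Lemma bigmeet_cset f x n : (forall i, cset x (f i)) -> cset x (bigmeet f n).
Proof. by move=> zf; elim: n => [|n IH] //=; apply: cset_meet. Qed.

Lemma bigmeet_mono f m n : (m <= n)%N -> bigmeet f n <=| bigmeet f m.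
Proof.
move=> /subnK <-; elim: (n - m)%N => [|k IH] /=; first exact: (le_refl gl).
exact: (le_trans gl (meetl gl _ _)).
Qed.

(** The partial meets descend but stay above [z], so their length over [z] becomes constant: the
    infinite meet is a finite one. *)
Lemma bigmeet_glb f z : (forall i, z <=| f i) ->
  exists n, forall i, bigmeet f n <=| f i.
Proof.
move=> zf.
have [n _ hn] := @nat_argmin nat (fun _ => True) (fun n => nu (z^-1 * bigmeet f n))
  (ex_intro _ 0%N I).
exists n => i; have [/bigmeet_le//|ni] := leqP i n.
suff <- : bigmeet f i = bigmeet f n by apply: bigmeet_le.
have Pz j : P (z^-1 * bigmeet f j) by exact: (le_bigmeet j zf).
apply/(mulgI z^-1)/(le_nu_eq gl) => //.
  by rewrite lediv_mul2l; apply: bigmeet_mono; exact: ltnW.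
apply/eqP; rewrite eqn_leq hn // andbT; apply: (le_nu gl) => //.
by rewrite lediv_mul2l; apply: bigmeet_mono; exact: ltnW.
Qed.

Section DescentTheorem.
(** In the applications [A b] is [x b ^+ k b]. The chain hypotheses express that consecutive blocks
    glue to a normal form, and [headEl] that [v n.+1] cannot be enlarged towards [v n] within its
    set. *)
Variables (x A : bool -> G) (v : nat -> G) (El bl : nat -> seq G) (r : nat).
Hypothesis vC : forall n, cset (x (odd n)) (v n).
Hypothesis vEl : forall n, v n = v n.+1 * prods (El n).
Hypothesis vbl : forall n, A (odd n.+1) * v n = v n.+1 * prods (bl n).
Hypothesis lEl : forall n, letters P D (El n).
Hypothesis lbl : forall n, letters P D (bl n).
Hypothesis bl0 : forall n, bl n <> [::].
Hypothesis El0 : forall n, El n <> [::].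
Hypothesis cbl : forall n, lwchain P D (bl n.+1 ++ bl n).
Hypothesis cEl : forall n, lwchain P D (El n.+1 ++ bl n).
Hypothesis headEl : forall n V, P V -> V <=| head 1 (El n) ->
  cset (x (odd n.+1)) (v n.+1 * V) -> V = 1.

Let X := A false * A true.

Fixpoint blocks (n : nat) : seq G :=
  if n is m.+1 then bl m ++ blocks m else [::].

Lemma blocks_letters n : letters P D (blocks n).
Proof. by elim: n => [|n IH] //=; apply/letters_cat. Qed.

Lemma blocks_chain n : lwchain P D (blocks n.+1).
Proof.
elim: n => [|n IH] /=.
  have := cbl 0; rewrite cats0; elim: (bl 1) => [|a s IH] //= h.
  by apply: IH; exact: (lwchain_tail h).
exact: lwchain_cat3.
Qed.

Lemma El_blocks_chain n : lwchain P D (El n.+1 ++ blocks n.+1).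
Proof. by apply: lwchain_cat3 => //; exact: blocks_chain. Qed.

Lemma power_blocks N : X ^+ N * v 0 = v N.*2 * prods (blocks N.*2).
Proof.
elim: N => [|N IH]; first by rewrite expg0 prods_nil; gsimp.
rewrite expgS -mulgA IH doubleS /= !prods_cat.
have := vbl N.*2; have := vbl N.*2.+1; rewrite /= odd_double /= => h1 h2.
by rewrite /X -!mulgA (mulgA (A true)) h2 -!mulgA (mulgA (A false)) h1 -!mulgA.
Qed.

(** [X ^+ N * v 0] is [v N.*2.+1] times a product whose normal form starts with [El N.*2]. If the
    join of [g] and [v N.*2.+1] exceeds the latter by [V], then the gcd of [V] and [D] divides the
    head of [El N.*2] and leads to another element of the set, so it is trivial by [headEl]. *)
Lemma le_power_next N g : cset (x true) g ->
  (0 < N)%N -> g <=| X ^+ N * v 0 -> g <=| v N.*2.+1.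
Proof.
move=> xg N0; rewrite power_blocks vEl -mulgA -prods_cat => gle.
have [m mE] : exists m, N.*2 = m.+1 by exists N.*2.-1; lia.
have xv : cset (x true) (v N.*2.+1) by have := vC N.*2.+1; rewrite /= odd_double.
have lW : letters P D (El N.*2 ++ blocks N.*2).
  by apply/letters_cat; split => //; exact: blocks_letters.
have cW : lwchain P D (El N.*2 ++ blocks N.*2) by rewrite mE; exact: El_blocks_chain.
have [V PV jE] := leE (joinr gl g (v N.*2.+1)).
have VW : V <=| prods (El N.*2 ++ blocks N.*2).
  rewrite -(lediv_mul2l P (v N.*2.+1)) -jE; apply: le_join => //.
  by apply: le_mulr; exact: (letters_pos gl lW).
have {}jE' : v N.*2.+1 * meet gl V D = meet gl (v N.*2.+1 * V) (v N.*2.+1 * D).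
  apply: (le_anti gl).
    by apply: le_meet; rewrite lediv_mul2l; [exact: meetl|exact: meetr].
  rewrite -(lediv_mul2l P (v N.*2.+1)^-1) mulKg; apply: le_meet.
    by rewrite -(lediv_mul2l P (v N.*2.+1)) mulVKg; exact: meetl.
  by rewrite -(lediv_mul2l P (v N.*2.+1)) mulVKg; exact: meetr.
have V1 : meet gl V D = 1.
  apply: (headEl (n := N.*2)); first by apply: pos_meet => //; exact: (posD gl).
    have := @El0 N.*2; move: lW cW VW; case: (El N.*2) => //= a s lW cW VW _.
    apply: (lwchain_head gl lW cW); first exact: meetr.
    exact: (le_trans gl (meetl gl _ _)).
  rewrite jE' /= odd_double -jE /=; apply: cset_meet; first exact: cset_join.
  by have := cset_Dn 1 xv; rewrite expg1.
suff VE1 : V = 1 by have := joinl gl g (v N.*2.+1); rewrite jE VE1 mulg1.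
(* A nontrivial [V] would have a first letter, and that letter would divide the trivial gcd of [V]
   and [D]. *)
have [n [_ Vn]] := le_Dbound gl V.
have [s [ls _ sE _]] := normal_form gl PV Vn.
case: s ls sE => [|a s] ls sE; first by rewrite -sE prods_nil.
have /letters_cons[[Pa a1 aD] ls'] := ls; case: a1; apply: (pos_inv_eq1 gl) => //.
rewrite -V1; apply: le_meet => //; rewrite -sE prods_cons; apply: le_mulr.
exact: (letters_pos gl ls').
Qed.

Hypothesis vr : forall n, v n <=| v n.+2 * D ^+ r.

Lemma v_desc n : v n.+1 <=| v n.
Proof. by rewrite (vEl n); apply: le_mulr; exact: (letters_pos gl (@lEl n)). Qed.

(* For u a counterexample, the meets over N of v (2 N) D^(m N) and of
   v (2 N + 1) D^(m N) would exist and be at distance m. *)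
Lemma descent_inf m :
  (forall g h, cset (x false) g -> cset (x true) h -> h <=| g -> ~ g <=| h * D ^+ m) ->
  forall u, ~ u <=| X * u * D ^+ m.
Proof.
move=> far u uX.
have uXN N := iter_le N uX.
have [c [uc vc]] := two_sided_bound u (v 0).
have x1 : cset (x true) (v 1) by have := vC 1.
(* The chain is v 1, v 0, u, X^N u, X^N v 0, up to powers of [D]. The bound [c] is paid twice, once
   in each direction between [u] and [v 0]; the resulting bound is independent of N, so the infinite
   meets below exist. *)
have low N : v 1 * D ^- (c + c) <=| v N.*2.+1 * D ^+ (m * N).
  case: N => [|N]; first by rewrite muln0 expg0 mulg1; apply: (le_divDnl gl); exact: (le_Dn gl).
  have : v 1 * D ^- (m * N.+1 + (c + c)) <=| v N.+1.*2.+1.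
    apply: le_power_next => //; first exact: cset_DVn.
    apply: (le_divDnl gl); apply: (le_trans gl (v_desc 0)).
    apply: (le_trans gl vc); rewrite addnA expgnDr !mulgA; apply/(le_mulDn gl c).
    apply: (le_trans gl (uXN N.+1)); rewrite addnC expgnDr !mulgA; apply/(le_mulDn gl).
    by rewrite -!mulgA lediv_mul2l.
  by move/(le_mulDn gl (m * N.+1)); rewrite expgnDr; gsimp.
pose f1 N := v N.*2.+1 * D ^+ (m * N); pose f0 N := v N.*2 * D ^+ (m * N).
have f10 N : f1 N <=| f0 N by apply/(le_mulDn gl); exact: v_desc.
have [M1 hM1] := bigmeet_glb low.
have [M0 hM0] := @bigmeet_glb f0 _ (fun N => le_trans gl (low N) (f10 N)).
apply: (far (bigmeet f0 M0) (bigmeet f1 M1)).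
- apply: bigmeet_cset => N; apply: cset_Dn.
  by have := vC N.*2; rewrite odd_double.
- apply: bigmeet_cset => N; apply: cset_Dn.
  by have := vC N.*2.+1; rewrite /= odd_double.
- by apply: le_bigmeet => N; exact: (le_trans gl (hM1 N) (f10 N)).
(* Shift by one index: [f0 N.+1] is below [f1 N * D ^+ m], because [v N.*2.+2] is below
   [v N.*2.+1]. *)
- suff /(le_mulDn gl m) : bigmeet f0 M0 * D ^- m <=| bigmeet f1 M1 by gsimp.
  apply: le_bigmeet => N; apply: (le_divDnl gl); apply: (le_trans gl (hM0 N.+1)).
  rewrite /f0 /f1 mulnS addnC expgnDr mulgA; apply/(le_mulDn gl); apply/(le_mulDn gl).
  by rewrite doubleS; exact: v_desc.
Qed.

Lemma descent_sup q :
  (forall n, (size (bl n) + size (bl n.+1))%N = (r + q).+1) ->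
  forall u, ~ X * u <=| u * D ^+ q.
Proof.
move=> sz u uX.
have szb N : size (blocks N.*2) = (N * (r + q).+1)%N.
  elim: N => [|N IH]; first by [].
  by rewrite doubleS /= !size_cat IH -(sz N.*2); lia.
have vN N : v 0 <=| v N.*2 * D ^+ (r * N).
  elim: N => [|N IH]; first by rewrite muln0 expg0; gsimp; exact: (le_refl gl).
  apply: (le_trans gl IH); rewrite mulnS expgnDr mulgA; apply/(le_mulDn gl).
  exact: vr.
have [c [uc vc]] := two_sided_bound u (v 0).
(* The blocks have [N * (r + q).+1] letters, but their product lies below the power
   [(r + q) * N + 2 * c] of [D]. This forces N to be at most 2 c. *)
pose N := (c + c).+1.
have : prods (blocks N.*2) <=| D ^+ (r * N + (q * N + (c + c))).
  rewrite -(lediv_mul2l P (v N.*2)) -power_blocks.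
  apply: (@le_trans _ _ _ _ gl (X ^+ N * u * D ^+ c)).
    by rewrite -mulgA lediv_mul2l.
  apply: (@le_trans _ _ _ _ gl (u * D ^+ (q * N) * D ^+ c)).
    by apply/(le_mulDn gl); exact: iter_ge.
  apply: (@le_trans _ _ _ _ gl (v 0 * D ^+ c * (D ^+ (q * N) * D ^+ c))).
    by rewrite -mulgA -!expgnDr; apply/(le_mulDn gl).
  have e : (c + (q * N + c) = q * N + (c + c))%N by lia.
  rewrite -mulgA -!expgnDr e [D ^+ (r * N + _)]expgnDr mulgA.
  by apply/(le_mulDn gl).
have cN : lwchain P D (blocks N.*2) by rewrite /N doubleS; exact: blocks_chain.
move/(lwchain_size gl (@blocks_letters N.*2) cN); rewrite szb /N; nia.
Qed.

End DescentTheorem.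
End Descent.

(** * Summit infimum and length *)

Section Summit.
Variables (G : groupType) (P : set G) (D : G) (nu : G -> nat).
Hypothesis gl : garside_length P D nu.
Hypothesis D1 : D <> 1.
Local Notation "a <=| b" := (lediv P a b) (at level 70, no associativity).

Lemma zexpg_shift (p : int) (n : nat) :
  (0 <= p + Posz n)%R -> zexpg D p * D ^+ n = D ^+ (absz (p + Posz n)%R).
Proof.
case: p => p /=; first by rewrite -expgnDr.
move=> h; have [m nE] : exists m, n = (p.+1 + m)%N by exists (n - p.+1)%N; lia.
by rewrite nE expgnDr; gsimp; congr (_ ^+ _); lia.
Qed.

Lemma zexpg_shiftV (p : int) (n : nat) :
  (p + Posz n <= 0)%R -> zexpg D p * D ^+ n = D ^- (absz (p + Posz n)%R).
Proof.
case: p => p /= h.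
  have -> : p = 0%N by lia. have -> : n = 0%N by lia. by rewrite expg0; gsimp.
have [m nE] : exists m, p.+1 = (n + m)%N by exists (p.+1 - n)%N; lia.
by rewrite nE expgnDr; gsimp; congr (_ ^- _); lia.
Qed.

Lemma left_weighted_lw a b : P a -> P b -> a <=| D ->
  left_weighted P D a b <-> lw P D a b.
Proof.
move=> Pa Pb aD; split=> [[_ _ h] p Pp pb apD|h].
  apply: (mulgI a); rewrite mulg1; apply: (le_anti gl); last exact: le_mulr.
  by apply: h => //; rewrite lediv_mul2l.
split=> // [|z zab zD]; first exact: le_mulr.
have [p Pp jE] := leE (joinl gl a z).
have apD : a * p <=| D by rewrite -jE; apply: le_join.
have pb : p <=| b by rewrite -(lediv_mul2l P a) -jE; apply: le_join => //; exact: le_mulr.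
by have := joinr gl a z; rewrite jE (h p) // mulg1.
Qed.

Lemma nth_lwchain s : lwchain P D s <->
  forall i, (i.+1 < size s)%N -> lw P D (nth 1 s i) (nth 1 s i.+1).
Proof.
elim: s => [|a [|b s] IH] //.
split=> [[ab /IH h] [|i] //= ih|h]; first exact: (h i).
by split; [exact: (h 0%N)|apply/IH => i ih; exact: (h i.+1)].
Qed.

Lemma proper_simpleP a : proper_simple P D a <-> letter P D a /\ a <> D.
Proof. by rewrite /proper_simple /simple_elt /letter /= le1P; split=> [[[? ?] ? ?]|[[? ? ?] ?]]. Qed.

Lemma is_left_normal_formP X p s : is_left_normal_form P D X (p, s) <->
  [/\ X = zexpg D p * prods s, letters P D s, forall a, a \in s -> a <> D
    & lwchain P D s].
Proof.
split=> [[/= XE ps ws]|[XE ls nD ch]].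
  have ls : letters P D s by move=> a /ps/proper_simpleP[].
  split=> // [a /ps/proper_simpleP[]//|]; apply/nth_lwchain => i ih.
  have [Pa _ aD] : letter P D (nth 1 s i) by apply: ls; apply: mem_nth; exact: ltnW.
  have [Pb _ _] : letter P D (nth 1 s i.+1) by apply: ls; exact: mem_nth.
  by apply/left_weighted_lw => //; exact: ws.
split=> //= [a as_|i ih]; first by apply/proper_simpleP; split; [exact: ls|exact: nD].
have [Pa _ aD] : letter P D (nth 1 s i) by apply: ls; apply: mem_nth; exact: ltnW.
have [Pb _ _] : letter P D (nth 1 s i.+1) by apply: ls; exact: mem_nth.
by apply/left_weighted_lw => //; move/nth_lwchain: ch; exact.
Qed.

(** [D] can stand only at the front of a chain: if [a] is followed by [D], then the prefix
    [a^-1 * D] of [D] has a simple product with [a], so it is trivial. *)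
Lemma lwchain_proper a s : letters P D (a :: s) -> lwchain P D (a :: s) -> a <> D ->
  forall b, b \in a :: s -> b <> D.
Proof.
elim: s a => [|b s IH] a ls ch aD c; first by rewrite inE => /eqP ->.
rewrite in_cons => /orP[/eqP -> //|].
have /letters_cons[[Pa _ aD'] ls'] := ls.
apply: IH => //; first exact: lwchain_tail ch.
move=> bD; case: ch => ab _; apply: aD.
apply: (mulgI a^-1); rewrite mulVg; apply/esym/ab => //; last by rewrite mulVKg; exact: (le_refl gl).
by rewrite bD; apply: (simple_factor gl Pa); rewrite mulVKg; exact: (le_refl gl).
Qed.

Lemma lwchain_splitD s : letters P D s -> lwchain P D s ->
  exists j s', [/\ prods s = D ^+ j * prods s', letters P D s',
    forall a, a \in s' -> a <> D & lwchain P D s'].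
Proof.
elim: s => [|a s IH] ls ch.
  by exists 0%N, [::]; split => //; rewrite expg0 mul1g.
have [aD|aD] := EM (a = D); last first.
  by exists 0%N, (a :: s); split => //; [rewrite expg0 mul1g|exact: lwchain_proper].
have /letters_cons[_ ls'] := ls.
have [j [s' [sE ls1 nD ch']]] := IH ls' (lwchain_tail ch).
by exists j.+1, s'; split => //; rewrite prods_cons sE aD expgS mulgA.
Qed.

Lemma left_normal_form_ex X : exists d, is_left_normal_form P D X d.
Proof.
have [n [n1 n2]] := le_Dbound gl X.
have PX : P (D ^+ n * X) by move: n1; rewrite /lediv; gsimp.
have XD : D ^+ n * X <=| D ^+ (n + n) by rewrite expgnDr lediv_mul2l.
have [s [ls ch sE _]] := normal_form gl PX XD.
have [j [s' [sE' ls' nD ch']]] := lwchain_splitD ls ch.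
exists ((Posz j - Posz n)%R, s'); apply/is_left_normal_formP; split => //.
apply: (mulgI (D ^+ n)); rewrite -sE sE' !mulgA; congr (_ * _).
apply: (mulIg (D ^+ n)); rewrite -mulgA zexpg_shift ?subrK //= -!expgnDr.
by rewrite addnC.
Qed.

Lemma nfP X : is_left_normal_form P D X (ginf P D X, (left_normal_form P D X).2).
Proof.
have := xgetPex (0%R, [::]) (left_normal_form_ex X).
by rewrite -/(left_normal_form P D X) /ginf; case: (left_normal_form P D X).
Qed.

Lemma zexpg_mulD_le p n m : (p + Posz n <= Posz m)%R -> zexpg D p * D ^+ n <=| D ^+ m.
Proof.
move=> h; have [h0|h0] := leP 0%R (p + Posz n)%R.
  by rewrite zexpg_shift // -[D ^+ _]mul1g -[D ^+ m]mul1g; apply: (le_Dleq gl); lia.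
rewrite zexpg_shiftV ?ltW // /lediv; gsimp; rewrite -expgnDr.
by apply: (posX gl); exact: posD gl.
Qed.

Lemma zexpg_mulD_pos p n : (0 <= p + Posz n)%R -> P (zexpg D p * D ^+ n).
Proof. by move=> h; rewrite zexpg_shift //; apply: (posX gl); exact: posD gl. Qed.

Lemma prods_le_D s : letters P D s -> prods s <=| D ^+ size s.
Proof.
elim: s => [|a s IH] ls; first by rewrite prods_nil expg0; exact: (le_refl gl).
have /letters_cons[[Pa _ aD] ls'] := ls.
rewrite prods_cons /= expgSr; apply: (@le_trans _ _ _ _ gl (a * D ^+ size s)).
  by rewrite lediv_mul2l; exact: IH.
by rewrite -expgSr expgS; apply/(le_mulDn gl).
Qed.

Lemma nf_inf_lt X Y p s m : (forall u, ~ u <=| X * u * D ^+ m) ->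
  cclass X Y -> is_left_normal_form P D Y (p, s) -> (p < - Posz m)%R.
Proof.
move=> hX [z _ <-] /is_left_normal_formP[YE ls _ _]; rewrite ltNge; apply/negP => pm.
apply: (hX z); rewrite /lediv; have -> : z^-1 * (X * z * D ^+ m) = X ^ z * D ^+ m.
  by rewrite /conjg; gsimp.
have -> : X ^ z * D ^+ m = zexpg D p * D ^+ m * (D ^- m * prods s * D ^+ m).
  by rewrite YE; gsimp.
apply: (posM gl); first by apply: zexpg_mulD_pos; lia.
by apply/(pos_conjDn gl); exact: (letters_pos gl).
Qed.

Lemma nf_sup_gt X Y p s m : (forall u, ~ X * u <=| u * D ^+ m) ->
  cclass X Y -> is_left_normal_form P D Y (p, s) -> (Posz m < p + Posz (size s))%R.
Proof.
move=> hX [z _ <-] /is_left_normal_formP[YE ls _ _]; rewrite ltNge; apply/negP => pm.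
apply: (hX z); rewrite -(lediv_mul2l P z^-1) mulKg.
have -> : z^-1 * (X * z) = X ^ z by [].
rewrite YE; apply: (@le_trans _ _ _ _ gl (zexpg D p * D ^+ size s)).
  by rewrite lediv_mul2l; exact: prods_le_D.
exact: zexpg_mulD_le.
Qed.

(** If p were smaller than -m, then [D] would divide [prods s], hence its first letter, which would
    then be [D]. *)
Lemma nf_inf_ge X p s m : is_left_normal_form P D X (p, s) -> D ^- m <=| X ->
  (- Posz m <= p)%R.
Proof.
move=> /is_left_normal_formP[XE ls nD ch] mX; rewrite leNgt; apply/negP => pm.
have : D ^+ absz (p + Posz m)%R <=| prods s.
  move: mX; rewrite /lediv => /(pos_conjDn gl m) h; apply/(pos_conjDn gl m).
  have := @zexpg_shiftV p m _; rewrite ltW; last by lia.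
  move=> /(_ isT) zE.
  have -> : D ^- m * ((D ^+ absz (p + Posz m)%R)^-1 * prods s) * D ^+ m =
    (zexpg D p * D ^+ m) * (D ^- m * prods s * D ^+ m).
    rewrite zE mulgA -invgM -expgnDr addnC expgnDr invgM; gsimp.
    by [].
  by move: h; rewrite XE; gsimp.
case e : (absz (p + Posz m)%R) => [|k]; first by lia.
move=> Ds; have {Ds} : D <=| prods s.
  by apply: (le_trans gl _ Ds); rewrite expgS; exact: (le_Dn gl).
case: s XE ls nD ch => [|a s] XE ls nD ch h.
  by apply: D1; apply: (pos_inv_eq1 gl); [exact: posD gl|rewrite -(prods_nil G)].
apply: (nD a); first exact: mem_head.
have /letters_cons[[_ _ aD] _] := ls.
apply: (le_anti gl) => //; apply: (lwchain_head gl ls ch) => //; exact: (le_refl gl).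
Qed.

Lemma nf_size_le X s m q : is_left_normal_form P D X ((- Posz m)%R, s) ->
  X <=| D ^+ q -> (size s <= m + q)%N.
Proof.
move=> /is_left_normal_formP[XE ls nD ch] Xq; apply: (lwchain_size gl) => //.
rewrite expgnDr -(lediv_mul2l P (D ^- m)) mulKg.
suff -> : D ^- m * prods s = X by [].
by rewrite XE; congr (_ * _); case: m {XE Xq} => //; rewrite expg0 invg1.
Qed.

Lemma set_max_eq (A : set int) m : A m -> ubound A m -> set_max A = m.
Proof.
move=> Am uA; have [h1 h2] := xgetI 0%R (conj Am uA : (A `&` ubound A) m).
by apply/eqP; rewrite eq_le uA // h2.
Qed.

Lemma set_min_eq (A : set nat) m : A m -> lbound A m -> set_min A = m.
Proof.
move=> Am uA; have [h1 h2] := xgetI 0%N (conj Am uA : (A `&` lbound A) m).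
by apply/eqP; rewrite eq_le uA // h2.
Qed.

(** The last hypothesis provides one conjugate that attains the best infimum and the best supremum
    together; this is why the summit length is their difference. *)
Theorem summit_values X d q :
  (forall u, ~ u <=| X * u * D ^+ d) -> (forall u, ~ X * u <=| u * D ^+ q) ->
  (exists u, u <=| X * u * D ^+ d.+1 /\ X * u <=| u * D ^+ q.+1) ->
  summit_inf P D X = (- Posz d.+1)%R /\ summit_len P D X = (d.+1 + q.+1)%N.
Proof.
move=> hd hq [u [u1 u2]].
have XuC : cclass X (X ^ u) by exists u.
have glen_gt Y : cclass X Y -> (Posz q < ginf P D Y + Posz (glen P D Y))%R.
  by move=> /nf_sup_gt h; apply: h hq (nfP Y).
have ginf_lt Y : cclass X Y -> (ginf P D Y < - Posz d)%R.
  by move=> /nf_inf_lt h; apply: h hd (nfP Y).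
have ginfu : ginf P D (X ^ u) = (- Posz d.+1)%R.
  apply/eqP; rewrite eq_le; apply/andP; split; first by have := ginf_lt _ XuC; lia.
  apply: nf_inf_ge (nfP _) _; rewrite /lediv invgK.
  by move: u1; rewrite /lediv => h; apply/(pos_conjDn gl d.+1); move: h; rewrite /conjg; gsimp.
split.
  apply: set_max_eq; first by exists (X ^ u).
  by move=> _ [Y XY <-]; have := ginf_lt _ XY; lia.
apply: set_min_eq; last first.
  move=> _ [Y XY <-]; have h1 := ginf_lt _ XY; have h2 := glen_gt _ XY.
  suff : (d.+1 + q.+1 <= glen P D Y)%N by [].
  lia.
exists (X ^ u) => //; apply/eqP; rewrite eqn_leq; apply/andP; split; last first.
  have := glen_gt _ XuC; rewrite ginfu; lia.
have := nfP (X ^ u); rewrite ginfu => /nf_size_le; apply.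
by move: u2; rewrite -(lediv_mul2l P u^-1) mulKg.
Qed.

Theorem summit_inf_ge0 X u : u <=| X * u -> ~ (summit_inf P D X < 0)%R.
Proof.
(* If there were no maximum, [set_max] would return its default value 0, which is not negative
   either. *)
move=> uX; rewrite /summit_inf /set_max; case: xgetP => // m _ [_ h]; apply/negP.
rewrite -leNgt; have XuC : cclass X (X ^ u) by exists u.
suff : (0 <= ginf P D (X ^ u))%R by move=> h0; apply: (Order.POrderTheory.le_trans h0); apply: h; exists (X ^ u).
rewrite -oppr0; apply: (nf_inf_ge (m := 0) (nfP _)).
by move: uX; rewrite expg0 invg1 le1P /lediv /conjg.
Qed.

End Summit.

(** * Distance between the sets of positive conjugators *)

Section Distance.
Variables (G : groupType) (P : set G) (D : G) (nu : G -> nat).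
Hypothesis gl : garside_length P D nu.
Local Notation "a <=| b" := (lediv P a b) (at level 70, no associativity).
Local Notation cset := (cset P).

Definition unit_length (a : G) : Prop := P a /\ nu a = 1%N.

Definition conj_unit (x : G) : Prop := exists y z, unit_length y /\ x = y ^ z.

Lemma csetE x g : cset x g = P (x ^ g).
Proof. by []. Qed.

Lemma unit_neq1 a : unit_length a -> a <> 1.
Proof. by move=> [_ a1] aE; move: a1; rewrite aE (nu1 gl). Qed.

Lemma le_unit p a : unit_length a -> P p -> p <=| a -> p = 1 \/ p = a.
Proof.
move=> [Pa a1] Pp pa; have := le_nu gl Pp pa; rewrite a1.
case e : (nu p) => [|[|n]] // _; first by left; exact: (gl_eq0 gl).
by right; apply: (le_nu_eq gl) => //; rewrite e a1.
Qed.

(** [nu] is additive on [P] only. A power of [D] makes the conjugator positive, and the lengths of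
    two expressions for the same product are compared. *)
Lemma conj_unit_at x g : conj_unit x -> cset x g -> unit_length (x ^ g).
Proof.
move=> [y [z [[Py y1] ->]]]; rewrite csetE -conjgM => Px'; split => //.
set w := z * g in Px' *.
have [n [n1 _]] := le_Dbound gl w.
have Pp : P (D ^+ n * w) by move: n1; rewrite /lediv; gsimp.
have Dn : P (D ^+ n) by apply: (posX gl); exact: posD gl.
have Py' : P (D ^+ n * y * D ^- n) by apply/(pos_conjDn gl n); gsimp.
have e1 : nu (D ^+ n * y * D ^- n * D ^+ n) = nu (D ^+ n * y) by congr nu; gsimp.
have e2 : nu (D ^+ n * y * D ^- n * (D ^+ n * w)) = nu (D ^+ n * w * y ^ w).
  by congr nu; rewrite /conjg; gsimp.
rewrite (gl_M gl Py' Dn) (gl_M gl Dn Py) in e1.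
rewrite (gl_M gl Py' Pp) (gl_M gl Pp Px') in e2; lia.
Qed.

Lemma cset_ex x : conj_unit x -> exists g, cset x g.
Proof.
by move=> [y [z [[Py _] ->]]]; exists z^-1; rewrite csetE conjgK.
Qed.

Definition is_proj (x u g : G) : Prop :=
  [/\ cset x g, g <=| u & forall g', cset x g' -> g' <=| u -> g' <=| g].

(** An element of the set below [u] with the shortest quotient to [u] is the greatest one, because
    the set is closed under joins. *)
Lemma proj_ex x u : conj_unit x -> exists g, is_proj x u g.
Proof.
move=> /cset_ex[h xh].
have [n [hn _]] := two_sided_bound gl h u.
have [|g [xg gu] gmin] := @nat_argmin G (fun g => cset x g /\ g <=| u) (fun g => nu (g^-1 * u)).
  by exists (h * D ^- n); split; [exact: (cset_DVn gl)|exact: (le_divDnl gl)].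
exists g; split => // g' xg' g'u.
have ju : join gl g g' <=| u by apply: le_join.
have := gmin (join gl g g') (conj (cset_join gl xg xg') ju).
have gj := joinl gl g g'.
have -> : nu (g^-1 * u) = (nu (g^-1 * join gl g g') + nu ((join gl g g')^-1 * u))%N.
  by rewrite -(gl_M gl) //; congr nu; gsimp.
move=> h1; have /(gl_eq0 gl gj) e : nu (g^-1 * join gl g g') = 0%N by lia.
have -> : g = join gl g g' by rewrite -[LHS]mulg1 -e mulVKg.
exact: joinr.
Qed.

Definition close (x y : G) (n : nat) : Prop :=
  exists g h, [/\ cset x g, cset y h, h <=| g & g <=| h * D ^+ n].

Lemma close_sym x y n : close x y n -> close y x n.
Proof.
move=> [g [h [xg yh hg gh]]]; exists h, (g * D ^- n); split => //.
- exact: (cset_DVn gl).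
- exact: (le_divDnl gl).
- by gsimp.
Qed.

Lemma close_ex x y : conj_unit x -> conj_unit y -> exists n, close x y n.
Proof.
move=> /cset_ex[g xg] /cset_ex[h yh].
have [n [gh hg]] := two_sided_bound gl g h.
exists (n + n)%N; exists g, (h * D ^- n); split => //.
- exact: (cset_DVn gl).
- exact: (le_divDnl gl).
- by rewrite expgnDr mulgA; gsimp.
Qed.

Lemma close_min x y : conj_unit x -> conj_unit y -> ~ close x y 0 ->
  exists r, close x y r.+1 /\ ~ close x y r.
Proof.
move=> cx cy; have [n] := close_ex cx cy; elim: n => [//|n IH] cn c0.
by have [/IH/(_ c0)//|cN] := EM (close x y n); exists n.
Qed.

Lemma close0 x y : close x y 0 -> exists g, cset x g /\ cset y g.
Proof.
move=> [g [h [xg yh hg]]]; rewrite expg0 mulg1 => gh.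
by exists g; split => //; rewrite (le_anti gl gh hg).
Qed.

(** A normal form with at most r letters would place [g] and [h] at distance r, so the length is
    exactly r + 1. *)
Lemma close_normal_form x y r g h : ~ close x y r ->
  cset x g -> cset y h -> h <=| g -> g <=| h * D ^+ r.+1 ->
  exists s, [/\ letters P D s, lwchain P D s, g = h * prods s & size s = r.+1].
Proof.
move=> far xg yh hg gh.
have ED : h^-1 * g <=| D ^+ r.+1 by rewrite -(lediv_mul2l P h) mulVKg.
have [s [ls ch sE sr]] := normal_form gl hg ED.
exists s; split => //; first by rewrite sE mulVKg.
apply/eqP; rewrite eqn_leq sr /= ltnNge; apply/negP => sr'.
apply: far; exists g, h; split => //.
rewrite -(mulVKg h g) lediv_mul2l -sE.
apply: (le_trans gl (prods_le_D gl ls)).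
by rewrite -[D ^+ size s]mul1g -[D ^+ r]mul1g; exact: (le_Dleq gl).
Qed.

Lemma far_bool x r : ~ close (x false) (x true) r ->
  forall b, ~ close (x b) (x (~~ b)) r.
Proof. by move=> far [] // /close_sym. Qed.

(* Projecting alternately on the two sets gives a descending sequence with all
   steps at the minimal distance. *)
Lemma descending_sequence (x : bool -> G) r :
  (forall b, conj_unit (x b)) -> close (x false) (x true) r.+1 ->
  exists v : nat -> G, [/\ forall n, cset (x (odd n)) (v n),
    forall n, is_proj (x (odd n.+1)) (v n) (v n.+1)
    & forall n, v n <=| v n.+1 * D ^+ r.+1].
Proof.
move=> cx [g [h [xg xh hg gh]]].
pose proj b u := projT1 (cid (proj_ex u (cx b))).
have projP b u : is_proj (x b) u (proj b u) by rewrite /proj; case: cid.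
pose v := fix v n := if n is m.+1 then proj (odd n) (v m) else g.
have vC n : cset (x (odd n)) (v n) by case: n => [|n] //; case: (projP (odd n.+1) (v n)).
exists v; split=> //.
elim=> [|n IH].
  apply: (le_trans gl gh); apply/(le_mulDn gl).
  by have [_ _] := projP true g; apply.
have [_ v1 _] := projP (odd n.+1) (v n).
have [_ _ v2] := projP (odd n.+2) (v n.+1).
apply: (le_trans gl v1); apply/(le_mulDn gl r.+1); gsimp.
suff : v n * D ^- r.+1 <=| v n.+2 by move=> h1; apply/(le_mulDn gl r.+1); move/(le_mulDn gl r.+1): h1; gsimp.
apply: v2; last exact: (le_divDnl gl).
by rewrite /= negbK; apply: (cset_DVn gl); exact: vC.
Qed.

Lemma lwchain_cat s t : lwchain P D s -> lwchain P D t ->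
  (s <> [::] -> t <> [::] -> lw P D (last 1 s) (head 1 t)) -> lwchain P D (s ++ t).
Proof.
move=> cs ct h; case: s cs h => [|a s] //= cs h.
elim: s a cs h => [|b s IH] a cs h.
  by split => //; case: t {ct} h => // b t h; exact: h.
by case: cs => ab cs; split => //; apply: IH => // _ t0; exact: h.
Qed.

Lemma lwchain_nseq n a : ((1 < n)%N -> lw P D a a) -> lwchain P D (nseq n a).
Proof.
elim: n => [|[|n] IH] // h; split; first exact: h.
by apply: IH => _; exact: h.
Qed.

Lemma letters_nseq n a : letter P D a -> letters P D (nseq n a).
Proof. by move=> la b; rewrite mem_nseq => /andP[_ /eqP ->]. Qed.

End Distance.

Lemma last_nseq (T : Type) m (a b : T) : (0 < m)%N -> last b (nseq m a) = a.
Proof. by case: m => // m _; elim: m. Qed.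

(** * Symmetric homogeneous structures *)

Section Common.
Variables (G : groupType) (P : set G) (D : G) (nu : G -> nat).
Hypothesis gl : garside_length P D nu.
Local Notation "a <=| b" := (lediv P a b) (at level 70, no associativity).
Local Notation cset := (cset P).
Local Notation unit_length := (unit_length P nu).
Local Notation conj_unit := (conj_unit P nu).

Lemma unit_le_D a : unit_length a -> a <=| D.
Proof.
move=> ua; have [Pa _] := ua; have [n [_ aD]] := le_Dbound gl a.
have [[|b s] [ls _ sE _]] := normal_form gl Pa aD.
  by case: (unit_neq1 gl ua); rewrite -sE prods_nil.
have /letters_cons[[Pb b1 bD] ls'] := ls.
have ba : b <=| a by rewrite -sE prods_cons; apply: le_mulr; exact: (letters_pos gl ls').
by case: (le_unit gl ua Pb ba) => [//|<-].
Qed.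

Lemma unit_letter a : unit_length a -> letter P D a.
Proof. by move=> ua; split; [case: ua|exact: (unit_neq1 gl)|exact: unit_le_D]. Qed.

Lemma unit_X_le_D a n : unit_length a -> a ^+ n <=| D ^+ n.
Proof.
move=> ua; have := prods_le_D gl (@letters_nseq _ _ _ n _ (unit_letter ua)).
by rewrite prods_nseq size_nseq.
Qed.

Lemma mulX_conj (x g : G) k : x ^+ k * g = g * (x ^ g) ^+ k.
Proof. by rewrite -conjXg; exact: conjgC. Qed.

Section Sequence.
Variables (x : bool -> G) (r : nat) (v : nat -> G).
Hypothesis vC : forall n, cset (x (odd n)) (v n).
Hypothesis vP : forall n, is_proj P (x (odd n.+1)) (v n) (v n.+1).
Hypothesis vD : forall n, v n <=| v n.+1 * D ^+ r.+1.

(** [v n * D ^- r.+1] belongs to the set of [x (odd n)] and lies below [v n.+1], hence below the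
    projection [v n.+2]. *)
Lemma sequence_return n : v n <=| v n.+2 * D ^+ r.+1.
Proof.
have [_ _ h] := vP n.+1.
suff : v n * D ^- r.+1 <=| v n.+2 by move/(le_mulDn gl r.+1); rewrite mulgVK.
apply: h; last exact: (le_divDnl gl).
by rewrite /= negbK; apply: (cset_DVn gl); exact: vC.
Qed.

Lemma sequence_inf_bound (k : bool -> nat) :
  v 0 <=| x false ^+ k false * x true ^+ k true * v 0 * D ^+ r.+1.
Proof.
have [_ v10 _] := vP 0; have C0 := vC 0; have C1 := vC 1.
apply: (le_trans gl (cset_X gl (k false) C0)); rewrite -!mulgA lediv_mul2l !mulgA.
apply: (le_trans gl (vD 0)); apply/(le_mulDn gl).
apply: (le_trans gl (cset_X gl (k true) C1)).
by rewrite lediv_mul2l.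
Qed.

End Sequence.

Section Symmetric.
Variables (x : bool -> G) (k : bool -> nat).
Hypothesis cx : forall b, conj_unit (x b).
Hypothesis k0 : forall b, (0 < k b)%N.
Hypothesis sym : symmetric_structure P D.
Hypothesis sqf : forall b, (1 < k b)%N -> forall z, unit_length z -> ~ z * z <=| D.

Let X := x false ^+ k false * x true ^+ k true.

Theorem summit_symmetric r : D <> 1 ->
  close P D (x false) (x true) r.+1 -> ~ close P D (x false) (x true) r ->
  summit_inf P D X = (- Posz r.+1)%R /\
  summit_len P D X = (r.+1 + (r + k false + k true).+1)%N.
Proof.
move=> D1 cl far.
have [v [vC vP vD]] := descending_sequence gl cx cl.
have farb := far_bool gl far.
have exE n : exists s, [/\ letters P D s, lwchain P D s, v n = v n.+1 * prods s & size s = r.+1].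
  apply: (close_normal_form gl (farb (odd n))) => //.
    by case: (vP n).
  by case: (vP n).
pose El n := projT1 (cid (exE n)).
have ElP n : [/\ letters P D (El n), lwchain P D (El n), v n = v n.+1 * prods (El n)
  & size (El n) = r.+1] by rewrite /El; case: cid.
pose z n := x (odd n) ^ v n.
have uz n : unit_length (z n) by exact: (conj_unit_at gl).
pose bl n := nseq (k (odd n.+1)) (z n.+1) ++ El n.
have lEl n : letters P D (El n) by case: (ElP n).
have El0 n : El n <> [::] by case: (ElP n) => _ _ _; case: (El n).
have headP n V : P V -> V <=| head 1 (El n) -> cset (x (odd n.+1)) (v n.+1 * V) -> V = 1.
  move=> PV VE xV; have [_ _ vmax] := vP n; have [ls _ vE _] := ElP n.
  apply: (pos_inv_eq1 gl) => //; rewrite -(lediv_mul2l P (v n.+1)) mulg1; apply: vmax => //.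
  rewrite vE lediv_mul2l; apply: (le_trans gl VE).
  case: (El n) (El0 n) ls => // a s _ ls; rewrite prods_cons; apply: le_mulr.
  by have /letters_cons[_ ls'] := ls; exact: (letters_pos gl ls').
(* Symmetry turns the right divisor [p] of [z n.+1 * p] into a left divisor. So [p] conjugates
   [z n.+1] to a positive element, and the maximality of the projection makes [p] trivial. *)
have lw_head n : lw P D (z n.+1) (head 1 (El n)).
  move=> p Pp pE zpD; apply: (headP n) => //.
  have sp : simple_elt P D p.
    by split; [rewrite le1P|apply: (simple_factor gl _ zpD); case: (uz n.+1)].
  have szp : simple_elt P D (z n.+1 * p).
    by split; [rewrite le1P; apply: (posM gl) => //; case: (uz n.+1)|].
  rewrite csetE conjgM -/(z n.+1) /conjg.
  suff : lediv P p (z n.+1 * p) by [].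
  by apply/(sym sp szp); rewrite /gediv mulgK; case: (uz n.+1).
(* If [e * z n.+1] were simple for the last letter [e], then [e * z n.+1 * e^-1] would be positive
   by symmetry, and [v n.+1 * e^-1] would be at distance r from [v n.+2]. *)
have lw_last n : lw P D (last 1 (El n.+1)) (z n.+1).
  move=> p Pp pz; case: (le_unit gl (uz n.+1) Pp pz) => [//|->] {p Pp pz} ezD.
  have [ls _ vE sE] := ElP n.+1; case: (lastP (El n.+1)) (El0 n.+1) ls vE sE ezD => // s e _.
  rewrite last_rcons -cats1 size_cat addn1 prods_cat prods_cons prods_nil mulg1.
  move=> ls vE [sE] ezD; have [lss /letters_cons[[Pe _ eD] _]] := (letters_cat P D _ _).1 ls.
  have [Pz _] := uz n.+1.
  have se : simple_elt P D e by split => //; rewrite le1P.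
  have sez : simple_elt P D (e * z n.+1) by split => //; rewrite le1P; apply: (posM gl).
  have zC : P (e * z n.+1 * e^-1) by apply/(sym se sez); exact: le_mulr.
  case: (farb (odd n.+1)); exists (v n.+1 * e^-1), (v n.+2); split.
  - by rewrite csetE conjgM -/(z n.+1) /conjg invgK mulgA.
  - exact: vC.
  - by rewrite vE mulgA mulgK; apply: le_mulr; exact: (letters_pos gl).
  - by rewrite vE mulgA mulgK lediv_mul2l -sE; exact: (prods_le_D gl).
have lz n : letter P D (z n) by exact: unit_letter.
have lbl n : letters P D (bl n) by apply/letters_cat; split => //; exact: letters_nseq.
have hd_nseq n s : head 1 (nseq (k (odd n.+1)) (z n.+1) ++ s) = z n.+1.
  by case: (k _) (k0 (odd n.+1)).
have nseq0 n : nseq (k (odd n.+1)) (z n.+1) <> [::] by case: (k _) (k0 (odd n.+1)).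
have cbl1 n : lwchain P D (bl n).
  apply: lwchain_cat; last 2 first.
  - by case: (ElP n).
  - by move=> _ _; rewrite last_nseq.
  apply: lwchain_nseq => k1 p Pp pz; case: (le_unit gl (uz n.+1) Pp pz) => [//|->] zzD.
  by case: (sqf k1 (uz n.+1) zzD).
have cEl n : lwchain P D (El n.+1 ++ bl n).
  apply: lwchain_cat => //; first by case: (ElP n.+1).
  by move=> _ _; rewrite hd_nseq.
have cbl n : lwchain P D (bl n.+1 ++ bl n).
  by rewrite {1}/bl -catA; apply: lwchain_cat3; [exact: El0|exact: (cbl1 n.+1)|exact: cEl].
have vEl n : v n = v n.+1 * prods (El n) by case: (ElP n).
have szbl n : size (bl n) = (k (odd n.+1) + r.+1)%N.
  by rewrite size_cat size_nseq; case: (ElP n) => _ _ _ ->.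
have vbl n : x (odd n.+1) ^+ k (odd n.+1) * v n = v n.+1 * prods (bl n).
  by rewrite {1}vEl mulgA mulX_conj -/(z n.+1) prods_cat prods_nseq mulgA.
have bl0 n : bl n <> [::] by move=> /(congr1 size); rewrite szbl /= addnS.
have vret := sequence_return vC vP vD.
apply: (summit_values gl D1).
- apply: (@descent_inf _ _ _ _ gl x (fun b => x b ^+ k b) v El bl vC) => //.
  by move=> g h xg yh hg gh; apply: far; exists g, h.
- apply: (@descent_sup _ _ _ _ gl (fun b => x b ^+ k b) v bl r.+1) => // n.
  by rewrite !szbl /=; case: (odd n) => /=; lia.
- exists (v 0); split; first exact: sequence_inf_bound.
  (* The block at [v 0] costs [k true + r.+1] factors [D]; after returning from [v 1] up to [v 0],
     the remaining power of [z 0] costs [k false] more. *)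
  have [C0 C1] := (vC 0%N, vC 1%N); have [_ v10 _] := vP 0.
  apply: (@le_trans _ _ _ _ gl (x false ^+ k false * v 1%N * D ^+ (k true + r.+1))).
    rewrite /X -!mulgA lediv_mul2l.
    have := vbl 0; rewrite /= => ->; rewrite lediv_mul2l.
    by apply: (le_trans gl (prods_le_D gl (@lbl 0))); rewrite szbl; exact: (le_refl gl).
  apply: (@le_trans _ _ _ _ gl (x false ^+ k false * v 0 * D ^+ (k true + r.+1))).
    by apply/(le_mulDn gl); rewrite lediv_mul2l.
  rewrite mulX_conj -mulgA lediv_mul2l.
  apply: (@le_trans _ _ _ _ gl (D ^+ k false * D ^+ (k true + r.+1))).
    by apply/(le_mulDn gl); exact: (unit_X_le_D _ (uz 0)).
  rewrite -expgnDr; have -> : (k false + (k true + r.+1) = (r + k false + k true).+1)%N by lia.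
  exact: (le_refl gl).
Qed.
End Symmetric.
End Common.

(** * The additive length of a symmetric homogeneous structure *)

Section SymmetricHomogeneous.
Variables (G : groupType) (P : set G) (D : G).
Hypothesis gs : garside_structure P D.
Hypothesis sym : symmetric_structure P D.
Hypothesis hom : homogeneous P.
Local Notation "a <=| b" := (lediv P a b) (at level 70, no associativity).

Let PM a b : P a -> P b -> P (a * b).
Proof. by have [_] := garside_submonoid gs; apply. Qed.

Let P1 : P 1. Proof. by case: (garside_submonoid gs). Qed.

Let PD : P D. Proof. exact: garside_delta gs. Qed.

Lemma gnorm_max X : P X -> X <> 1 ->
  fact_lengths P X (gnorm P X) /\ forall k, fact_lengths P X k -> (k <= gnorm P X)%N.
Proof.
move=> PX X1; have [b hb] := garside_norm gs PX X1.
have X1f : fact_lengths P X 1%N.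
  by exists [:: X]; split => // [a|]; rewrite ?inE ?big_seq1 // => /eqP ->.
have [m mX mb] : exists2 m, fact_lengths P X m & forall k, fact_lengths P X k -> (k <= m)%N.
  have [m mX mb] := @nat_argmin nat (fact_lengths P X) (fun k => (b - k)%N) (ex_intro _ _ X1f).
  exists m => // k kX; have := mb _ kX; have : (k <= b)%N by exact: hb.
  have : (m <= b)%N by exact: hb. lia.
suff -> : gnorm P X = m by [].
have sm : supremums (fact_lengths P X) m.
  by split=> [k /mb //|k]; apply.
rewrite /gnorm /supremum; case: ifPn => [/eqP e|_]; first by move: mX; rewrite e.
by apply: (is_subset1_supremums (A := fact_lengths P X)); [exact: (xgetI _ sm)|].
Qed.

Lemma gnorm_eq0 X : P X -> gnorm P X = 0%N -> X = 1.
Proof.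
move=> PX X0; have [//|X1] := EM (X = 1).
have [_ h] := gnorm_max PX X1; have : (1 <= gnorm P X)%N.
  by apply: h; exists [:: X]; split => // [a|]; rewrite ?inE ?big_seq1 // => /eqP ->.
by rewrite X0.
Qed.

Lemma gnorm_atom x : atom P x -> gnorm P x = 1%N.
Proof.
move=> [Px x1 xat]; have [[s [<- sP xE]] h] := gnorm_max Px x1.
case: s sP xE {h} => [|a [|b s]] sP xE //; first by rewrite big_nil in xE.
have [Pa a1] := sP a (mem_head _ _).
have [Pb b1] : P b /\ b <> 1 by apply: sP; rewrite !inE eqxx orbT.
have Ps : P (\prod_(c <- s) c).
  have {}sP c : c \in s -> P c by move=> cs; case: (sP c) => //; rewrite !inE cs !orbT.
  elim: s sP {xE} => [|c s IH] sP; first by rewrite big_nil.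
  rewrite big_cons; apply: PM; first by apply: sP; rewrite mem_head.
  by apply: IH => d ds; apply: sP; rewrite inE ds orbT.
rewrite !big_cons in xE; case: (xat _ _ Pa (PM Pb Ps) xE) => // e.
case: b1; apply: (garside_pointed gs) => //.
by rewrite -(mulg1 b^-1) -e mulKg.
Qed.

Let simple := simple_elt P D.

(** Symmetry applied to [b <=| D] shows that the complement [D * b^-1] is simple. Taking the
    complement twice gives [D * a * D^-1]. *)
Lemma simple_conjV a : simple a -> simple (D * a^-1) /\ simple (D * a * D^-1).
Proof.
have s1 b : simple b -> simple (D * b^-1).
  move=> sb; split; last by rewrite /lediv; gsimp; case: sb; rewrite /lediv; gsimp.
  have sD : simple D by split; rewrite /lediv; gsimp.
  have [_ bD] := sb; rewrite /lediv; gsimp.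
  by have := (sym sb sD).1 bD.
move=> sa; split; first exact: s1.
have := s1 _ (s1 _ sa); gsimp; exact.
Qed.

Definition simples (l : seq G) : Prop := forall a, a \in l -> simple a.

Lemma simples_pos l : simples l -> P (prods l).
Proof.
elim: l => [|a l IH] h; first by rewrite prods_nil.
rewrite prods_cons; apply: PM.
  by have [] := h a (mem_head _ _); rewrite /lediv; gsimp.
by apply: IH => b bl; apply: h; rewrite inE bl orbT.
Qed.

(** [s] is pushed through the factors: its lcm with the first factor is simple, and its residue is
    again a simple element, dividing the remaining product. *)
Lemma simple_divides s l : simple s -> simples l -> s <=| prods l ->
  exists2 l', simples l' & prods l = s * prods l'.
Proof.
elim: l s => [|a l IH] s ss sl.
  rewrite prods_nil /lediv mulg1 => sV; exists [::] => //; rewrite prods_nil mulg1.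
  by apply/esym/(garside_pointed gs) => //; case: ss; rewrite /lediv; gsimp.
have sa : simple a by apply: sl; rewrite mem_head.
have {}sl : simples l by move=> b bl; apply: sl; rewrite inE bl orbT.
rewrite prods_cons => sal.
have [j [jub jlub]] := garside_lcm gs s a.
have sj := jub s (or_introl erefl); have aj := jub a (or_intror erefl).
have jD : j <=| D by apply: jlub => _ [->|->]; [case: ss|case: sa].
have jal : j <=| a * prods l.
  by apply: jlub => _ [->|->] //; rewrite /lediv mulKg; exact: simples_pos.
have rest b : simple b -> b <=| j -> simple (b^-1 * j).
  move=> [b1 bD] bj; split; first by rewrite /lediv; gsimp.
  move: jD b1; rewrite /lediv; gsimp => jD /(garside_conj gs) b1.
  by have := PM jD b1; gsimp.
have jl : a^-1 * j <=| prods l by move: jal; rewrite /lediv; gsimp.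
have [l' sl' lE] := IH _ (rest _ sa aj) sl jl.
exists (s^-1 * j :: l').
  by move=> b; rewrite inE => /orP[/eqP ->|/sl'//]; exact: rest.
by rewrite lE prods_cons; gsimp.
Qed.

(** The elements that become products of simple elements after left multiplication by some power of
    [D] form a subgroup containing the simple elements. For positive [X] the factors [D] are then
    removed one by one with [simple_divides]. *)
Lemma pos_simples X : P X -> exists2 l, simples l & X = prods l.
Proof.
pose S := [set X | exists n l, simples l /\ D ^+ n * X = prods l].
have conjn n l : simples l -> exists2 l', simples l' & D ^+ n * prods l = prods l' * D ^+ n.
  elim: l => [|a l IH] sl; first by exists [::] => //; rewrite prods_nil; gsimp.
  have [l' sl' lE] : exists2 l', simples l' & D ^+ n * prods l = prods l' * D ^+ n.
    by apply: (IH) => b bl; apply: sl; rewrite inE bl orbT.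
  have sa : simple (D ^+ n * a * D ^- n).
    have : simple a by apply: sl; rewrite mem_head.
    elim: n {IH lE sl} => [|n IH] sa; first by rewrite expg0; gsimp.
    by have [_] := simple_conjV (IH sa); rewrite expgS; gsimp.
  exists (D ^+ n * a * D ^- n :: l').
    by move=> b; rewrite inE => /orP[/eqP ->|/sl'].
  by rewrite !prods_cons -!mulgA -lE; gsimp.
have SM : forall a b, S a -> S b -> S (a * b).
  move=> a b [n [l [sl lE]]] [m [k [sk kE]]].
  have [l' sl' l'E] := conjn m l sl.
  exists (m + n)%N, (l' ++ k); split.
    by move=> c; rewrite mem_cat => /orP[/sl'|/sk].
  by rewrite expgnDr prods_cat -kE -!mulgA (mulgA _ a) lE !mulgA l'E.
have Ss a : simple a -> S a /\ S a^-1.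
  move=> sa; split.
    by exists 0%N, [:: a]; rewrite expg0 mul1g prods_cons prods_nil mulg1; split => // b;
      rewrite inE => /eqP ->.
  have [sa' _] := simple_conjV sa.
  by exists 1%N, [:: D * a^-1]; rewrite expg1 prods_cons prods_nil mulg1; split => // b;
      rewrite inE => /eqP ->.
have S1 : S 1 by exists 0%N, [::]; rewrite expg0 prods_nil mulg1.
have sD : simple D by split; rewrite /lediv; gsimp.
have SV a : S a -> S a^-1.
  move=> [n [l [sl lE]]]; have -> : a^-1 = (prods l)^-1 * D ^+ n by rewrite -lE; gsimp.
  apply: (SM); last by elim: n {lE} => [|n IH]; rewrite ?expg0 // expgS; apply: (SM) => //; case: (Ss D sD).
  elim: l sl {lE} => [|b l IH] sl; first by rewrite prods_nil invg1.
  rewrite prods_cons invgM; apply: (SM).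
    by apply: IH => c cl; apply: sl; rewrite inE cl orbT.
  by apply: (proj2 (Ss b _)); apply: sl; rewrite mem_head.
have : S X.
  have : smallest (@is_subgroup G) simple X by rewrite (garside_gen gs).
  apply: smallest_sub; last by move=> a /Ss[].
  by split.
move=> [n [l [sl lE]]] PX.
have PDn m : P (D ^+ m * X) by elim: m => [|m IH]; rewrite ?expg0 ?mul1g // expgS -mulgA; apply: PM.
elim: n l sl lE => [|n IH] l sl; first by rewrite expg0 mul1g; exists l.
rewrite expgS -mulgA => lE.
have [l' sl' l'E] : exists2 l', simples l' & prods l = D * prods l'.
  by apply: simple_divides => //; rewrite -lE /lediv mulKg.
by apply: (IH l') => //; apply: (mulgI D); rewrite -l'E.
Qed.

Lemma homogeneous_garside_length : garside_length P D (gnorm P).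
Proof.
split=> // [X /pos_simples[l sl ->]|]; last exact: gnorm_eq0.
elim: l sl => [|a l IH] sl; first by rewrite prods_nil mulg1 mulgV.
have -> : D * prods (a :: l) * D^-1 = D * a * D^-1 * (D * prods l * D^-1).
  by rewrite prods_cons; gsimp.
apply: PM.
  have /simple_conjV[_ []] : simple a by apply: sl; rewrite mem_head.
  by rewrite /lediv; gsimp.
by apply: (IH) => b bl; apply: sl; rewrite inE bl orbT.
Qed.

End SymmetricHomogeneous.

Lemma cclass_X (G : groupType) (x X : G) k : cclass (x ^+ k) X ->
  exists z, X = (x ^ z) ^+ k.
Proof. by move=> [z _ <-]; exists z; rewrite conjXg. Qed.

Theorem summit_dual (G : groupType) (P : set G) (D : G) (k l : nat) (x y X : G) :
  garside_structure P D -> symmetric_structure P D -> homogeneous P ->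
  (0 < k)%N -> (0 < l)%N -> ((2 <= maxn k l)%N -> square_free P D) ->
  atom P x -> atom P y -> setmulg (cclass (x ^+ k)) (cclass (y ^+ l)) X ->
  (summit_inf P D X < 0)%R ->
  Posz (summit_len P D X) = (- 2 * summit_inf P D X + Posz k + Posz l)%R.
Proof.
move=> gs sym hom k0 l0 sqf ax ay [_ /cclass_X[z1 ->] [_ /cclass_X[z2 ->] <-]].
have gl := homogeneous_garside_length gs sym hom.
have ux : unit_length P (gnorm P) x by split; [case: ax|exact: (gnorm_atom gs)].
have uy : unit_length P (gnorm P) y by split; [case: ay|exact: (gnorm_atom gs)].
have D1 : D <> 1.
  move=> D1; case: (unit_neq1 gl ux); apply: (pos_inv_eq1 gl); first by case: ux.
  by rewrite -D1; exact: unit_le_D ux.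
pose xs (b : bool) := if b then y ^ z2 else x ^ z1.
pose ks (b : bool) := if b then l else k.
have cx b : conj_unit P (gnorm P) (xs b).
  by case: b; [exists y, z2|exists x, z1].
have [/(close0 gl)[g [xg yg]] h|] := EM (close P D (xs false) (xs true) 0%N).
  exfalso; apply: (@summit_inf_ge0 _ _ _ _ gl D1 _ g _ h).
  apply: (le_trans gl (cset_X gl k xg)); rewrite -mulgA lediv_mul2l; exact: (cset_X gl l yg).
move=> c0 _; have [r [cl far]] := close_min gl (cx false) (cx true) c0.
have [||i ->] := @summit_symmetric _ _ _ _ gl xs ks cx _ sym _ r D1 cl far.
- by case.
- move=> b kb z [Pz z1'] zzD; apply: (sqf _ 1 z 1).
  + by case: b kb => /=; lia.
  + exact: pos1 gl.
  + split => //; first exact: (unit_neq1 gl).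
    move=> b' c Pb Pc zE; have := gl_M gl Pb Pc; rewrite -zE z1' => e.
    have [b0|c0'] : gnorm P b' = 0%N \/ gnorm P c = 0%N by lia.
      by left; exact: (gl_eq0 gl).
    by right; exact: (gl_eq0 gl).
  + exact: pos1 gl.
  + by rewrite mul1g mulg1 expg2; split => //; rewrite le1P; apply: (posM gl).
- by rewrite i /ks /=; lia.
Qed.

(** * Alternating words *)

Definition alt_letter (T : Type) (j : nat) (a b : T) : T := if odd j then b else a.

Section Alternating.
Variable G : groupType.
Implicit Types a b : G.

Lemma alternatingS m a b : alternating m.+1 a b = a * alternating m b a.
Proof. by []. Qed.

Lemma alternating_cat i j a b : alternating (i + j) a b =
  alternating i a b * alternating j (alt_letter i a b) (alt_letter i.+1 a b).
Proof.
elim: i a b => [|i IH] a b; first by rewrite mul1g.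
rewrite addSn !alternatingS IH mulgA; congr (_ * alternating _ _ _);
  by rewrite /alt_letter /=; case: (odd i).
Qed.

Lemma alternatingSr m a b :
  alternating m.+1 a b = alternating m a b * alt_letter m a b.
Proof. by rewrite -addn1 alternating_cat /= mulg1. Qed.

Lemma alt_letter_swap (T : Type) j (a b : T) : alt_letter j.+1 a b = alt_letter j b a.
Proof. by rewrite /alt_letter /=; case: (odd j). Qed.

Lemma alt_letterSS (T : Type) j (a b : T) : alt_letter j.+2 a b = alt_letter j a b.
Proof. by rewrite /alt_letter /= negbK. Qed.

(* The word ending with [alternating j a b] has the letter b just before it. *)
Lemma alternating_before i j a b : (0 < i)%N ->
  exists2 w, (w = alternating i.-1 a b \/ w = alternating i.-1 b a) &
  (w * b * alternating j a b = alternating (i + j) a b \/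
   w * b * alternating j a b = alternating (i + j) b a).
Proof.
case: i => // i _; rewrite [i.+1.-1]/=; case oi : (odd i).
  exists (alternating i a b); first by left.
  by left; rewrite alternating_cat alternatingSr /alt_letter /= oi.
exists (alternating i b a); first by right.
by right; rewrite alternating_cat alternatingSr /alt_letter /= oi.
Qed.

End Alternating.

(** * Divisibility in Artin monoids *)

Section ArtinGarside.
Variables (G : groupType) (P : set G) (D : G) (nu : G -> nat).
Local Notation "a <=| b" := (lediv P a b) (at level 70, no associativity).
Local Notation unit_length := (unit_length P nu).

Definition dihedral_pair (m : nat) (a b : G) : Prop :=
  [/\ (2 <= m)%N, alternating m a b = alternating m b a,
    forall w, a <=| w -> b <=| w -> alternating m a b <=| w
    & forall p, P p -> p <=| alternating m a b ->
      exists2 j, (j <= m)%N & p = alternating j a b \/ p = alternating j b a].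

(** The interface through which the Artin group is used. [rev] reverses words, so it exchanges left
    and right divisibility between positive elements. *)
Record artin_garside (rev : G -> G) : Prop := ArtinGarside {
  ag_length :> garside_length P D nu;
  ag_gen : forall X, P X -> X <> 1 -> exists2 x, unit_length x & x <=| X;
  ag_dihedral : forall a b, unit_length a -> unit_length b -> a <> b ->
    exists m, dihedral_pair m a b;
  ag_delta : forall w, (forall x, unit_length x -> x <=| w) -> D <=| w;
  ag_revM : forall a b, rev (a * b) = rev b * rev a;
  ag_rev1 : forall x, unit_length x -> rev x = x
}.

Variable rev : G -> G.
Hypothesis ag : artin_garside rev.
Let gl : garside_length P D nu := ag.

Lemma dihedral_sym m a b : dihedral_pair m a b -> dihedral_pair m b a.
Proof.
move=> [m2 e h1 h2]; split=> // [w bw aw|p Pp]; rewrite -e; first exact: h1.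
by move=> /(h2 _ Pp)[j jm [->|->]]; exists j => //; [right|left].
Qed.

Lemma unit_pos a : unit_length a -> P a. Proof. by case. Qed.

Lemma unit_pos_alt j a b : unit_length a -> unit_length b -> P (alternating j a b).
Proof.
move=> ua ub; elim: j a b ua ub => [|j IH] a b ua ub; first exact: (pos1 gl).
by rewrite alternatingS; apply: (posM gl); [exact: unit_pos|exact: IH].
Qed.

Lemma nu_alt j a b : unit_length a -> unit_length b -> nu (alternating j a b) = j.
Proof.
move=> ua ub; elim: j a b ua ub => [|j IH] a b ua ub; first exact: (nu1 gl).
rewrite alternatingS (gl_M gl (unit_pos ua) (unit_pos_alt j ub ua)) IH //.
by case: ua => _ ->.
Qed.

Lemma unit_alt_letter j a b : unit_length a -> unit_length b -> unit_length (alt_letter j a b).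
Proof. by rewrite /alt_letter; case: ifP. Qed.

Lemma unit_le_eq a b : unit_length a -> unit_length b -> a <=| b -> a = b.
Proof.
move=> ua ub ab; case: (le_unit gl ub (unit_pos ua) ab) => // a1.
by case: (unit_neq1 gl ua).
Qed.

Lemma le_mul a b c : P c -> a <=| b -> a <=| b * c.
Proof. by move=> Pc ab; apply: (le_trans gl ab); apply: le_mulr. Qed.

Lemma rev_1 : rev 1 = 1.
Proof. by apply: (mulgI (rev 1)); rewrite -(ag_revM ag) !mulg1. Qed.

Lemma unit_ind (Q : G -> Prop) : Q 1 ->
  (forall x X, unit_length x -> P X -> Q X -> Q (x * X)) -> forall X, P X -> Q X.
Proof.
move=> Q1 QM X; have [n] := ubnP (nu X); elim: n X => // n IH X Xn PX.
have [->//|X1] := EM (X = 1).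
have [x ux /leE[Y PY XE]] := ag_gen ag PX X1.
rewrite XE; apply: QM => //; apply: IH => //.
by move: Xn; rewrite XE (gl_M gl (unit_pos ux) PY); case: ux => _ ->; rewrite ltnS.
Qed.

Lemma rev_props X : P X -> [/\ P (rev X), rev (rev X) = X & nu (rev X) = nu X].
Proof.
move: X; apply: unit_ind; first by rewrite !rev_1; split => //; exact: (pos1 gl).
move=> x X ux PX [h1 h2 h3]; have Px := unit_pos ux.
rewrite !(ag_revM ag) !(ag_rev1 ag ux) h2; split => //; first exact: (posM gl).
by rewrite (gl_M gl Px PX) (gl_M gl h1 Px) h3 addnC.
Qed.

Lemma rev_alt j a b : unit_length a -> unit_length b ->
  rev (alternating j a b) = alternating j (alt_letter j.+1 a b) (alt_letter j a b).
Proof.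
move=> ua ub; elim: j => [|j IH]; first exact: rev_1.
rewrite alternatingSr (ag_revM ag) IH (ag_rev1 ag (unit_alt_letter j ua ub)).
by rewrite alternatingS alt_letterSS.
Qed.

Lemma gediv_unit_rev a w : unit_length a -> P w -> gediv P w a <-> a <=| rev w.
Proof.
move=> ua Pw; have Pa := unit_pos ua; rewrite /gediv /lediv; split=> h.
  have [h1 _ _] := rev_props h.
  by have := ag_revM ag (w * a^-1) a; rewrite mulgVK (ag_rev1 ag ua) => ->; rewrite mulKg.
have [h1 _ _] := rev_props h; have [_ h2 _] := rev_props Pw.
by have := ag_revM ag a (a^-1 * rev w); rewrite mulVKg h2 (ag_rev1 ag ua) => ->; rewrite mulgK.
Qed.

Lemma right_lcm m a b w : unit_length a -> unit_length b -> dihedral_pair m a b ->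
  P w -> gediv P w a -> gediv P w b -> gediv P w (alternating m a b).
Proof.
move=> ua ub [_ e lcm _] Pw /(gediv_unit_rev ua Pw) aw /(gediv_unit_rev ub Pw) bw.
have h := lcm _ aw bw; have [h1 _ _] := rev_props h; have [_ h2 _] := rev_props Pw.
have rD : rev (alternating m a b) = alternating m a b.
  by rewrite rev_alt // /alt_letter /=; case: (odd m).
have := ag_revM ag (alternating m a b) ((alternating m a b)^-1 * rev w).
by rewrite mulVKg h2 rD => ->; rewrite /gediv mulgK.
Qed.

(** The alternating prefix is the gcd of [B] and the lcm of [a] and [b]; being the greatest, it
    cannot be continued by its next letter inside [F]. *)
Lemma alt_prefix m a b B : unit_length a -> unit_length b -> dihedral_pair m a b ->
  P B -> a <=| B -> ~ b <=| B ->
  exists j F, [/\ (0 < j < m)%N, P F, B = alternating j a b * F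
    & ~ alt_letter j a b <=| F].
Proof.
move=> ua ub [m2 e lcm dv] PB aB bB.
have Pm : P (alternating m a b) by exact: unit_pos_alt.
have bm : b <=| alternating m a b.
  by rewrite e; case: m {e lcm dv Pm} m2 => // m _; rewrite alternatingS; apply: le_mulr; exact: unit_pos_alt.
have am : a <=| alternating m a b.
  by case: m {e lcm dv Pm bm} m2 => // m _; rewrite alternatingS; apply: le_mulr; exact: unit_pos_alt.
pose p := meet gl B (alternating m a b).
have Pp : P p by exact: pos_meet.
have ap : a <=| p by apply: le_meet.
have bp : ~ b <=| p by move=> bp; apply: bB; apply: (le_trans gl bp); exact: meetl.
have [j jm pE] := dv p Pp (meetr gl _ _).
have [F PF BE] := leE (meetl gl B (alternating m a b) : p <=| B).
have j0 : (0 < j)%N.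
  rewrite lt0n; apply/eqP => j0; move: pE; rewrite j0 => pE.
  have p1 : p = 1 by case: pE.
  by apply: (unit_neq1 gl ua); apply: (pos_inv_eq1 gl); [exact: unit_pos|rewrite -p1].
have {}pE : p = alternating j a b.
  case: pE => // pE; case: bp; rewrite pE; case: j j0 {jm pE} => // j _.
  by rewrite alternatingS; apply: le_mulr; exact: unit_pos_alt.
have {}jm : (j < m)%N.
  by rewrite ltn_neqAle jm andbT; apply/eqP => jE; apply: bp; rewrite pE jE.
exists j, F; split=> //; first by rewrite j0.
  by rewrite -pE.
move=> cF; have : alternating j.+1 a b <=| p.
  apply: le_meet.
    by rewrite alternatingSr -pE BE lediv_mul2l.
  rewrite -(subnKC jm) alternating_cat; apply: le_mulr.
  by apply: unit_pos_alt; exact: unit_alt_letter.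
move/(le_nu gl (unit_pos_alt _ ua ub)); rewrite pE !nu_alt // ltnn //.
Qed.

(** In the Coxeter group this says that [x] lengthens every element it does not divide. Let
    [B = p * F] with [p] alternating in an atom [s] of [B] and in [x]. By induction the next letter
    may be put before [F], so the complement [D * F^-1] is right divisible by both atoms, hence by
    their lcm. The lcm has a word ending in [x] followed by [p], and so [x * B] has a positive
    complement. *)
Lemma simple_mull B x : P B -> B <=| D -> unit_length x -> ~ x <=| B -> x * B <=| D.
Proof.
have [n] := ubnP (nu B); elim: n B x => // n IH B x Bn PB BD ux xB.
have [B1|B1] := EM (B = 1); first by rewrite B1 mulg1; exact: (unit_le_D gl).
have [s us sB] := ag_gen ag PB B1.
have sx : s <> x by move=> e; apply: xB; rewrite -e.
have [m dp] := ag_dihedral ag us ux sx.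
have [j [F [/andP[j0 jm] PF BE cF]]] := alt_prefix us ux dp PB sB xB.
set p := alternating j s x in BE.
have Pp : P p by exact: unit_pos_alt.
have FD : F <=| D by apply: (simple_factor gl Pp); rewrite -BE.
have compl Y : P Y -> Y <=| D -> P (D * Y^-1).
  by move=> PY; rewrite /lediv => /(gl_conjV gl); gsimp.
have uc := unit_alt_letter j us ux.
have Fn : (nu F < n)%N.
  move: Bn; rewrite BE (gl_M gl Pp PF) nu_alt //; lia.
have PW := compl F PF FD.
have Wc : gediv P (D * F^-1) (alt_letter j s x).
  have := IH F _ Fn PF FD uc cF => /(compl _ (posM gl (unit_pos uc) PF)).
  by rewrite /gediv; gsimp.
have Wc' : gediv P (D * F^-1) (alt_letter j.-1 s x).
  have FE : F = p^-1 * B by rewrite BE mulKg.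
  have jE : p = alternating j.-1 s x * alt_letter j.-1 s x by rewrite -alternatingSr prednK.
  rewrite /gediv FE jE; gsimp; apply: (posM gl); last exact: unit_pos_alt.
  exact: compl.
have dW : gediv P (D * F^-1) (alternating m s x).
  have [Ws Wx] : gediv P (D * F^-1) s /\ gediv P (D * F^-1) x.
    move: Wc Wc'; case: (j) j0 => // i _ /=; rewrite /alt_letter /=.
    by case: (odd i).
  exact: (right_lcm us ux dp).
have [w wE uE] := @alternating_before _ (m - j) j s x (ltac:(by rewrite subn_gt0)).
have Pw : P w by case: wE => ->; exact: unit_pos_alt.
have {}uE : w * x * p = alternating m s x.
  have [_ e _ _] := dp; rewrite subnK in uE; last exact: ltnW.
  by case: uE => -> //.
have : P (D * B^-1 * x^-1).
  have -> : D * B^-1 * x^-1 = D * F^-1 * (alternating m s x)^-1 * w.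
    by rewrite -uE BE; gsimp.
  exact: (posM gl).
by move/(garside_conj gl); rewrite /lediv; gsimp.
Qed.

Definition squarefree (U : G) : Prop :=
  forall V y W, P V -> unit_length y -> P W -> U <> V * (y * y) * W.

Lemma squarefree_factor V U W : P V -> P W -> squarefree (V * U * W) -> squarefree U.
Proof.
move=> PV PW h V' y W' PV' uy PW' UE.
apply: (h (V * V') y (W' * W)) => //; [exact: (posM gl)|exact: (posM gl)|].
by rewrite UE !mulgA.
Qed.

Lemma alt_not_le m a b U j : unit_length a -> unit_length b -> dihedral_pair m a b ->
  P U -> ~ a <=| U -> ~ b <=| U -> (j < m)%N -> ~ b <=| alternating j a b * U.
Proof.
move=> ua ub dp PU aU bU jm bj; case: j jm bj => [|j] jm bj.
  by apply: bU; rewrite mul1g in bj.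
have [_ _ lcm _] := dp.
have : alternating m a b <=| alternating j.+1 a b * U.
  apply: lcm => //; rewrite alternatingS -mulgA; apply: le_mulr.
  by apply: (posM gl) => //; exact: unit_pos_alt.
have [i mE] : exists i, m = (j.+1 + i.+1)%N by exists (m - j.+2)%N; lia.
rewrite mE alternating_cat lediv_mul2l alternatingS => h.
have : alt_letter j.+1 a b <=| U.
  apply: (le_trans gl _ h); apply: le_mulr; apply: unit_pos_alt; exact: unit_alt_letter.
by rewrite /alt_letter /=; case: (odd j).
Qed.

(** The point is [key]: if [x * U] also starts with an atom [s] other than [x], it starts with their
    lcm, and neither atom divides the remainder [U']. Putting the letters back before [U'] one at a
    time, by induction, shows that the rest after [s] is square free. A square in [x * U] would then
    lie in a shorter square free element or start with [x * x]. *)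
Lemma squarefree_mull U x : P U -> squarefree U -> unit_length x -> ~ x <=| U ->
  squarefree (x * U).
Proof.
have [n] := ubnP (nu U); elim: n U x => // n IH U x Un PU sU ux xU.
have key s T : unit_length s -> s <> x -> P T -> x * U = s * T -> squarefree T /\ ~ s <=| T.
  move=> us sx PT UT; have [m dp] := ag_dihedral ag us ux sx.
  have [m2 e lcm _] := dp.
  have [U' PU' xUE] : exists2 U', P U' & x * U = alternating m s x * U'.
    apply: leE; apply: lcm; last exact: le_mulr.
    by rewrite UT; apply: le_mulr.
  case: m m2 e lcm dp xUE => // m m2 e lcm dp xUE.
  have UE : U = alternating m s x * U'.
    by apply: (mulgI x); rewrite xUE e alternatingS mulgA.
  have TE : T = alternating m x s * U'.
    by apply: (mulgI s); rewrite -UT xUE alternatingS mulgA.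
  have e1 : ~ alt_letter m s x <=| U'.
    move=> /leE[U'' PU'' U'E]; apply: xU; rewrite UE U'E mulgA -alternatingSr e alternatingS -mulgA.
    by apply: le_mulr; apply: (posM gl) => //; exact: unit_pos_alt.
  have e2 : ~ alt_letter m.-1 s x <=| U'.
    move=> /leE[U'' PU'' U'E].
    apply: (sU (alternating m.-1 s x) (alt_letter m.-1 s x) U'') => //.
    - exact: unit_pos_alt.
    - exact: unit_alt_letter.
    - by rewrite UE U'E -{1}(prednK (n := m)) // alternatingSr -!mulgA.
  have [sU' xU'] : ~ s <=| U' /\ ~ x <=| U'.
    by move: e1 e2; case: (m) m2 => // i _; rewrite /alt_letter /=; case: (odd i).
  have sqU' : squarefree U'.
    apply: (@squarefree_factor (alternating m s x) U' 1); [exact: unit_pos_alt|exact: pos1 gl|].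
    by rewrite mulg1 -UE.
  have sq j a b : (j <= m)%N -> (a = x /\ b = s) \/ (a = s /\ b = x) ->
      squarefree (alternating j a b * U').
    elim: j a b => [|j IHj] a b jm ab; first by rewrite mul1g.
    have [ua ub] : unit_length a /\ unit_length b by case: ab => [[-> ->]|[-> ->]].
    rewrite alternatingS -mulgA; apply: IH => //.
    - rewrite (gl_M gl) // ?nu_alt //; last exact: unit_pos_alt.
      by move: Un; rewrite UE (gl_M gl) // ?nu_alt //; [lia|exact: unit_pos_alt].
    - by apply: (posM gl) => //; exact: unit_pos_alt.
    - by apply: IHj; [exact: ltnW|case: ab => -[-> ->]; [right|left]].
    - case: ab => -[-> ->]; [apply: (alt_not_le (m := m.+1))|apply: (alt_not_le (m := m.+1))] => //;
        [exact: ltnW|exact: dihedral_sym|exact: ltnW].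
  split; first by rewrite TE; apply: sq => //; left.
  by rewrite TE; apply: (alt_not_le (m := m.+1)) => //; exact: dihedral_sym.
move=> V y W PV uy PW E.
have Pyy : P (y * y * W) by apply: (posM gl) => //; apply: (posM gl); exact: unit_pos.
have [V1|V1] := EM (V = 1).
  rewrite V1 mul1g in E.
  have [yx|yx] := EM (y = x).
    apply: xU; have -> : U = x * W by apply: (mulgI x); rewrite E yx mulgA.
    exact: le_mulr.
  have PyW : P (y * W) by apply: (posM gl) => //; exact: unit_pos.
  have [|_] := key y (y * W) uy yx PyW; first by rewrite E mulgA.
  by apply; apply: le_mulr.
have [s us /leE[V' PV' VE]] := ag_gen ag PV V1.
have PT : P (V' * (y * y) * W) by rewrite -mulgA; apply: (posM gl).
have [sx|sx] := EM (s = x).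
  by apply: (sU V' y W) => //; apply: (mulgI x); rewrite E VE sx !mulgA.
have [|h _] := key s _ us sx PT; first by rewrite E VE !mulgA.
exact: (h V' y W).
Qed.

(** A longest square free simple element is divisible by every atom, since a missing atom could be
    put in front; hence it is [D]. *)
Lemma squarefreeD : squarefree D.
Proof.
have [|B [PB BD sB] Bmax] := @nat_argmin G (fun B => [/\ P B, B <=| D & squarefree B])
  (fun B => (nu D - nu B)%N).
  exists 1; split; [exact: pos1 gl|by rewrite le1P; exact: posD gl|].
  move=> V y W PV uy PW E; have := congr1 nu E.
  have [Py y1] := uy.
  rewrite (nu1 gl) !(gl_M gl) ?y1 //; [lia|exact: (posM gl)|].
  by apply: (posM gl) => //; exact: (posM gl).
suff -> : D = B by [].
apply: (le_anti gl) => //; apply: (ag_delta ag) => x ux.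
apply: contrapT => xB; have xBD := simple_mull PB BD ux xB.
have PxB : P (x * B) by apply: (posM gl) => //; exact: unit_pos.
have := Bmax _ (And3 PxB xBD (squarefree_mull PB sB ux xB)).
have := le_nu gl PxB xBD; rewrite (gl_M gl (unit_pos ux) PB); case: ux => _ ->; lia.
Qed.

Lemma simple_squarefree B : P B -> B <=| D -> squarefree B.
Proof.
move=> PB /leE[C PC DE]; apply: (@squarefree_factor 1 B C) => //; first exact: pos1 gl.
by rewrite mul1g -DE; exact: squarefreeD.
Qed.

Lemma simple_mulr A x : P A -> A <=| D -> unit_length x -> ~ gediv P A x -> A * x <=| D.
Proof.
move=> PA AD ux xA; apply: contrapT => h; apply: xA.
have PC : P (A^-1 * D) by [].
have CD : A^-1 * D <=| D by apply: (simple_factor gl PA); rewrite mulVKg; exact: (le_refl gl).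
have xC : ~ x <=| A^-1 * D by move=> xC; apply: h; rewrite -(lediv_mul2l P A^-1) mulKg.
have := simple_mull PC CD ux xC; rewrite /lediv /gediv => /(gl_conjV gl); gsimp; exact.
Qed.

Lemma simple_mulrN A x : P A -> unit_length x -> gediv P A x -> ~ A * x <=| D.
Proof.
move=> PA ux xA h; have Px := unit_pos ux.
apply: (simple_squarefree (posM gl PA Px) h (V := A * x^-1) (y := x) (W := 1)) => //.
  exact: pos1 gl.
by gsimp.
Qed.

(** An exchange property. Write [E = p * F] as in [alt_prefix]; the lcm of the two atoms divides
    [E * y], so induction carries the next letter through [F]. If [p] has m - 1 letters, it carries
    [z] to that letter; otherwise the last letter of [p] would divide [F], producing a square in
    [E]. *)
Lemma simple_carry E z y : P E -> E <=| D -> unit_length z -> unit_length y ->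
  ~ z <=| E -> z <=| E * y -> z * E = E * y.
Proof.
have [n] := ubnP (nu E); elim: n E z => // n IH E z En PE ED uz uy zE zEy.
have [E1|E1] := EM (E = 1).
  by move: zEy; rewrite E1 mul1g mulg1; exact: unit_le_eq.
have [s us sE] := ag_gen ag PE E1.
have sz : s <> z by move=> e; apply: zE; rewrite -e.
have [m dp] := ag_dihedral ag us uz sz.
have [j [F [/andP[j0 jm] PF EE cF]]] := alt_prefix us uz dp PE sE zE.
have [m2 e lcm _] := dp.
have Pp : P (alternating j s z) by exact: unit_pos_alt.
have mEy : alternating m s z <=| E * y by apply: lcm => //; apply: le_mul => //; exact: unit_pos.
have [i mE] : exists i, m = (j + i.+1)%N by exists (m - j.+1)%N; lia.
rewrite mE alternating_cat EE -mulgA lediv_mul2l alternatingS in mEy.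
set c := alt_letter j s z in cF mEy *; set c' := alt_letter j.+1 s z in mEy.
have uc : unit_length c by exact: unit_alt_letter.
have uc' : unit_length c' by exact: unit_alt_letter.
have cFy : c <=| F * y by apply: (le_trans gl _ mEy); apply: le_mulr; exact: unit_pos_alt.
have FD : F <=| D by apply: (simple_factor gl Pp); rewrite -EE.
have cFE : c * F = F * y.
  apply: IH => //; move: En; rewrite EE (gl_M gl Pp PF) nu_alt //; lia.
case: i mE mEy => [|i] mE mEy.
  have : z * alternating j s z = alternating j s z * c.
    by rewrite -alternatingSr -alternatingS -addn1 -mE e.
  by rewrite EE mulgA => ->; rewrite -!mulgA cFE.
move: mEy; rewrite -cFE lediv_mul2l alternatingS => h.
have /leE[F' PF' FE] : c' <=| F.
  by apply: (le_trans gl _ h); apply: le_mulr; exact: unit_pos_alt.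
case: (simple_squarefree PE ED (V := alternating j.-1 s z) (y := c') (W := F')) => //.
  exact: unit_pos_alt.
have jE : alternating j s z = alternating j.-1 s z * c'.
  by rewrite /c'; case: (j) j0 => // j' _; rewrite alt_letterSS alternatingSr.
by rewrite EE FE jE -!mulgA.
Qed.

(** The residue of [rho] after the first letter is nontrivial and simple, and left weightedness
    prevents its atoms from dividing the next letter. So the situation reproduces itself down to the
    last letter, where [simple_carry] applies. *)
Lemma chain_carry s rho y : letters P D s -> lwchain P D s -> s <> [::] ->
  P rho -> rho <=| D -> rho <> 1 -> unit_length y ->
  (forall d, unit_length d -> d <=| rho -> ~ d <=| head 1 s) ->
  rho <=| prods s * y -> exists2 d, unit_length d & d * last 1 s = last 1 s * y.
Proof.
elim: s rho => // a [|b s] IH rho ls ch _ Prho rhoD rho1 uy hd.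
  rewrite prods_cons prods_nil mulg1 => rhoa.
  have [d ud drho] := ag_gen ag Prho rho1; exists d => //=.
  have /letters_cons[[Pa _ aD] _] := ls.
  by apply: simple_carry => //; [exact: hd|exact: (le_trans gl drho)].
rewrite prods_cons -mulgA => rhoa.
have /letters_cons[[Pa a1 aD] ls'] := ls.
have [r [Pr jE rmin]] := joinE gl a rho.
have jD : a * r <=| D by rewrite -jE; apply: le_join.
apply: (IH r) => //.
- exact: (lwchain_tail ch).
- exact: (simple_factor gl Pa).
- move=> r1; have [d ud drho] := ag_gen ag Prho rho1; apply: (hd d ud drho) => /=.
  by apply: (le_trans gl drho); have := joinr gl a rho; rewrite jE r1 mulg1.
- move=> d ud dr db; case: ch => ab _; apply: (unit_neq1 gl ud).
  apply: ab => //; first exact: unit_pos.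
  by apply: (le_trans gl _ jD); rewrite lediv_mul2l.
- by apply: rmin => //; apply: (posM gl); [exact: (letters_pos gl ls')|exact: unit_pos].
Qed.

(** [E''] is the last letter of the normal form of [E], so removing it saves one factor [D]; this is
    how a carry contradicts minimal distance. For trivial [E] the atom [y] itself serves as [d]. *)
Lemma carry_left E n z y : P E -> E <=| D ^+ n.+1 -> unit_length z -> unit_length y ->
  ~ z <=| E -> z <=| E * y ->
  exists E' E'' d, [/\ P E' /\ P E'', E = E' * E'', E' <=| D ^+ n, unit_length d
    & d * E'' = E'' * y].
Proof.
move=> PE ED uz uy zE zEy.
have [s [ls ch sE sn]] := normal_form gl PE ED.
have [s0|s0] := EM (s = [::]).
  have E1 : E = 1 by rewrite -sE s0 prods_nil.
  exists 1, 1, y; split => //; [split; exact: pos1 gl|by rewrite E1 mul1g| |by rewrite mul1g mulg1].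
  by rewrite le1P; apply: (posX gl); exact: posD gl.
have [||d ud dE] := chain_carry ls ch s0 (unit_pos uz) (unit_le_D gl uz) (unit_neq1 gl uz) uy.
- move=> d ud dz; rewrite (unit_le_eq ud uz dz) => zs; apply: zE; rewrite -sE.
  case: (s) s0 ls zs => // a s' _ ls' zs; rewrite prods_cons; apply: le_mul => //.
  by have /letters_cons[_ /(letters_pos gl)] := ls'.
- by rewrite sE.
case/lastP: s s0 ls {ch} sE sn dE => // s a _; rewrite size_rcons last_rcons -cats1.
move=> /letters_cat[ls /letters_cons[[Pa _ _] _]]; rewrite prods_cat prods_cons prods_nil mulg1.
move=> sE sn dE; exists (prods s), a, d; split => //; first by split => //; exact: (letters_pos gl).
apply: (le_trans gl (prods_le_D gl ls)).
by rewrite -[D ^+ size s]mul1g -[D ^+ n]mul1g; apply: (le_Dleq gl).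
Qed.

Lemma revD : rev D = D.
Proof.
have [h1 h2 h3] := rev_props (posD gl).
apply/esym/(le_nu_eq gl (posD gl)) => //; apply: (ag_delta ag) => x ux.
apply/(gediv_unit_rev ux (posD gl)); rewrite /gediv.
by have := unit_le_D gl ux; rewrite /lediv => /(gl_conjV gl); gsimp.
Qed.

Lemma rev_Dn n : rev (D ^+ n) = D ^+ n.
Proof.
elim: n => [|n IH]; first by rewrite expg0 rev_1.
by rewrite expgS (ag_revM ag) IH revD -expgSr -expgS.
Qed.

Lemma rev_le_Dn F n : P F -> F <=| D ^+ n -> rev F <=| D ^+ n.
Proof.
move=> PF; rewrite /lediv => h.
have h' : P (D ^+ n * F^-1) by apply/(pos_conjDn gl n); gsimp.
have [h1 _ _] := rev_props h'.
by have := ag_revM ag (D ^+ n * F^-1) F; rewrite mulgVK rev_Dn => ->; rewrite mulKg.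
Qed.

Lemma carry_right F n y c : P F -> F <=| D ^+ n.+1 -> unit_length y -> unit_length c ->
  ~ gediv P F c -> gediv P (y * F) c ->
  exists F' F'' f, [/\ P F' /\ P F'', F = F'' * F', F' <=| D ^+ n, unit_length f
    & y * F'' = F'' * f].
Proof.
move=> PF FD uy uc cF cyF; have Py := unit_pos uy.
have [PrF rrF _] := rev_props PF.
have cF' : ~ c <=| rev F by move/(gediv_unit_rev uc PF).
have cyF' : c <=| rev F * y.
  by move/(gediv_unit_rev uc (posM gl Py PF)): cyF; rewrite (ag_revM ag) (ag_rev1 ag uy).
have [E' [E'' [d [[PE' PE''] EE E'D ud dE]]]] := carry_left PrF (rev_le_Dn PF FD) uc uy cF' cyF'.
have [P1 _ _] := rev_props PE'; have [P2 _ _] := rev_props PE''.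
exists (rev E'), (rev E''), d; split => //.
- by rewrite -(ag_revM ag) -EE.
- exact: rev_le_Dn.
- by have := congr1 rev dE; rewrite !(ag_revM ag) (ag_rev1 ag uy) (ag_rev1 ag ud).
Qed.

End ArtinGarside.

(** * Crossing a wall *)

Section Crossing.
Variables (G : groupType) (P : set G) (D : G) (nu : G -> nat).
Local Notation "a <=| b" := (lediv P a b) (at level 70, no associativity).
Local Notation unit_length := (unit_length P nu).
Local Notation conj_unit := (conj_unit P nu).
Local Notation cset := (cset P).
Local Notation close := (close P D).
Local Notation dihedral_pair := (dihedral_pair P).
Variable rev : G -> G.
Hypothesis ag : artin_garside P D nu rev.
Let gl : garside_length P D nu := ag.

Lemma cset_mul_unit x g : cset x g -> cset x (g * x ^ g).
Proof.
by rewrite !csetE conjgM {2}/conjg mulKg.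
Qed.

Lemma conj_self (a : G) : a ^ a = a.
Proof. by rewrite /conjg mulKg. Qed.

(** Otherwise [carry_left] would make [y] positive already at a prefix [g * E'] of [g * E] with [E']
    below [D ^+ r]. *)
Lemma far_carry x y r g E z : conj_unit x -> conj_unit y -> ~ close x y r ->
  cset x g -> cset y (g * E) -> P E -> E <=| D ^+ r.+1 -> unit_length z ->
  ~ z <=| E -> ~ z <=| E * y ^ (g * E).
Proof.
move=> cx cy far xg yE PE ED uz zE zEy; have uy := conj_unit_at gl cy yE.
have [E' [E'' [d [[PE' PE''] EE E'D ud dE]]]] := carry_left ag PE ED uz uy zE zEy.
apply: far; apply: (close_sym gl); exists (g * E'), g; split => //.
- have -> : g * E' = g * E * E''^-1 by rewrite EE; gsimp.
  rewrite csetE conjgM; suff -> : (y ^ (g * E)) ^ E''^-1 = d by exact: unit_pos ud.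
  by rewrite [LHS]conjgE invgK mulgA -dE mulgK.
- exact: le_mulr.
- by rewrite lediv_mul2l.
Qed.

(** At the first failure the product would be right divisible by its last letter and by the next
    one, hence by the lcm of [a] and [b]. Cancelling the alternating word would leave [A] right
    divisible by [b]. *)
Lemma simple_mul_alt m A i a b : unit_length a -> unit_length b -> dihedral_pair m a b ->
  P A -> A <=| D -> ~ gediv P A a -> ~ gediv P A b -> (i < m)%N ->
  A * alternating i a b <=| D.
Proof.
move=> ua ub dp PA AD aA bA; elim: i => [|i IH] im; first by rewrite mulg1.
have Pi : P (alternating i a b) by exact: (unit_pos_alt ag).
have PAi : P (A * alternating i a b) by exact: (posM gl).
rewrite alternatingSr mulgA; apply: (simple_mulr ag) => //; first exact: IH (ltnW im).
  exact: unit_alt_letter.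
case: i im IH Pi PAi => [|i] im IH Pi PAi h; first by apply: aA; rewrite mulg1 in h.
have h' : gediv P (A * alternating i.+1 a b) (alt_letter i a b).
  rewrite /gediv alternatingSr mulgA mulgK; apply: (posM gl) => //; exact: (unit_pos_alt ag).
have [ha hb] : gediv P (A * alternating i.+1 a b) a /\ gediv P (A * alternating i.+1 a b) b.
  by move: h h'; rewrite /alt_letter /=; case: (odd i).
have := right_lcm ag ua ub dp PAi ha hb.
have [w wE uE] := @alternating_before _ (m - i.+1) i.+1 a b (ltac:(rewrite subn_gt0; exact: ltnW)).
have Pw : P w by case: wE => ->; exact: (unit_pos_alt ag).
have {}uE : w * b * alternating i.+1 a b = alternating m a b.
  have [_ e _ _] := dp; rewrite subnK in uE; last by exact: ltnW (ltnW im).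
  by case: uE => -> //.
rewrite -uE /gediv => k; apply: bA.
have -> : gediv P A b = P (A * alternating i.+1 a b * (w * b * alternating i.+1 a b)^-1 * w).
  by rewrite /gediv; congr P; gsimp.
exact: (posM gl).
Qed.

(* The exceptional position: x and y are, at g, the atom b and a conjugate of
   an atom inside the dihedral monoid generated by a and b. *)
Definition dihedral_position (x y g a b : G) (m s : nat) : Prop :=
  [/\ x ^ g = b, [/\ unit_length a, unit_length b & a <> b], dihedral_pair m a b,
    (0 < s)%N /\ (s.+2 < m)%N & y ^ (g * alternating s a b) = alt_letter s a b].

Section Wall.
Variables (x y : G) (r : nat).
Hypothesis cx : conj_unit x.
Hypothesis cy : conj_unit y.
Hypothesis far : ~ close x y r.

Let far' : ~ close y x r. Proof. by move=> /(close_sym gl). Qed.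

(** Multiplication by [q] is an elementary move inside the set of [x], and the wall of [y] lies
    across it. Carrying the atom of [y] to the right would lower the distance, except when r = 0 and
    the wall is met strictly inside the dihedral monoid. *)
Lemma wall_dihedral h g z m :
  cset y h -> cset x g -> h <=| g ->
  unit_length z -> z <> x ^ g -> dihedral_pair m z (x ^ g) ->
  ~ h * y ^ h <=| g -> h * y ^ h <=| g * alternating m.-1 z (x ^ g) ->
  g * alternating m.-1 z (x ^ g) <=| h * D ^+ r.+1 ->
  ~ gediv P (h^-1 * g) (x ^ g) ->
  r = 0%N /\ exists s, dihedral_position x y g z (x ^ g) m s.
Proof.
move=> yh xg hg uz zx dp yg ygq gqD Bx.
have uxg := conj_unit_at gl cx xg; have uyh := conj_unit_at gl cy yh.
set xi := x ^ g in uxg zx dp ygq gqD Bx *; set yt := y ^ h in uyh yg ygq *.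
set q := alternating m.-1 z xi in ygq gqD.
have [B PB gE] := leE hg.
have {}Bx : ~ gediv P B xi by move: Bx; rewrite gE mulKg.
have [m2 e lcm dv] := dp.
have Pq : P q by exact: (unit_pos_alt ag).
have yB : ~ yt <=| B by rewrite -(lediv_mul2l P h) -gE.
have yBq : yt <=| B * q by rewrite -(lediv_mul2l P h) (mulgA h B) -gE.
have BqD : B * q <=| D ^+ r.+1 by rewrite -(lediv_mul2l P h) (mulgA h B) -gE.
have [[Pyt Pz] Pxi] := (unit_pos uyh, unit_pos uz, unit_pos uxg).
have qm : q <=| alternating m z xi.
  by rewrite /q -{2}(prednK (n := m)) ?alternatingSr; [apply: le_mulr; apply: unit_pos; exact: unit_alt_letter|exact: ltnW].
(* The residue of [yt] after [B] is a nontrivial divisor of [q], so it is alternating. It starts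
   with [z], since [q] is too short to be divisible by both atoms. *)
have [rr [Prr jE rmin]] := joinE gl B yt.
have rq : rr <=| q by apply: rmin.
have rr1 : rr <> 1 by move=> rr1; apply: yB; have := joinr gl B yt; rewrite jE rr1 mulg1.
have [j jm rE] := dv rr Prr (le_trans gl rq qm).
have j0 : (0 < j)%N by rewrite lt0n; apply/eqP => j0; apply: rr1; move: rE; rewrite j0 => -[].
have {}rE : rr = alternating j z xi.
  case: rE => // rE; have xiq : xi <=| q.
    apply: (le_trans gl _ rq); rewrite rE; case: (j) j0 => // i _; rewrite alternatingS.
    by apply: le_mulr; exact: (unit_pos_alt ag).
  have zq : z <=| q.
    rewrite /q; case: (m) m2 => // -[//|i] _; rewrite alternatingS.
    by apply: le_mulr; exact: (unit_pos_alt ag).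
  have := le_nu gl (unit_pos_alt ag m uz uxg) (lcm _ zq xiq).
  by rewrite !(nu_alt ag) //; lia.
have {}jm : (j <= m.-1)%N by have := le_nu gl Prr rq; rewrite rE !(nu_alt ag).
case: j j0 jm rE => // s _ sm rE.
set c := alt_letter s z xi; have uc : unit_length c by exact: unit_alt_letter.
have Pc := unit_pos uc.
set rl := alternating s z xi; have Prl : P rl by exact: (unit_pos_alt ag).
have {}rE : rr = rl * c by rewrite rE alternatingSr.
have yBr : yt <=| B * rr by rewrite -jE; exact: joinr.
have yBrl : ~ yt <=| B * rl.
  move=> /rmin/(_ Prl) /(le_nu gl Prr).
  by rewrite rE (gl_M gl Prl Pc); case: uc => _ ->; lia.
have [B' PB' /esym yB'] := leE yBr.
have B'c : ~ gediv P B' c.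
  move=> h1; apply: yBrl; rewrite /lediv.
  have -> : yt^-1 * (B * rl) = B' * c^-1.
    have -> : B' = yt^-1 * (B * rr) by rewrite -yB' mulKg.
    by rewrite rE -!mulgA mulgV mulg1.
  exact: h1.
have yB'c : gediv P (yt * B') c.
  by rewrite yB' rE /gediv mulgA mulgK; exact: (posM gl).
pose rs := alternating (m.-1 - s.+1) (alt_letter s.+1 z xi) (alt_letter s.+2 z xi).
have qE : q = rr * rs.
  by rewrite rE -alternatingSr -alternating_cat subnKC.
have Prs : P rs by apply: (unit_pos_alt ag); exact: unit_alt_letter.
have yB'D : yt * B' <=| D ^+ r.+1.
  by rewrite yB'; apply: (le_trans gl _ BqD); rewrite qE mulgA; apply: le_mulr.
have B'D : B' <=| D ^+ r.+1.
  rewrite /lediv; move: yB'D; rewrite /lediv; gsimp => h1.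
  have h2 : P (D ^- r.+1 * yt * D ^+ r.+1) by apply/(pos_conjDn gl).
  by have := posM gl h1 h2; gsimp.
have [F' [F1 [f [[PF' PF1] B'E F'D uf yF]]]] := carry_right ag PB' B'D uyh uc B'c yB'c.
(* Otherwise [g * q] and [h * yt * F1], which belong to the sets of [x] and [y], would be at
   distance r. *)
have noclose : ~ F' * rs <=| D ^+ r.
  move=> h1; apply: far; exists (g * q), (h * yt * F1); split.
  - rewrite csetE conjgM -/xi.
    have -> : xi ^ q = alt_letter m.-1 z xi.
      rewrite /conjg; apply: (mulgI q); rewrite mulVKg -alternatingSr -alternatingS prednK ?e //.
      exact: ltnW.
    by apply: unit_pos; exact: unit_alt_letter.
  - rewrite csetE (conjgM _ _ F1) (conjgM _ h yt) -/yt (conj_self yt).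
    by rewrite conjgE yF mulKg; exact: (unit_pos uf).
  - have -> : g * q = h * yt * F1 * (F' * rs).
      by rewrite gE qE !mulgA -[h * B * rr]mulgA -yB' B'E !mulgA.
    by apply: le_mulr; exact: (posM gl).
  - have -> : g * q = h * yt * F1 * (F' * rs).
      by rewrite gE qE !mulgA -[h * B * rr]mulgA -yB' B'E !mulgA.
    by rewrite lediv_mul2l.
have sm' : (s.+2 < m)%N.
  rewrite ltnNge; apply/negP => ms; apply: noclose.
  by have -> : rs = 1; [rewrite /rs; have -> : (m.-1 - s.+1 = 0)%N by lia|rewrite mulg1].
(* For r > 0 the last simple factor [A] of [F'] is right divisible by neither atom, so [A * rs] is
   still simple, against [noclose]. *)
have r0 : r = 0%N.
  case: (r) F'D noclose => [//|r'] F'D noclose; exfalso; apply: noclose.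
  have B'z : ~ gediv P B' (alt_letter s.+1 z xi).
    move=> h1; have h2 : gediv P (B * rr) (alt_letter s.+1 z xi).
      by rewrite -yB' /gediv -mulgA; exact: (posM gl).
    have h3 : gediv P (B * rr) (alt_letter s z xi) by rewrite -yB'.
    have [hz hx] : gediv P (B * rr) z /\ gediv P (B * rr) xi.
      by move: h2 h3; rewrite /alt_letter /=; case: (odd s).
    have := right_lcm ag uz uxg dp (posM gl PB Prr) hz hx.
    have [w wE uE] := @alternating_before _ (m - s.+1) s.+1 z xi (ltac:(rewrite subn_gt0; lia)).
    have Pw : P w by case: wE => ->; exact: (unit_pos_alt ag).
    have {}uE : w * xi * rr = alternating m z xi.
      by rewrite rE -alternatingSr; rewrite subnK in uE; [case: uE => ->|lia].
    rewrite -uE /gediv => k; apply: Bx.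
    have -> : gediv P B xi = P (B * rr * (w * xi * rr)^-1 * w).
      by rewrite /gediv; congr P; gsimp.
    exact: (posM gl).
  have [t [lt _ tE ts]] := normal_form gl PF' F'D.
  have [F'' [A [PF'' [PA AD] F'E F''D]]] : exists F'' A, [/\ P F'', P A /\ A <=| D, F' = F'' * A & F'' <=| D ^+ r'].
    case/lastP: t lt tE ts => [|t a].
      move=> _ <- _; exists 1, 1; rewrite prods_nil mulg1 !le1P; split => //; try exact: pos1 gl.
        by split; [exact: pos1 gl|exact: posD gl].
      by apply: (posX gl); exact: posD gl.
    rewrite size_rcons -cats1 => /letters_cat[lt /letters_cons[[Pa _ aD] _]].
    rewrite prods_cat prods_cons prods_nil mulg1 => <- ts; exists (prods t), a; split => //.
      exact: (letters_pos gl).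
    apply: (le_trans gl (prods_le_D gl lt)).
    by rewrite -[D ^+ size t]mul1g -[D ^+ r']mul1g; apply: (le_Dleq gl).
  have nA w : ~ gediv P B' w -> ~ gediv P A w.
    move=> h1 h2; apply: h1; rewrite B'E F'E /gediv -!mulgA.
    by do 2!apply: (posM gl) => //.
  rewrite F'E -mulgA expgSr; apply: (@le_trans _ _ _ _ gl (F'' * D)).
    rewrite lediv_mul2l /rs.
    have ul i : unit_length (alt_letter i z xi) by exact: unit_alt_letter.
    apply: (@simple_mul_alt m) => //; [|exact: nA|by apply: nA; rewrite alt_letterSS|by lia].
    by rewrite /alt_letter /= negbK; case: (odd s) => //; exact: dihedral_sym.
  by have /(le_mulDn gl 1) := F''D; rewrite expg1.
have BrD : B * rr <=| D.
  rewrite -jE; apply: le_join; last exact: (unit_le_D gl).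
  by have := le_mul ag Pq (le_refl gl B) => h1; apply: (le_trans gl h1); rewrite r0 expg1 in BqD.
(* With r = 0 the element [B * rl] is simple, and the exchange property carries [yt] through it to
   the atom [c]. This places [y] at [g * rl]. *)
have carry : yt * (B * rl) = B * rl * c.
  apply: (simple_carry ag) => //; first exact: (posM gl).
    by apply: (le_trans gl _ BrD); rewrite rE mulgA; apply: le_mulr.
  by rewrite -mulgA -rE.
have yc : y ^ (g * rl) = c.
  by rewrite gE -mulgA (conjgM y h) -/yt conjgE carry mulKg.
split=> //; exists s; split => //; split => //.
rewrite lt0n; apply/eqP => s0.
apply: far; rewrite r0; exists g, g; rewrite expg0 mulg1; split => //; try exact: (le_refl gl).
by have := yc; rewrite /rl s0 mulg1 csetE => ->.
Qed.

Lemma dihedral_conj m a b : dihedral_pair m a b ->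
  b ^ alternating m.-1 a b = alt_letter m.-1 a b.
Proof.
move=> [m2 e _ _]; rewrite conjgE; apply: (mulgI (alternating m.-1 a b)).
by rewrite mulVKg -alternatingSr -alternatingS prednK ?e // ltnW.
Qed.

(** Induction strips the atom [x ^ g] from the end of [h^-1 * g]. This keeps the element in the set
    of [x], and by [far_carry] the wall still lies across the move by the alternating word. *)
Lemma wall_crossing_alt h g z m :
  cset y h -> cset x g -> h <=| g ->
  unit_length z -> z <> x ^ g -> dihedral_pair m z (x ^ g) ->
  ~ h * y ^ h <=| g -> h * y ^ h <=| g * alternating m.-1 z (x ^ g) ->
  g * alternating m.-1 z (x ^ g) <=| h * D ^+ r.+1 ->
  r = 0%N /\ exists g' a b k s, dihedral_position x y g' a b k s.
Proof.
move=> yh; have [n] := ubnP (nu (h^-1 * g)); elim: n g => // n IH g gn xg hg uz zx dp yg ygq gqD.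
have [Bx|Bx] := EM (gediv P (h^-1 * g) (x ^ g)); last first.
  have [r0 [s ds]] := wall_dihedral yh xg hg uz zx dp yg ygq gqD Bx.
  by split => //; exists g, z, (x ^ g), m, s.
have uxg := conj_unit_at gl cx xg; have uyh := conj_unit_at gl cy yh.
have xg'E : x ^ (g * (x ^ g)^-1) = x ^ g by rewrite (conjgM x g) [LHS]conjgE invgK mulgV mulg1.
have xg' : cset x (g * (x ^ g)^-1) by rewrite csetE xg'E; exact: (unit_pos uxg).
have hg' : h <=| g * (x ^ g)^-1 by move: Bx; rewrite /gediv /lediv mulgA.
have Pxg := unit_pos uxg.
have le1 : g * (x ^ g)^-1 <=| g by rewrite /lediv invgM invgK -mulgA mulVg mulg1.
set q := alternating m.-1 z (x ^ g) in ygq gqD.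
have uq : unit_length (alt_letter m.-1 z (x ^ g)) by exact: unit_alt_letter.
have qE : x ^ g * q = q * alt_letter m.-1 z (x ^ g).
  by rewrite -(dihedral_conj dp) -/q conjgE mulVKg.
have gqE : g * q = g * (x ^ g)^-1 * q * alt_letter m.-1 z (x ^ g).
  by rewrite -[RHS]mulgA -qE mulgA mulgVK.
have g'q : g * (x ^ g)^-1 * q <=| g * q by rewrite gqE; apply: le_mulr; exact: (unit_pos uq).
apply: (IH (g * (x ^ g)^-1)); rewrite ?xg'E //.
- have : nu (h^-1 * g) = (nu (h^-1 * (g * (x ^ g)^-1)) + nu (x ^ g))%N.
    by rewrite -(gl_M gl hg' Pxg); congr nu; rewrite -mulgA mulgVK.
  by case: uxg => _ ->; lia.
- by move=> h1; apply: yg; exact: (le_trans gl h1).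
- apply: contrapT => nyq.
  have xq : x ^ (g * (x ^ g)^-1 * q) = alt_letter m.-1 z (x ^ g).
    by rewrite conjgM xg'E; exact: dihedral_conj.
  pose E := h^-1 * (g * (x ^ g)^-1 * q).
  have hE : h * E = g * (x ^ g)^-1 * q by rewrite mulVKg.
  have PE : P E.
    by rewrite /E mulgA; apply: (posM gl) => //; exact: (unit_pos_alt ag).
  apply: (@far_carry y x r h E (y ^ h) cy cx far') => //.
  - by rewrite hE csetE xq; exact: (unit_pos uq).
  - by rewrite -(lediv_mul2l P h) hE; exact: (le_trans gl g'q).
  - by rewrite -(lediv_mul2l P h) hE.
  - by rewrite hE xq -(lediv_mul2l P h) (mulgA h E) hE -gqE.
- exact: (le_trans gl g'q).
Qed.

(* The wall of y at h can be crossed inside the set of x only in the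
   exceptional position. *)
Lemma wall_crossing h g g1 :
  cset y h -> cset x g -> cset x g1 -> h <=| g -> g <=| g1 -> g1 <=| h * D ^+ r.+1 ->
  ~ h * y ^ h <=| g -> h * y ^ h <=| g1 ->
  r = 0%N /\ exists g' a b k s, dihedral_position x y g' a b k s.
Proof.
move=> yh; have [n] := ubnP (nu (g^-1 * g1)); elim: n g => // n IH g gn xg xg1 hg gg1 g1D yg yg1.
have uxg := conj_unit_at gl cx xg; have uyh := conj_unit_at gl cy yh.
have Pxg := unit_pos uxg.
have e1 : g^-1 * g1 <> 1.
  move=> e1; apply: yg; suff -> : g = g1 by [].
  by apply: (mulgI g^-1); rewrite mulVg e1.
have step g2 : cset x g2 -> g <=| g2 -> g2 <=| g1 -> g <> g2 -> ~ h * y ^ h <=| g2 ->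
    r = 0%N /\ exists g' a b k s, dihedral_position x y g' a b k s.
  move=> xg2 gg2 g21 ng yg2; apply: (IH g2) => //; last exact: (le_trans gl hg).
  have e2 : nu (g^-1 * g1) = (nu (g^-1 * g2) + nu (g2^-1 * g1))%N.
    by rewrite -(gl_M gl gg2 g21); congr nu; gsimp.
  have : (0 < nu (g^-1 * g2))%N.
    apply: (nu_gt0 gl) => // e3; apply: ng; apply: (mulgI g^-1).
    by rewrite e3 mulVg.
  lia.
have [xe|xe] := EM (x ^ g <=| g^-1 * g1).
  have gx1 : g * x ^ g <=| g1 by rewrite -(lediv_mul2l P g^-1) mulKg.
  have ngx : g <> g * x ^ g.
    move=> /(congr1 (fun w => g^-1 * w)); rewrite mulVg mulKg => /esym.
    exact: (unit_neq1 gl uxg).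
  have gx : g <=| g * x ^ g by apply: le_mulr.
  apply: (step (g * x ^ g)) => //; first exact: cset_mul_unit.
  have hE : h * (h^-1 * g) = g by rewrite mulVKg.
  have := @far_carry y x r h (h^-1 * g) (y ^ h) cy cx far' yh.
  rewrite hE => h1 h2; apply: h1 => //.
  - by rewrite -(lediv_mul2l P h) hE; apply: (le_trans gl gg1).
  - by rewrite -(lediv_mul2l P h) hE.
  - by move: h2; rewrite /lediv invgM -!mulgA.
have [z uz ze] := ag_gen ag gg1 e1.
have zx : z <> x ^ g by move=> zx; apply: xe; rewrite -zx.
have [m dp] := ag_dihedral ag uz uxg zx.
have [m2 e lcm _] := dp.
(* [z] and [x ^ g] both divide [x ^ g * (g^-1 * g1)], which equals [g^-1 * g1 * x ^ g1]; so their
   lcm does, and its first letter [x ^ g] cancels. *)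
have qe : alternating m.-1 z (x ^ g) <=| g^-1 * g1.
  rewrite -(lediv_mul2l P (x ^ g)) -alternatingS prednK ?(ltnW m2) // -e; apply: lcm.
    have -> : x ^ g * (g^-1 * g1) = g^-1 * g1 * x ^ g1 by rewrite !conjgE; gsimp.
    by apply: (le_mul ag) => //; move: xg1; rewrite csetE.
  exact: le_mulr.
have gq1 : g * alternating m.-1 z (x ^ g) <=| g1 by rewrite -(lediv_mul2l P g^-1) mulKg.
have Pq : P (alternating m.-1 z (x ^ g)) by exact: (unit_pos_alt ag).
have [yq|yq] := EM (h * y ^ h <=| g * alternating m.-1 z (x ^ g)).
  by apply: (wall_crossing_alt yh xg hg uz zx dp) => //; exact: (le_trans gl gq1).
apply: (step (g * alternating m.-1 z (x ^ g))) => //.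
- rewrite csetE conjgM (dihedral_conj dp); apply: (unit_pos (nu := nu)); exact: unit_alt_letter.
- exact: le_mulr.
- move=> /(congr1 (fun w => nu (g^-1 * w))); rewrite mulVg mulKg.
  rewrite (nu1 gl) (nu_alt ag) //; lia.
Qed.

End Wall.
End Crossing.

(** * Summits in Artin groups *)

Section GoodSequences.
Variables (G : groupType) (P : set G) (D : G) (nu : G -> nat).
Local Notation "a <=| b" := (lediv P a b) (at level 70, no associativity).
Local Notation unit_length := (unit_length P nu).
Local Notation conj_unit := (conj_unit P nu).
Local Notation cset := (cset P).
Local Notation close := (close P D).
Variable rev : G -> G.
Hypothesis ag : artin_garside P D nu rev.
Let gl : garside_length P D nu := ag.

(** The last three conditions make the junctions left weighted: the letter before ends in the atom
    [z], the product of [z] and the next letter is simple, and [z] is the only atom starting that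
    product. *)
Record good_sequence (x : bool -> G) (r : nat) (v : nat -> G) (El : nat -> seq G) : Prop :=
  GoodSequence {
    good_cset : forall n, cset (x (odd n)) (v n);
    good_step : forall n, v n = v n.+1 * prods (El n);
    good_letters : forall n, letters P D (El n);
    good_chain : forall n, lwchain P D (El n);
    good_size : forall n, size (El n) = r.+1;
    good_return : forall n, v n <=| v n.+2 * D ^+ r.+1;
    good_headN : forall n, ~ x (odd n.+1) ^ v n.+1 <=| head 1 (El n);
    good_head : forall n c, unit_length c ->
      c <=| x (odd n.+1) ^ v n.+1 * head 1 (El n) -> c = x (odd n.+1) ^ v n.+1;
    good_last : forall n, gediv P (last 1 (El n)) (x (odd n) ^ v n)
  }.

Section Good.
Variables (x : bool -> G) (k : bool -> nat) (r : nat) (v : nat -> G) (El : nat -> seq G).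
Hypothesis cx : forall b, conj_unit (x b).
Hypothesis k0 : forall b, (0 < k b)%N.
Hypothesis gd : good_sequence x r v El.
Hypothesis far : ~ close (x false) (x true) r.

Let X := x false ^+ k false * x true ^+ k true.
Let z n := x (odd n) ^ v n.
(** One of the atoms is absorbed by the first letter of [El n]. A block is thus one letter shorter
    than in the symmetric case, and two blocks account for the final -2. *)
Let bl n := nseq (k (odd n.+1)).-1 (z n.+1) ++ (z n.+1 * head 1 (El n)) :: behead (El n).

Lemma good_unit n : unit_length (z n).
Proof. by apply: (conj_unit_at gl) => //; exact: (good_cset gd). Qed.

Let uz := good_unit.

Lemma good_El n : exists a s, El n = a :: s.
Proof. by have := good_size gd n; case: (El n) => // a s _; exists a, s. Qed.

Lemma good_head_letter n : letter P D (head 1 (El n)).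
Proof.
have [a [s E]] := good_El n; have := good_letters gd (n := n).
by rewrite E => /letters_cons[].
Qed.

Lemma good_zhead_letter n : letter P D (z n.+1 * head 1 (El n)).
Proof.
have [Pa a1 aD] := good_head_letter n; have Pz := unit_pos (uz n.+1).
split; first exact: (posM gl).
  move=> e; apply: (unit_neq1 gl (uz n.+1)); apply: (pos_inv_eq1 gl) => //.
  by rewrite -e; apply: le_mulr.
by apply: (simple_mull ag) => //; exact: (good_headN gd).
Qed.

(** Since [a] ends in [c], the product [a * c] contains a square and is not simple; and [c] is the
    only atom that could move from [b] to [a]. *)
Lemma lw_unit_start a b c : P a -> unit_length c -> gediv P a c ->
  (forall d, unit_length d -> d <=| b -> d = c) -> lw P D a b.
Proof.
move=> Pa uc ac hb p Pp pb apD; apply: contrapT => p1.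
have [d ud dp] := ag_gen ag Pp p1.
have dc : d = c by apply: hb => //; exact: (le_trans gl dp).
rewrite dc in dp.
apply: (simple_mulrN ag Pa uc ac); apply: (le_trans gl _ apD).
by rewrite lediv_mul2l.
Qed.

Lemma good_last_gediv n : gediv P (last 1 (bl n.+1)) (z n.+1).
Proof.
have Pz := unit_pos (uz n.+2); have gl1 := good_last gd n.+1.
have [a [s E]] := good_El n.+1; move: gl1; rewrite /bl last_cat E /= -/(z n.+1).
case: s E => [|b s] E //= h; rewrite /gediv -mulgA; exact: (posM gl).
Qed.

Lemma good_bl_start n d : unit_length d -> d <=| head 1 (bl n) -> d = z n.+1.
Proof.
move=> ud; rewrite /bl; case: (k _).-1 => [|j] /=; first exact: (good_head gd).
exact: (unit_le_eq ag).
Qed.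

Lemma good_bl_chain n : lwchain P D (bl n).
Proof.
have Pz := unit_pos (uz n.+1); have Pz1 : P 1 := pos1 gl.
have zz : gediv P (z n.+1) (z n.+1) by rewrite /gediv mulgV.
apply: lwchain_cat.
- apply: lwchain_nseq => _; apply: (lw_unit_start Pz (uz n.+1)) => // d ud.
  exact: (unit_le_eq ag).
- have := good_chain gd n; have := good_letters gd (n := n); have [a [s E]] := good_El n.
  rewrite E => ls [ab ch] /=; split => //.
  have /letters_cons[[Pa _ _] _] := ls.
  case: s {E ls ch} ab => // b s ab p Pp pb zapD; apply: ab => //.
  by apply: (simple_factor gl Pz); rewrite mulgA.
- move=> n0 _; have -> : last 1 (nseq (k (odd n.+1)).-1 (z n.+1)) = z n.+1.
    by rewrite last_nseq //; move: n0; case: (k _).-1.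
  by apply: (lw_unit_start Pz (uz n.+1)) => // d ud /=; exact: (good_head gd).
Qed.

Lemma good_bl_letters n : letters P D (bl n).
Proof.
apply/letters_cat; split; first by apply: letters_nseq; exact: (unit_letter gl).
apply/letters_cons; split; first exact: good_zhead_letter.
have := good_letters gd (n := n); have [a [s E]] := good_El n.
by rewrite E => /letters_cons[].
Qed.

Lemma good_bl_step n : x (odd n.+1) ^+ k (odd n.+1) * v n = v n.+1 * prods (bl n).
Proof.
rewrite {1}(good_step gd n) mulgA mulX_conj -/(z n.+1) -mulgA; congr (_ * _).
have [a [s E]] := good_El n; rewrite /bl E prods_cat prods_nseq !prods_cons /=.
by rewrite -{1}(prednK (k0 (odd n.+1))) expgSr !mulgA.
Qed.

Lemma good_bl_size n : size (bl n) = ((k (odd n.+1)).-1 + r.+1)%N.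
Proof.
rewrite size_cat size_nseq /= size_behead (good_size gd) //.
Qed.

Theorem summit_good : D <> 1 ->
  summit_inf P D X = (- Posz r.+1)%R /\
  summit_len P D X = (r.+1 + (r + k false + k true - 2).+1)%N.
Proof.
move=> D1; have [kf kt] := (k0 false, k0 true).
have bl0 n : bl n <> [::] by move=> /(congr1 size); rewrite good_bl_size addnS.
have El0 n : El n <> [::] by have [a [s ->]] := good_El n.
have bl_cat n s : s <> [::] -> lwchain P D s -> gediv P (last 1 s) (z n.+1) -> letters P D s ->
    lwchain P D (s ++ bl n).
  move=> s0 ch ls lts; apply: lwchain_cat => //; first exact: good_bl_chain.
  move=> _ _; apply: (lw_unit_start _ (uz n.+1)) => //; last by move=> d; exact: good_bl_start.
  by case/lastP: s s0 lts {ch ls} => // s a _ lts; rewrite last_rcons;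
    have [] := lts a; rewrite // mem_rcons mem_head.
have vle n : v n.+1 <=| v n.
  by rewrite [v n](good_step gd); apply: le_mulr; exact: (letters_pos gl (@good_letters _ _ _ _ gd n)).
have vD n : v n <=| v n.+1 * D ^+ r.+1.
  rewrite [v n](good_step gd) lediv_mul2l -(good_size gd n).
  exact: (prods_le_D gl (@good_letters _ _ _ _ gd n)).
apply: (summit_values gl D1).
- apply: (@descent_inf _ _ _ _ gl x (fun b => x b ^+ k b) v El bl (good_cset gd)).
  + exact: good_step gd.
  + exact: good_bl_step.
  + by move=> n; exact: (@good_letters _ _ _ _ gd n).
  + exact: good_bl_letters.
  + exact: bl0.
  + exact: El0.
  + move=> n; apply: bl_cat => //; [exact: good_bl_chain|exact: good_last_gediv|exact: good_bl_letters].
  + move=> n; apply: bl_cat => //; [exact: (good_chain gd)|exact: (good_last gd)|].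
    exact: (@good_letters _ _ _ _ gd n.+1).
  (* An atom of [V] divides [z n.+1 * V], because this equals [V * z n.+1 ^ V]. It then divides
     [z n.+1] times the head, so it is [z n.+1], which does not divide the head. *)
  + move=> n V PV VE xV; apply: contrapT => V1.
    have [c uc cV] := ag_gen ag PV V1.
    have [Ph _ _] := good_head_letter n.
    have PzV : P (z n.+1 ^ V) by rewrite -conjgM -csetE.
    have zV : z n.+1 * V = V * z n.+1 ^ V by rewrite conjgE mulVKg.
    have cz : c = z n.+1.
      apply: (good_head gd) => //; rewrite -/(z n.+1).
      apply: (@le_trans _ _ _ _ gl (z n.+1 * V)); last by rewrite lediv_mul2l.
      by rewrite zV; apply: (le_mul ag).
    by apply: (good_headN gd (n := n)); rewrite -/(z n.+1) -cz; exact: (le_trans gl cV).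
  + by move=> g h xg yh hg gh; apply: far; exists g, h.
- apply: (@descent_sup _ _ _ _ gl (fun b => x b ^+ k b) v bl r.+1).
  + exact: good_bl_step.
  + exact: good_bl_letters.
  + exact: bl0.
  + move=> n; apply: bl_cat => //; [exact: good_bl_chain|exact: good_last_gediv|exact: good_bl_letters].
  + exact: (good_return gd).
  + by move=> n; rewrite !good_bl_size /=; case: (odd n) => /=; lia.
- exists (v 0); split.
    have C0 := good_cset gd 0; have C1 := good_cset gd 1.
    apply: (le_trans gl (cset_X gl (k false) C0)); rewrite /X -!mulgA lediv_mul2l !mulgA.
    apply: (le_trans gl (vD 0%N)); apply/(le_mulDn gl).
    apply: (le_trans gl (cset_X gl (k true) C1)).
    by rewrite lediv_mul2l.
  (* The last letter of [El 0] ends in [z 0]; dividing it out cancels one of the atoms at [v 0] and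
     saves one factor [D]. *)
  have v1z : v 1%N <=| v 0%N * (z 0)^-1.
    rewrite [v 0%N](good_step gd) -mulgA; apply: le_mulr.
    have := good_last gd 0; have := @good_letters _ _ _ _ gd 0.
    case/lastP: (El 0%N) => [|s a] ls; rewrite ?last_rcons.
      by rewrite /= prods_nil /gediv mul1g.
    move: ls; rewrite -cats1 prods_cat prods_cons prods_nil mulg1 -mulgA => /letters_cat[ls _] h.
    by apply: (posM gl) => //; exact: (letters_pos gl).
  apply: (@le_trans _ _ _ _ gl (x false ^+ k false * v 1%N * D ^+ ((k true).-1 + r.+1))).
    rewrite /X -!mulgA lediv_mul2l.
    have := good_bl_step 0; rewrite /= => ->; rewrite lediv_mul2l.
    by apply: (le_trans gl (prods_le_D gl (@good_bl_letters 0))); rewrite good_bl_size; exact: (le_refl gl).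
  apply: (@le_trans _ _ _ _ gl (x false ^+ k false * (v 0%N * (z 0)^-1) * D ^+ ((k true).-1 + r.+1))).
    by apply/(le_mulDn gl); rewrite lediv_mul2l.
  have -> : x false ^+ k false * (v 0%N * (z 0)^-1) = v 0%N * z 0 ^+ (k false).-1.
    rewrite mulgA mulX_conj -mulgA; congr (_ * _).
    by rewrite -/(z 0) -{1}(prednK kf) expgSr mulgK.
  rewrite -mulgA lediv_mul2l.
  apply: (@le_trans _ _ _ _ gl (D ^+ (k false).-1 * D ^+ ((k true).-1 + r.+1))).
    by apply/(le_mulDn gl); exact: (unit_X_le_D gl _ (uz 0)).
  rewrite -expgnDr.
  have -> : ((k false).-1 + ((k true).-1 + r.+1) = (r + k false + k true - 2).+1)%N by lia.
  exact: (le_refl gl).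
Qed.

End Good.
End GoodSequences.

(** * Existence of good sequences and the exceptional dihedral case *)

Section GoodSequenceExistence.
Variables (G : groupType) (P : set G) (D : G) (nu : G -> nat).
Local Notation "a <=| b" := (lediv P a b) (at level 70, no associativity).
Local Notation unit_length := (unit_length P nu).
Local Notation conj_unit := (conj_unit P nu).
Local Notation cset := (cset P).
Local Notation close := (close P D).
Local Notation dihedral_pair := (dihedral_pair P).
Local Notation dihedral_position := (dihedral_position P nu).
Variable rev : G -> G.
Hypothesis ag : artin_garside P D nu rev.
Let gl : garside_length P D nu := ag.

Lemma good_or_dihedral (x : bool -> G) r :
  (forall b, conj_unit (x b)) -> close (x false) (x true) r.+1 -> ~ close (x false) (x true) r ->
  (exists v El, good_sequence P D nu x r v El) \/
  (r = 0%N /\ exists b g a a' m s, dihedral_position (x b) (x (~~ b)) g a a' m s).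
Proof.
move=> cx cl far; have farb := far_bool gl far.
have [v [vC vP vD]] := descending_sequence gl cx cl.
have [dih|ndih] := EM (r = 0%N /\ exists b g a a' m s, dihedral_position (x b) (x (~~ b)) g a a' m s).
  by right.
left.
have exE n : exists s, [/\ letters P D s, lwchain P D s, v n = v n.+1 * prods s & size s = r.+1].
  apply: (close_normal_form gl (farb (odd n))) => //.
    by case: (vP n).
  by case: (vP n).
pose El n := projT1 (cid (exE n)).
have ElP n : [/\ letters P D (El n), lwchain P D (El n), v n = v n.+1 * prods (El n)
  & size (El n) = r.+1] by rewrite /El; case: cid.
have vret := sequence_return gl vC vP vD.
have oddE n : odd n.+2 = odd n by rewrite /= negbK.
(* The condition on the last letter at [v n.+2] is proved from [v n.+1], so the start of the
   sequence is dropped; a shift by two preserves parity. *)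
exists (fun n => v n.+2), (fun n => El n.+2).
have headE n : head 1 (El n) <=| prods (El n).
  have [ls _ _] := ElP n; case: (El n) ls => // a s ls _; rewrite prods_cons.
  by apply: le_mulr; have /letters_cons[_ /(letters_pos gl)] := ls.
have max n V : P V -> V <=| head 1 (El n) -> cset (x (odd n.+1)) (v n.+1 * V) -> V = 1.
  move=> PV VE xV; have [_ _ vmax] := vP n; have [_ _ vE _] := ElP n.
  apply: (pos_inv_eq1 gl) => //; rewrite -(lediv_mul2l P (v n.+1)) mulg1; apply: vmax => //.
  by rewrite vE lediv_mul2l; exact: (le_trans gl VE).
have uz n : unit_length (x (odd n) ^ v n) by exact: (conj_unit_at gl).
have headN n : ~ x (odd n.+1) ^ v n.+1 <=| head 1 (El n).
  move=> h; apply: (unit_neq1 gl (uz n.+1)); apply: (max n) => //; first exact: (unit_pos (uz n.+1)).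
  by apply: cset_mul_unit; exact: vC.
split.
- by move=> n; have := vC n.+2; rewrite oddE.
- by move=> n; case: (ElP n.+2).
- by move=> n; case: (ElP n.+2).
- by move=> n; case: (ElP n.+2).
- by move=> n; case: (ElP n.+2).
- by move=> n; exact: vret.
- by move=> n; have := headN n.+2; rewrite oddE.
(* Another atom [c] would bring in the lcm of [c] and [z]. Cancelling [z] leaves an alternating word
   below the head that conjugates [z] to an atom, against [max]. *)
- move=> n c uc; have := headN n.+2; have := uz n.+3; have := max n.+2.
  rewrite -[odd n.+3]/(~~ odd n.+2) -[odd n.+1]/(~~ odd n) oddE.
  set b := ~~ odd n; set z := x b ^ v n.+3 => mx uzn hN hc.
  apply: contrapT => cz.
  have [m dp] := ag_dihedral ag uc uzn cz; have [m2 e lcm _] := dp.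
  have Pq : P (alternating m.-1 c z) by exact: (unit_pos_alt ag).
  have := nu_alt ag m.-1 uc uzn; rewrite (mx (alternating m.-1 c z)) //.
  + by rewrite (nu1 gl); lia.
  + rewrite -(lediv_mul2l P z) -alternatingS prednK ?(ltnW m2) // -e; apply: lcm => //.
    apply: le_mulr; have [ls _ _ _] := ElP n.+2; case: (El n.+2) ls => [|a s] ls.
      by rewrite /=; exact: (pos1 gl).
    by have /letters_cons[[]] := ls.
  + rewrite csetE conjgM -/z (dihedral_conj dp); apply: (unit_pos (nu := nu)); exact: unit_alt_letter.
(* If the last letter does not end in [z], its product with [z] is simple, so [v n.+2 * z] is below
   [v n.+3 * D ^+ r.+1] without being below [v n.+1]. Both of these bounds lie in the set of the
   other element, so a wall is crossed between them. *)
- move=> n; apply: contrapT => nlast; apply: ndih.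
  have [ls _ vE sE] := ElP n.+2; have un := uz n.+2; rewrite oddE in un.
  set z := x (odd n) ^ v n.+2 in nlast un.
  have [_ v21 vmax] := vP n.+1; rewrite oddE in vmax.
  have xz : cset (x (odd n)) (v n.+2 * z).
    by apply: cset_mul_unit; have := vC n.+2; rewrite oddE.
  have [r0 [g' [a [b [k [s ds]]]]]] : r = 0%N /\ exists g' a b k s,
      dihedral_position (x (odd n.+1)) (x (~~ odd n.+1)) g' a b k s.
    apply: (@wall_crossing _ _ _ _ _ ag (x (odd n.+1)) (x (~~ odd n.+1)) r (cx _) (cx _) (farb _)
      (v n.+2) (v n.+1) (v n.+3 * D ^+ r.+1)) => //.
    + by have := vC n.+2.
    + by apply: (cset_Dn gl); have := vC n.+3; rewrite oddE.
    + by apply/(le_mulDn gl); case: (vP n.+2).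
    + rewrite -[~~ odd n.+1]/(odd n.+2) oddE -/z => h; apply: (unit_neq1 gl un).
      apply: (pos_inv_eq1 gl); first exact: (unit_pos un).
      by rewrite -(lediv_mul2l P (v n.+2)) mulg1; exact: vmax.
    + rewrite -[~~ odd n.+1]/(odd n.+2) oddE -/z {1}vE -mulgA lediv_mul2l -sE.
      case/lastP: (El n.+2) nlast ls sE => [|t e]; first by [].
      rewrite last_rcons size_rcons -cats1 prods_cat prods_cons prods_nil mulg1 => nlast.
      move=> /letters_cat[lt /letters_cons[[Pe _ eD] _]] _.
      apply: (@le_trans _ _ _ _ gl (prods t * D)).
        by rewrite -mulgA lediv_mul2l; exact: (simple_mulr ag).
      by rewrite expgSr; have /(le_mulDn gl 1) := prods_le_D gl lt; rewrite expg1.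
  by split => //; exists (odd n.+1), g', a, b, k, s.
Qed.

Lemma alt_letter_alt i j (a b : G) :
  alt_letter i (alt_letter j a b) (alt_letter j.+1 a b) = alt_letter (i + j) a b.
Proof. by rewrite /alt_letter oddD /=; case: (odd i); case: (odd j). Qed.

Section Dihedral.
Variables (m : nat) (a b : G).
Hypothesis ua : unit_length a.
Hypothesis ub : unit_length b.
Hypothesis ab : a <> b.
Hypothesis dp : dihedral_pair m a b.

Let T := alternating m a b.

Lemma alt_letter_le i : (0 < i < m)%N -> letter P D (alternating i a b).
Proof.
move=> /andP[i0 im]; have Pi : P (alternating i a b) by exact: (unit_pos_alt ag).
split=> //.
  by move=> e; have := nu_alt ag i ua ub; rewrite e (nu1 gl); lia.
have [_ _ lcm _] := dp.
apply: (@le_trans _ _ _ _ gl T); last by apply: lcm; exact: (unit_le_D gl).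
by rewrite /T -(subnKC (ltnW im)) alternating_cat; apply: le_mulr;
  apply: (unit_pos_alt ag); exact: unit_alt_letter.
Qed.

Lemma alt_unit_le i c : (i < m)%N -> unit_length c -> c <=| alternating i a b -> c = a.
Proof.
move=> im uc ci; have [m2 e lcm dv] := dp.
have cT : c <=| T.
  apply: (le_trans gl ci); rewrite /T -(subnKC (ltnW im)) alternating_cat; apply: le_mulr.
  by apply: (unit_pos_alt ag); exact: unit_alt_letter.
have i0 : (0 < i)%N.
  rewrite lt0n; apply/eqP => i0; apply: (unit_neq1 gl uc); apply: (pos_inv_eq1 gl).
    exact: unit_pos uc.
  by move: ci; rewrite i0.
have ai : a <=| alternating i a b.
  by case: (i) i0 => // i' _; rewrite alternatingS; apply: le_mulr; exact: (unit_pos_alt ag).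
have [j _ cE] := dv c (unit_pos uc) cT.
have j1 : j = 1%N by case: (uc) => _ <-; case: cE => ->; rewrite (nu_alt ag).
move: cE; rewrite j1 /= mulg1 => -[//|]; rewrite mulg1 => cb.
rewrite cb in ci; have := le_nu gl (unit_pos_alt ag m ua ub) (lcm _ ai ci).
by rewrite !(nu_alt ag) // leqNgt im.
Qed.

Lemma dihedral_turn : T * alt_letter m a b * T^-1 = a /\ T * alt_letter m b a * T^-1 = b.
Proof.
have [_ e _ _] := dp; split.
  by rewrite -alternatingSr alternatingS -e mulgK.
by rewrite {1}/T e -alternatingSr alternatingS mulgK.
Qed.

(** [T] normalises the pair of atoms, fixing or exchanging them, so conjugation by its powers turns
    alternating words into alternating words in the same letters. *)
Definition turn (i : nat) (w : G) : G := T ^+ i * w * T ^- i.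

Lemma turnM i u w : turn i (u * w) = turn i u * turn i w.
Proof. by rewrite /turn; gsimp. Qed.

Lemma turnS i w : turn i.+1 w = turn i (T * w * T^-1).
Proof. by rewrite /turn expgSr; gsimp. Qed.

Lemma turn_alt i j u w : turn i (alternating j u w) = alternating j (turn i u) (turn i w).
Proof.
elim: j u w => [|j IH] u w; first by rewrite /turn mulg1 mulgV.
by rewrite !alternatingS turnM IH.
Qed.

Lemma turn_letter i j u w : turn i (alt_letter j u w) = alt_letter j (turn i u) (turn i w).
Proof. by rewrite /alt_letter; case: (odd j). Qed.

Lemma turn_pair i : (turn i a = a /\ turn i b = b) \/ (turn i a = b /\ turn i b = a).
Proof.
elim: i => [|i IH]; first by left; rewrite /turn expg0 invg1 mul1g mulg1; gsimp.
have [h1 h2] := dihedral_turn; rewrite !turnS; move: h1 h2; rewrite /alt_letter.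
case: (odd m) => h1 h2.
  have -> : T * a * T^-1 = b by [].
  have -> : T * b * T^-1 = a by [].
  by case: IH => [[-> ->]|[-> ->]]; [right|left].
by rewrite h1 h2.
Qed.

Lemma turn_dihedral i : [/\ unit_length (turn i a), unit_length (turn i b),
  turn i a <> turn i b & dihedral_pair m (turn i a) (turn i b)].
Proof.
case: (turn_pair i) => -[-> ->]; split => //; first by move=> e; apply: ab.
exact: dihedral_sym.
Qed.

End Dihedral.
End GoodSequenceExistence.

Section ArtinSummit.
Variables (G : groupType) (P : set G) (D : G) (nu : G -> nat).
Local Notation "a <=| b" := (lediv P a b) (at level 70, no associativity).
Local Notation unit_length := (unit_length P nu).
Local Notation conj_unit := (conj_unit P nu).
Local Notation cset := (cset P).
Local Notation close := (close P D).
Local Notation dihedral_pair := (dihedral_pair P).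
Local Notation dihedral_position := (dihedral_position P nu).
Variable rev : G -> G.
Hypothesis ag : artin_garside P D nu rev.
Let gl : garside_length P D nu := ag.

(** [x false] is an atom at [g] and [x true] one at [g * rho]. With [T = rho * w] the sequence is g,
    g rho T^-1, g T^-1, g rho T^-2, and so on; its quotients are [w] and [rho] conjugated by powers
    of [T]. The bounds on [s] ensure that these alternating words, even with one more letter in
    front (lengths s + 2 and m - s), stay shorter than m. *)
Lemma dihedral_good (x : bool -> G) g a b m s :
  dihedral_position (x false) (x true) g a b m s ->
  exists v El, good_sequence P D nu x 0 v El.
Proof.
move=> [xg [ua ub ab] dp [s0 sm] yg].
have [m2 _ lcm _] := dp.
pose T := alternating m a b; pose rho := alternating s.+1 a b.
pose w := alternating (m - s.+1) (alt_letter s.+1 a b) (alt_letter s.+2 a b).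
pose c := alt_letter s a b; pose tn := turn m a b.
have TE : T = rho * w by rewrite /rho /w -alternating_cat subnKC // ltnW // ltnW.
have TD : T <=| D by apply: lcm; exact: (unit_le_D gl).
pose v n := if odd n then g * rho * T ^- n./2.+1 else g * T ^- n./2.
pose E n := tn n./2.+1 (if odd n then rho else w).
pose z n := if odd n then tn n./2.+1 c else tn n./2 b.
have half1 n : n.+1./2 = (odd n + n./2)%N by rewrite /= uphalf_half.
have rhoE : rho = alternating s a b * c by rewrite /rho alternatingSr.
have zE n : x (odd n) ^ v n = z n.
  rewrite /v /z; case: (odd n).
    rewrite rhoE (conjgM _ _ (T ^- n./2.+1)) mulgA (conjgM _ _ c) yg conj_self.
    by rewrite conjgE invgK mulgA.
  by rewrite conjgM xg conjgE invgK mulgA.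
pose A n := tn n./2.+1 a; pose B n := tn n./2.+1 b.
have AB n : [/\ unit_length (A n), unit_length (B n), A n <> B n & dihedral_pair m (A n) (B n)].
  exact: (turn_dihedral ua ub ab dp).
have ul i n : unit_length (alt_letter i (A n) (B n)).
  by have [h1 h2 _ _] := AB n; exact: unit_alt_letter.
have pair i n : dihedral_pair m (alt_letter i (A n) (B n)) (alt_letter i.+1 (A n) (B n)).
  have [h1 h2 _ h4] := AB n; rewrite /alt_letter /=; case: (odd i) => //=.
  exact: dihedral_sym.
have neq i n : alt_letter i (A n) (B n) <> alt_letter i.+1 (A n) (B n).
  have [_ _ h _] := AB n; rewrite /alt_letter /=; case: (odd i) => //= e.
  by apply: h.
have Eodd n : odd n -> E n = alternating s.+1 (A n) (B n).
  by rewrite /E => ->; rewrite /tn /rho turn_alt.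
have Eeven n : ~~ odd n -> E n =
    alternating (m - s.+1) (alt_letter s.+1 (A n) (B n)) (alt_letter s.+2 (A n) (B n)).
  by rewrite /E => /negbTE ->; rewrite /tn /w turn_alt !turn_letter.
have zodd n : odd n -> z n = alt_letter s (A n) (B n).
  by rewrite /z => ->; rewrite /tn /c turn_letter.
have zSodd n : odd n -> z n.+1 = B n.
  by move=> on; rewrite /z half1 /= on /= add1n.
have zSeven n : ~~ odd n -> z n.+1 = alt_letter s (A n) (B n).
  by move=> /negbTE on; rewrite /z half1 /= on /= add0n /tn /c turn_letter.
have zeven n : ~~ odd n -> z n = alt_letter m.-1 (A n) (B n).
  move=> /negbTE on; rewrite /z on /tn; have [_ h] := dihedral_turn dp.
  rewrite -[X in turn _ _ _ _ X]h -turnS turn_letter -/tn -/(A n) -/(B n).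
  by rewrite -{1}(prednK (ltnW m2)) alt_letter_swap.
have lE n : letter P D (E n).
  have [on|on] := boolP (odd n).
    rewrite Eodd //; have [h1 h2 _ h4] := AB n.
    by apply: (alt_letter_le ag h1 h2 h4); rewrite (ltnW sm).
  by rewrite Eeven //; apply: (alt_letter_le ag (ul _ n) (ul _ n) (pair _ n)); lia.
have vS n : v n = v n.+1 * E n.
  have gen (u p q t : G) i : t = p * q ->
      u * t ^- i = u * p * t ^- i.+1 * (t ^+ i.+1 * q * t ^- i.+1).
    by move=> tE; gsimp; rewrite -(mulgA u) -tE expgSr invgM !mulgA mulgK.
  rewrite /v /E half1 /=; case: (odd n) => /=; last exact: gen.
  by rewrite add1n /tn /turn -/T -/rho !mulgA mulgVK.
have h0 n : head 1 [:: E n] = E n by [].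
exists v, (fun n => [:: E n]); split.
- move=> n; rewrite csetE zE; have [on|on] := boolP (odd n).
    by rewrite zodd //; exact: (unit_pos (ul _ n)).
  by rewrite zeven //; exact: (unit_pos (ul _ n)).
- by move=> n; rewrite prods_cons prods_nil mulg1.
- by move=> n _ /[!inE] /eqP ->.
- by move=> n.
- by move=> n.
- move=> n; rewrite expg1 /v -[n.+2./2]/(n./2.+1) -[odd n.+2]/(~~ ~~ odd n) negbK.
  have e u i : (u * T ^- i <=| u * T ^- i.+1 * D) = (T <=| D).
    by rewrite /lediv expgS; congr P; gsimp.
  by case: (odd n); rewrite e.
- move=> n; rewrite zE h0; have [on|on] := boolP (odd n).
    rewrite zSodd // Eodd //; have [h1 h2 h3 h4] := AB n.
    move=> /(alt_unit_le ag h1 h2 h4 _ h2) h; apply: h3; apply/esym/h.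
    exact: ltnW.
  rewrite zSeven // Eeven // => /(alt_unit_le ag (ul _ n) (ul _ n) (pair _ n) _ (ul _ n)) h.
  by apply: (neq s n); apply: h; lia.
- move=> n d ud; rewrite zE h0; have [on|on] := boolP (odd n).
    rewrite zSodd // Eodd // -alternatingS; have [h1 h2 h3 h4] := AB n.
    exact: (alt_unit_le ag h2 h1 (dihedral_sym h4)).
  rewrite zSeven // Eeven // alt_letterSS -alternatingS.
  by apply: (alt_unit_le ag (ul _ n) (ul _ n) (pair _ n)) => //; lia.
- move=> n; rewrite zE /=; have [on|on] := boolP (odd n).
    rewrite zodd // Eodd // /gediv alternatingSr mulgK; have [h1 h2 _ _] := AB n.
    exact: (unit_pos_alt ag).
  rewrite zeven // Eeven //; have [i iE] : exists i, (m - s.+1 = i.+1)%N by exists (m - s.+2)%N; lia.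
  rewrite iE alternatingSr alt_letter_alt; have -> : (i + s.+1 = m.-1)%N by lia.
  by rewrite /gediv mulgK; exact: (unit_pos_alt ag).
Qed.

Lemma cclass_swap (a b : G) : cclass (a * b) = cclass (b * a).
Proof.
have h (c d : G) : cclass (c * d) `<=` cclass (d * c).
  move=> _ [u _ <-]; exists (c^-1 * u) => //.
  by rewrite !conjgE; gsimp.
by apply/seteqP; split; exact: h.
Qed.

Theorem summit_artin (k l : nat) (x y X : G) : D <> 1 ->
  (0 < k)%N -> (0 < l)%N -> unit_length x -> unit_length y ->
  setmulg (cclass (x ^+ k)) (cclass (y ^+ l)) X ->
  (summit_inf P D X < 0)%R ->
  Posz (summit_len P D X) = (- 2 * summit_inf P D X + Posz k + Posz l - 2)%R.
Proof.
move=> D1 k0 l0 ux uy [_ [z1 _ <-] [_ [z2 _ <-] <-]].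
rewrite !conjXg.
pose xs (b : bool) := if b then y ^ z2 else x ^ z1.
pose ks (b : bool) := if b then l else k.
have cx b : conj_unit (xs b) by case: b; [exists y, z2|exists x, z1].
have ks0 b : (0 < ks b)%N by case: b.
have [/(close0 gl)[g [xg yg]] h|] := EM (close (xs false) (xs true) 0%N).
  exfalso; apply: (@summit_inf_ge0 _ _ _ _ gl D1 _ g _ h).
  apply: (le_trans gl (cset_X gl k xg)); rewrite -mulgA lediv_mul2l; exact: (cset_X gl l yg).
move=> c0 _; have [r [cl far]] := close_min gl (cx false) (cx true) c0.
have [[v [El gd]]|[r0 [b [g [a [a' [m [s ds]]]]]]]] := good_or_dihedral ag cx cl far.
  have [-> ->] := summit_good ag cx ks0 gd far D1.
  rewrite /ks /=; lia.
(* The two factors are exchanged if necessary, so that the one positive at [g] comes first; the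
   conjugacy class of the product does not change. *)
pose xs' c := xs (c (+) b); pose ks' c := ks (c (+) b).
have ds' : dihedral_position (xs' false) (xs' true) g a a' m s.
  by rewrite /xs' addFb addTb.
have [v [El gd]] := dihedral_good ds'.
have far' : ~ close (xs' false) (xs' true) 0.
  by rewrite /xs' addFb addTb -r0; exact: (far_bool gl far).
have [e1 e2] := @summit_good _ _ _ _ _ ag xs' ks' 0%N v El (fun c => cx _) (fun c => ks0 _) gd far' D1.
have eX : cclass ((x ^ z1) ^+ k * (y ^ z2) ^+ l) =
    cclass (xs' false ^+ ks' false * xs' true ^+ ks' true).
  by rewrite /xs' /ks'; case: (b); [exact: cclass_swap|].
rewrite /summit_len /summit_inf eX -/(summit_len _ _ _) -/(summit_inf _ _ _) e1 e2.
by rewrite /ks' /ks; case: (b) => /=; lia.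
Qed.

End ArtinSummit.

Fixpoint alternate (T : Type) (m : nat) (f g : T -> T) (v : T) : T :=
  if m is m'.+1 then f (alternate m' g f v) else v.

(** * Representations of Artin groups *)

Section HeckeRepresentation.
Local Open Scope ring_scope.
Variables (K : fieldType) (n : nat) (mat : nat -> nat -> nat) (q tau : K).

(* The value of 4 cos^2 (pi / m) for m <= 5, with tau = 4 cos^2 (pi / 5). *)
Definition edge_weight (m : nat) : K :=
  if m == 3%N then 1 else if m == 4%N then 2 else if m == 5%N then tau else 0.

(** For a label m other than 2, the two opposite coefficients have product q times the edge weight
    of m, as the braid relation requires. All of q is put below the diagonal, so that at q = 2 these
    entries are even and the matrices become triangular modulo 2. *)
Definition coef (i j : nat) : K :=
  let m := mat i j in
  if m == 2%N then 0 else if (i < j)%N then 1 else q * edge_weight m.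

(* A representation of Burau type; at q = 1 the generators act by reflections. *)
Definition hecke (i : 'I_n) (v : 'I_n -> K) : 'I_n -> K := fun k =>
  if k == i then \sum_(l | l != i) coef i l * v l - q * v i else v k.

Definition hecke_inv (i : 'I_n) (v : 'I_n -> K) : 'I_n -> K := fun k =>
  if k == i then q^-1 * (\sum_(l | l != i) coef i l * v l - v i) else v k.

Lemma hecke_sum i (v w : 'I_n -> K) : (forall l, l != i -> v l = w l) ->
  \sum_(l | l != i) coef i l * v l = \sum_(l | l != i) coef i l * w l.
Proof. by move=> vw; apply: eq_bigr => l li; rewrite vw. Qed.

Lemma heckeK i : q != 0 -> cancel (hecke i) (hecke_inv i).
Proof.
move=> q0 v; apply/funext => k; rewrite /hecke_inv; case: eqP => [->|/eqP ki].
  rewrite (@hecke_sum i _ v) => [|l li]; last by rewrite /hecke (negbTE li).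
  by rewrite /hecke eqxx; field.
by rewrite /hecke (negbTE ki).
Qed.

Lemma hecke_invK i : q != 0 -> cancel (hecke_inv i) (hecke i).
Proof.
move=> q0 v; apply/funext => k; rewrite /hecke; case: eqP => [->|/eqP ki].
  rewrite (@hecke_sum i _ v) => [|l li]; last by rewrite /hecke_inv (negbTE li).
  by rewrite /hecke_inv eqxx; field.
by rewrite /hecke_inv (negbTE ki).
Qed.

Section TwoLetters.
Variables (i j : 'I_n).
Hypothesis ij : i != j.
Variable v : 'I_n -> K.

(** The operators of [i] and [j] change these two coordinates only; all others enter through the
    constants [S] and [S']. The braid relation thus becomes a polynomial identity in two
    variables. *)
Definition upd (p r : K) : 'I_n -> K :=
  fun k => if k == i then p else if k == j then r else v k.

Let S := \sum_(l | (l != i) && (l != j)) coef i l * v l.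
Let S' := \sum_(l | (l != j) && (l != i)) coef j l * v l.

Lemma hecke_updl p r : hecke i (upd p r) = upd (coef i j * r + S - q * p) r.
Proof.
apply/funext => k; rewrite /hecke; case: eqP => [->|/eqP ki]; last by rewrite /upd (negbTE ki).
rewrite (bigD1 j) /=; last by rewrite eq_sym.
rewrite {1 3 4}/upd eqxx eq_sym (negbTE ij) eqxx; congr (_ + _ - _).
by apply: eq_bigr => l /andP[li lj]; rewrite /upd (negbTE li) (negbTE lj).
Qed.

Lemma hecke_updr p r : hecke j (upd p r) = upd p (coef j i * p + S' - q * r).
Proof.
apply/funext => k; rewrite /hecke; case: eqP => [->|/eqP ki].
  rewrite (bigD1 i) //= {1 3 4}/upd !eqxx eq_sym (negbTE ij); congr (_ + _ - _).
  by apply: eq_bigr => l /andP[lj li]; rewrite /upd (negbTE li) (negbTE lj).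
by rewrite /upd (negbTE ki).
Qed.

Lemma upd_id : upd (v i) (v j) = v.
Proof. by apply/funext => k; rewrite /upd; case: eqP => [->//|_]; case: eqP => [->|]. Qed.

Hypothesis tauE : tau ^+ 2 = 3 * tau - 1.
Hypothesis sym : mat i j = mat j i.

Lemma hecke_braid : mat i j \in [:: 2; 3; 4; 5]%N ->
  alternate (mat i j) (hecke i) (hecke j) v = alternate (mat i j) (hecke j) (hecke i) v.
Proof.
rewrite -[X in alternate _ _ _ X = _]upd_id -[X in _ = alternate _ _ _ X]upd_id !inE => /or4P[] /eqP mE; rewrite mE /= !(hecke_updl, hecke_updr) /coef -sym mE /=.
all: rewrite /edge_weight /=; case: (ltngtP i j) => [lij|lij|/val_inj eij]; try by move: ij; rewrite eij eqxx.
all: congr upd; ring: tauE.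
Qed.

End TwoLetters.
Lemma hecke1_invol i : q = 1 -> involutive (hecke i).
Proof.
move=> q1 v; apply/funext => k; rewrite {1}/hecke; case: eqP => [->|/eqP ki].
  rewrite (@hecke_sum i _ v) => [|l li]; last by rewrite /hecke (negbTE li).
  by rewrite /hecke eqxx q1; ring.
by rewrite /hecke (negbTE ki).
Qed.

(** The witness is the basis vector of [i]: each of the finitely many powers changes one of its two
    relevant coordinates. *)
Lemma hecke1_order (i j : 'I_n) (k : nat) : i != j -> mat i j = mat j i -> q = 1 -> (2 : K) != 0 ->
  tau ^+ 2 = 3 * tau - 1 -> mat i j \in [:: 2; 3; 4; 5]%N -> (0 < k < mat i j)%N ->
  exists v, iter k (fun u => hecke i (hecke j u)) v <> v.
Proof.
move=> ij sym q1 two tauE.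
have one0 : (1 : K) <> 0 by apply/eqP; exact: oner_neq0.
have m11 : (-1 : K) <> 1.
  move=> h; move/eqP: two; apply; have -> : (2 : K) = 1 - -1 by ring.
  by rewrite h; ring.
have oneE : 1 = 3 * tau - tau ^+ 2 by rewrite tauE; ring.
have t0 : tau <> 0 by move=> h; apply: one0; rewrite oneE h; ring.
have t2 : tau <> 2.
  move=> h; apply: one0; apply: (addrI 1); rewrite addr0 [RHS]oneE h; ring.
have two0 : (2 : K) <> 0 by apply/eqP.
pose u := upd i j (fun=> 0) 1 0.
have sum0 (l : 'I_n) (Q : pred 'I_n) : \sum_(k' | Q k') coef l k' * (fun=> 0 : K) k' = 0.
  by apply: big1 => l' _; rewrite mulr0.
have step p r : hecke i (hecke j (upd i j (fun=> 0) p r)) =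
    upd i j (fun=> 0) (coef i j * (coef j i * p - r) - p) (coef j i * p - r).
  rewrite hecke_updr // hecke_updl // !sum0 q1; congr upd; ring.
have at_i p r : upd i j (fun=> 0 : K) p r i = p by rewrite /upd eqxx.
have at_j p r : upd i j (fun=> 0 : K) p r j = r by rewrite /upd eqxx eq_sym (negbTE ij).
rewrite !inE => /or4P[] /eqP mE; rewrite mE; case: k => [//|[|[|[|[|k]]]]] // _; exists u => h.
all: have hi := congr1 (fun f => f i) h; have hj := congr1 (fun f => f j) h.
all: move: hi hj; rewrite /= /u !step !at_i !at_j /coef -sym mE /= /edge_weight /= => {h}.
all: case: (ltngtP i j) => [lij|lij|/val_inj eij]; try by move: ij; rewrite eij eqxx.
all: rewrite ?q1 => hi hj.
(* The false equations that remain are, up to sign, -1 = 1, 0 = 1, 2 = 0, tau - 1 = 1 and 1 - tau =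
   1. That tau is neither 0 nor 2 follows from its quadratic equation. *)
all: try (by apply: m11; apply: etrans hi; ring: tauE).
all: try (by apply: one0; apply/esym; apply: etrans hi; ring: tauE).
all: try (by apply: one0; apply: etrans hj; ring: tauE).
all: try (by apply: two0; apply: etrans hj; ring: tauE).
all: try (by apply: one0; apply: oppr_inj; rewrite oppr0; apply: etrans hj; ring: tauE).
all: try (by apply: two0; apply: oppr_inj; rewrite oppr0; apply: etrans hj; ring: tauE).
all: try (by apply: t2; apply: (addIr (-1)); transitivity (1 : K);
  [apply: etrans hi; ring: tauE|ring]).
all: try (by apply: t0; apply: oppr_inj; apply: (addIr 1); transitivity (1 : K);
  [apply: etrans hi; ring: tauE|ring]).
Qed.

End HeckeRepresentation.

Section Support.
Local Open Scope ring_scope.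
Variables (n : nat) (mat : nat -> nat -> nat) (tau : algC).
Hypothesis tauE : tau ^+ 2 = 3 * tau - 1.

Definition tau_int (u : algC) : Prop := exists x y : int, u = x%:~R + y%:~R * tau.

Definition tau_even (u : algC) : Prop := exists2 w, tau_int w & u = 2 * w.

Lemma tau_intD u w : tau_int u -> tau_int w -> tau_int (u + w).
Proof.
move=> [x [y ->]] [x' [y' ->]]; exists (x + x'), (y + y'); rewrite !intrD; ring.
Qed.

Lemma tau_intM u w : tau_int u -> tau_int w -> tau_int (u * w).
Proof.
move=> [x [y ->]] [x' [y' ->]]; exists (x * x' - y * y'), (x * y' + y * x' + 3 * (y * y')).
rewrite !(intrD, intrM, intrN); ring: tauE.
Qed.

Lemma tau_int_int (m : int) : tau_int m%:~R.
Proof. by exists m, 0; ring. Qed.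

Lemma tau_int_tau : tau_int tau.
Proof. by exists 0, 1; ring. Qed.

Lemma tau_evenD u w : tau_even u -> tau_even w -> tau_even (u + w).
Proof.
by move=> [x hx ->] [y hy ->]; exists (x + y); [exact: tau_intD|ring].
Qed.

Lemma tau_evenMr u w : tau_int u -> tau_even w -> tau_even (u * w).
Proof. by move=> hu [x hx ->]; exists (u * x); [exact: tau_intM|ring]. Qed.

(** If 1 = 2 (x + y tau), then a = b tau with a = 1 - 2 x odd and b = 2 y even. The equation of tau
    gives a^2 = 3 a b - b^2, which is impossible modulo 2. *)
Lemma tau_evenN1 : ~ tau_even 1.
Proof.
move=> [_ [x [y ->]] e].
have e1 : ((1 - 2 * x)%:~R : algC) = (2 * y)%:~R * tau.
  rewrite !(intrD, intrM, intrN); apply: (addIr (2 * x%:~R)); rewrite subrK [LHS]e; ring.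
have : ((1 - 2 * x) ^+ 2 = 3 * (1 - 2 * x) * (2 * y) - (2 * y) ^+ 2 :> int).
  apply: (@intr_inj algC); rewrite !(intrD, intrM, intrN, rmorphXn) /=.
  move: e1; rewrite !(intrD, intrM, intrN) => e1; rewrite e1; ring: tauE.
lia.
Qed.

Lemma edge_weight_int m : tau_int (edge_weight tau m).
Proof.
rewrite /edge_weight; do 3?case: ifP => _.
- exact: (tau_int_int 1).
- exact: (tau_int_int 2).
- exact: tau_int_tau.
- exact: (tau_int_int 0).
Qed.

Lemma coef_int i j : tau_int (coef mat 2 tau i j).
Proof.
rewrite /coef; case: ifP => _; first exact: (tau_int_int 0).
case: ifP => _; first exact: (tau_int_int 1).
apply: tau_intM; [exact: (tau_int_int 2)|exact: edge_weight_int].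
Qed.

Lemma coef_even i j : (j <= i)%N -> tau_even (coef mat 2 tau i j).
Proof.
move=> ji; rewrite /coef; case: ifP => _.
  by exists 0; [exact: (tau_int_int 0)|ring].
by rewrite ltnNge ji /=; exists (edge_weight tau (mat i j)); [exact: edge_weight_int|].
Qed.

Let act (w : seq 'I_n) : ('I_n -> algC) -> 'I_n -> algC := fun v => foldr (hecke mat 2 tau) v w.

(* Modulo 2 the generators act by matrices that are triangular outside the
   diagonal, so the c-th diagonal entry tells whether c occurs in the word. *)
Lemma hecke_support (w : seq 'I_n) (c : 'I_n) : let v := act w (fun k => (k == c)%:R) in
  if c \in w then tau_even (v c) else v c = 1.
Proof.
move=> v.
have sum_even (i : 'I_n) (u : 'I_n -> algC) : (forall l, tau_int (u l)) ->
    (forall l : 'I_n, (i < l)%N -> tau_even (u l)) ->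
    tau_even (\sum_(l | l != i) coef mat 2 tau i l * u l - 2 * u i).
  move=> hu hl; apply: tau_evenD; last first.
    by exists (- u i); [have := tau_intM (tau_int_int (-1)) (hu i); rewrite mulN1r|ring].
  apply: big_ind; [by exists 0; [exact: (tau_int_int 0)|ring]|exact: tau_evenD|].
  move=> l li; case: (ltnP i l) => il; first by apply: tau_evenMr; [exact: coef_int|exact: hl].
  by rewrite mulrC; apply: tau_evenMr => //; exact: coef_even.
(* The entries beyond [c] start at 0 and stay even. Hence the letter [c] makes the c-th entry even
   whenever it acts, and no other letter changes that entry. *)
suff [_ _ h1 h2] : [/\ forall l, tau_int (v l), forall l : 'I_n, (c < l)%N -> tau_even (v l),
    c \in w -> tau_even (v c) & c \notin w -> v c = 1].
  by case: ifP => [/h1 //|/negbT /h2].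
rewrite /v /act; elim: (w) => [|i w' [h1 h2 h3 h4]].
  split => //=; [|move=> l cl|by rewrite eqxx].
    by move=> l; case: eqP => _; [exact: (tau_int_int 1)|exact: (tau_int_int 0)].
  exists 0; first exact: (tau_int_int 0).
  by rewrite mulr0; case: eqP => // lc; move: cl; rewrite lc ltnn.
rewrite /=; set u := foldr _ _ _ in h1 h2 h3 h4 *.
have ev (i' : 'I_n) : (c <= i')%N -> tau_even (\sum_(l | l != i') coef mat 2 tau i' l * u l - 2 * u i').
  by move=> ci; apply: sum_even => // l il; apply: h2; exact: leq_ltn_trans il.
split.
- move=> l; rewrite /hecke; case: eqP => // _; apply: tau_intD.
    apply: big_ind; [exact: (tau_int_int 0)|exact: tau_intD|].
    by move=> l' _; apply: tau_intM => //; exact: coef_int.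
  have := tau_intM (tau_int_int (-2)) (h1 i); rewrite intrN => h.
  by rewrite -mulNr.
- move=> l cl; rewrite /hecke; case: eqP => [li|_]; last exact: h2.
  by apply: ev; rewrite -li; exact: ltnW.
- rewrite inE /hecke; case: eqP => [<- _|_ /= /h3 //]; exact: ev.
- rewrite inE negb_or /hecke => /andP[/negbTE -> /h4]; exact.
Qed.

End Support.

(** * The group of bijections of a type, as a target for the universal property *)

Record bij (T : Type) := Bij {
  bij_fun : T -> T;
  bij_inv : T -> T;
  bij_funK : cancel bij_fun bij_inv;
  bij_invK : cancel bij_inv bij_fun
}.

HB.instance Definition _ (T : Type) := gen_eqMixin (bij T).
HB.instance Definition _ (T : Type) := gen_choiceMixin (bij T).

Section BijGroup.
Variable T : Type.
Implicit Types f g h : bij T.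

Lemma bij_ext f g : bij_fun f =1 bij_fun g -> f = g.
Proof.
case: f g => [f f' fK f'K] [g g' gK g'K] /= fg.
have e : f = g by apply/funext.
subst g; have e' : f' = g' by apply/funext => t; rewrite -{1}(g'K t) fK.
by subst g'; congr Bij; exact: Prop_irrelevance.
Qed.

Definition bij_one : bij T := @Bij T id id (frefl _) (frefl _).

Definition bij_mul f g : bij T :=
  Bij (can_comp (bij_funK f) (bij_funK g)) (can_comp (bij_invK g) (bij_invK f)).

Definition bij_V f : bij T := Bij (bij_invK f) (bij_funK f).

Lemma bij_mulA : associative bij_mul. Proof. by move=> f g h; apply: bij_ext. Qed.
Lemma bij_mul1 : left_id bij_one bij_mul. Proof. by move=> f; apply: bij_ext. Qed.
Lemma bij_1mul : right_id bij_one bij_mul. Proof. by move=> f; apply: bij_ext. Qed.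
Lemma bij_mulV : left_inverse bij_one bij_V bij_mul.
Proof. by move=> f; apply: bij_ext => t /=; rewrite bij_funK. Qed.
Lemma bij_Vmul : right_inverse bij_one bij_V bij_mul.
Proof. by move=> f; apply: bij_ext => t /=; rewrite bij_invK. Qed.

HB.instance Definition _ := isGroup.Build (bij T) bij_mulA bij_mul1 bij_1mul bij_mulV bij_Vmul.

End BijGroup.

Lemma bij_alternating (T : Type) m (f g : bij T) v :
  bij_fun (alternating m f g) v = alternate m (bij_fun f) (bij_fun g) v.
Proof. by elim: m f g => [|m IH] f g //=; rewrite IH. Qed.

(** * Words for the lcm of two atoms *)

Section ArtinAction.
Variables (t : coxeter_type) (G : groupType) (a : 'I_(coxeter_rank t) -> G).
Hypothesis art : artin_tits a.

(** The universal property applied to the bijections of [T]. Such actions serve to tell elements of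
    [G] apart and to define functions on [G]. *)
Lemma artin_action (T : Type) (f f' : 'I_(coxeter_rank t) -> T -> T) :
  (forall i, cancel (f i) (f' i)) -> (forall i, cancel (f' i) (f i)) ->
  (forall (i j : 'I_(coxeter_rank t)) v, i != j -> alternate (coxeter_matrix t i j) (f i) (f j) v =
     alternate (coxeter_matrix t i j) (f j) (f i) v) ->
  exists act : G -> T -> T, [/\ forall v, act 1 v = v,
    forall g h v, act (g * h) v = act g (act h v) & forall i v, act (a i) v = f i v].
Proof.
move=> fK f'K br; pose F i := Bij (fK i) (f'K i).
have [|phi phiE] := artin_univ art (f := F).
  by move=> i j ij; apply: bij_ext => v; rewrite !bij_alternating; exact: br.
have phi1 : phi 1 = 1 by apply: (mulgI (phi 1)); rewrite -gmulfM !mulg1.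
exists (fun g => bij_fun (phi g)); split => [v|g h v|i v].
- by rewrite phi1.
- by rewrite gmulfM.
- by rewrite phiE.
Qed.

Definition word (w : seq 'I_(coxeter_rank t)) : G := prods [seq a i | i <- w].

Lemma act_word (T : Type) (f : 'I_(coxeter_rank t) -> T -> T) (act : G -> T -> T) :
  (forall v, act 1 v = v) -> (forall g h v, act (g * h) v = act g (act h v)) ->
  (forall i v, act (a i) v = f i v) -> forall w v, act (word w) v = foldr f v w.
Proof.
move=> a1 aM af w v; elim: w => [|i w IH]; first by rewrite /word prods_nil a1.
by rewrite /word /= prods_cons aM af -/(word w) IH.
Qed.

Lemma coxeter_matrix_sym i j : coxeter_matrix t i j = coxeter_matrix t j i.
Proof.
rewrite /coxeter_matrix eq_sym; case: ifP => // _.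
by under eq_filter do rewrite orbC.
Qed.

End ArtinAction.

Fixpoint altw (T : Type) (m : nat) (i j : T) : seq T :=
  if m is m'.+1 then i :: altw m' j i else [::].

Lemma size_altw (T : Type) m (i j : T) : size (altw m i j) = m.
Proof. by elim: m i j => [|m IH] i j //=; rewrite IH. Qed.

Lemma altw_cat (T : Type) k d (i j : T) :
  altw (k + d) i j = altw k i j ++ altw d (alt_letter k i j) (alt_letter k.+1 i j).
Proof.
elim: k i j => [|k IH] i j //=; rewrite IH; congr (_ :: _ ++ altw _ _ _).
  by rewrite alt_letter_swap.
by rewrite alt_letterSS alt_letter_swap.
Qed.

Lemma altwSr (T : Type) k (i j : T) : altw k.+1 i j = altw k i j ++ [:: alt_letter k i j].
Proof. by rewrite -addn1 altw_cat. Qed.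

Lemma take_altw (T : Type) k m (i j : T) : (k <= m)%N -> take k (altw m i j) = altw k i j.
Proof.
by move=> km; rewrite -(subnKC km) altw_cat take_size_cat // size_altw.
Qed.

Section Involutions.
Variables (I : eqType) (T : Type) (f : I -> T -> T).

Lemma foldr_altw_double p i j v :
  foldr f v (altw p.*2 i j) = iter p (fun u => f i (f j u)) v.
Proof. by elim: p => [|p IH] //; rewrite doubleS /= IH. Qed.

(** One word is the reverse of the other, so equal involutions cancel from the junction outwards. *)
Lemma foldr_altw_cancel k i j v : involutive (f i) -> involutive (f j) ->
  foldr f (foldr f v (altw k (alt_letter k i j) (alt_letter k.+1 i j))) (altw k j i) = v.
Proof.
move=> fi fj; elim: k v => [|k IH] v //.
rewrite (altwSr k j i) foldr_cat alt_letterSS -(alt_letter_swap k i j) /=.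
have -> : f (alt_letter k.+1 i j) (f (alt_letter k.+1 i j)
    (foldr f v (altw k (alt_letter k i j) (alt_letter k.+1 i j)))) =
    foldr f v (altw k (alt_letter k i j) (alt_letter k.+1 i j)).
  by rewrite /alt_letter; case: ifP => _; rewrite ?fi ?fj.
exact: IH.
Qed.

(** Equal neighbours cancel. Each cancellation removes two letters, so parity is kept, and full
    length remains only if the word was alternating from the start. *)
Lemma reduce_word i j w : involutive (f i) -> involutive (f j) -> i != j ->
  (forall c, c \in w -> c = i \/ c = j) ->
  exists k s o, [/\ (s = i /\ o = j) \/ (s = j /\ o = i),
    forall v, foldr f v w = foldr f v (altw k s o), (k <= size w)%N,
    odd k = odd (size w) & k = size w -> w = altw k s o].
Proof.
move=> fi fj ij; elim: w => [|c w IH] wc.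
  by exists 0%N, i, j; split => //; left.
have [k [s [o [so wE kw odd_k wk]]]] : exists k s o, [/\ (s = i /\ o = j) \/ (s = j /\ o = i),
    forall v, foldr f v w = foldr f v (altw k s o), (k <= size w)%N,
    odd k = odd (size w) & k = size w -> w = altw k s o].
  by apply: IH => d dw; apply: wc; rewrite inE dw orbT.
have cij : c = i \/ c = j by apply: wc; rewrite mem_head.
have [o' co'] : exists o', (c = i /\ o' = j) \/ (c = j /\ o' = i).
  by case: cij => ->; [exists j; left|exists i; right].
case: k wE kw odd_k wk => [|k] wE kw odd_k wk.
  exists 1%N, c, o'; split => //=; [by move=> v; rewrite wE|by rewrite -odd_k|].
  by move=> [e]; rewrite (wk e).
have [sc|sc] := eqVneq s c.
  exists k, o, s; split.
  - by case: so => -[-> ->]; [right|left].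
  - move=> v; rewrite /= wE /= -sc.
    by case: so => -[-> _]; rewrite ?fi ?fj.
  - by apply: leqW; exact: ltnW.
  - by rewrite /= -odd_k /= negbK.
  - by move=> e; move: kw; rewrite e /= ltnNge leqnSn.
have oc : o = c.
  by move: sc; case: so => -[-> ->]; case: cij => ->; rewrite ?eqxx.
exists k.+2, o, s; split.
- by case: so => -[-> ->]; [right|left].
- by move=> v; rewrite /= wE /= oc.
- by [].
- by rewrite /= -odd_k.
- by move=> [e]; rewrite -oc; congr (_ :: _); exact: wk.
Qed.

End Involutions.

Section Words.
Variables (t : coxeter_type) (G : groupType) (a : 'I_(coxeter_rank t) -> G).
Hypothesis art : artin_tits a.
Local Notation I := 'I_(coxeter_rank t).
Local Notation m := (coxeter_matrix t).

Lemma word_cat w w' : word a (w ++ w') = word a w * word a w'.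
Proof. by rewrite /word map_cat prods_cat. Qed.

Lemma word_cons i w : word a (i :: w) = a i * word a w.
Proof. by rewrite /word /= prods_cons. Qed.

Lemma word_altw k i j : word a (altw k i j) = alternating k (a i) (a j).
Proof. by elim: k i j => [|k IH] i j; rewrite /= ?word_cons ?IH // /word prods_nil. Qed.

Lemma word_action (T : Type) (f f' : I -> T -> T) :
  (forall i, cancel (f i) (f' i)) -> (forall i, cancel (f' i) (f i)) ->
  (forall (i j : I) v, i != j -> alternate (m i j) (f i) (f j) v = alternate (m i j) (f j) (f i) v) ->
  forall w w', word a w = word a w' -> forall v, foldr f v w = foldr f v w'.
Proof.
move=> fK f'K br w w' e v; have [act [a1 aM af]] := artin_action art fK f'K br.
by rewrite -!(act_word a1 aM af) e.
Qed.

(** Every generator acts on the integers as translation by 1, which respects the relations because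
    their two sides have equally many letters. *)
Lemma artin_length : exists nu : G -> nat, forall w, nu (word a w) = size w.
Proof.
have [|||act [a1 aM af]] := @artin_action _ _ _ art int (fun _ v => (v + 1)%R) (fun _ v => (v - 1)%R).
- by move=> _ v; rewrite addrK.
- by move=> _ v; rewrite subrK.
- by [].
exists (fun g => absz (act g 0%R)) => w; rewrite (act_word a1 aM af).
suff -> : foldr (fun _ v => (v + 1)%R) 0%R w = Posz (size w) by [].
by elim: w => //= i w ->; lia.
Qed.

Lemma alternate_mulr k (x y v : G) :
  alternate k (fun u => u * x) (fun u => u * y) v =
  v * alternating k (alt_letter k.+1 x y) (alt_letter k x y).
Proof.
elim: k x y => [|k IH] x y; first by rewrite mulg1.
rewrite [LHS]/= IH alt_letterSS alternatingSr -mulgA; congr (_ * (alternating _ _ _ * _)).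
- by rewrite alt_letter_swap.
- by rewrite alt_letter_swap.
- by rewrite /alt_letter /=; case: (odd k).
Qed.

(** The braid relations read the same backwards, so the generators may act by right multiplication;
    the image of 1 under an element is then that element reversed. *)
Lemma artin_rev : exists rev : G -> G,
  (forall g h, rev (g * h) = rev h * rev g) /\ forall i, rev (a i) = a i.
Proof.
have [|||act [a1 aM af]] := @artin_action _ _ _ art G (fun i v => v * a i) (fun i v => v * (a i)^-1).
- by move=> i v; rewrite mulgK.
- by move=> i v; rewrite mulgVK.
- move=> i j v ij; rewrite !alternate_mulr; congr (_ * _).
  have := artin_rel art ij; rewrite /alt_letter /=; case: (odd _) => e; by rewrite /= ?e.
suff actE g : forall w, act g w = w * act g 1.
  exists (fun g => act g 1); split => [g h|i]; last by rewrite af mul1g.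
  by rewrite aM actE.
pose S := [set g | forall w, act g w = w * act g 1].
have : smallest (@is_subgroup G) (range a) g by rewrite (artin_gen art).
move/(_ S); apply; split; last by move=> _ [i _ <-] w; rewrite !af mul1g.
split; first split.
- by move=> w; rewrite !a1 mulg1.
- by move=> h k hh hk w; rewrite !aM hh (hk w) [in RHS]hh mulgA -hh.
- move=> h hh w; apply: (mulIg (act h 1)).
  rewrite -hh -aM mulgV a1 -mulgA -hh -aM mulgV a1 mulg1 //.
Qed.

(* What actions have to show for the only words equal to the braid word of i
   and j to be its two sides. *)
Definition detects (i j : I) : Prop :=
  (forall w, word a w = alternating (m i j) (a i) (a j) -> forall c, c \in w -> c = i \/ c = j) /\
  exists (T : Type) (f : I -> T -> T),
  [/\ forall w w', word a w = word a w' -> forall v, foldr f v w = foldr f v w',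
      involutive (f i) /\ involutive (f j),
      forall p, (0 < p < m i j)%N -> exists v, iter p (fun u => f i (f j u)) v <> v
    & forall p, (0 < p < m i j)%N -> exists v, iter p (fun u => f j (f i u)) v <> v].

Lemma foldr_altw_inj (T : Type) (f : I -> T -> T) i j k u v : involutive (f i) -> involutive (f j) ->
  foldr f u (altw k i j) = foldr f v (altw k i j) -> u = v.
Proof.
move=> fi fj; elim: k i j fi fj => [|k IH] i j fi fj //= e.
by apply: (IH j i) => //; rewrite -(fi (foldr f u _)) e fi.
Qed.

(** A word that is not alternating would act like an alternating one of length k < m with the parity
    of m. It is compared with the side of the braid word that starts with the same letter: the
    common prefix cancels, and the power p = (m - k) / 2 of the product of the two involutions would
    act trivially. *)
Lemma braid_word i j w : i != j -> detects i j ->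
  word a w = alternating (m i j) (a i) (a j) -> w = altw (m i j) i j \/ w = altw (m i j) j i.
Proof.
move=> ij [supp [T [f [fw [fi fj] oi oj]]]] wE.
have [nu nuE] := artin_length.
have sw : size w = m i j by rewrite -nuE wE -word_altw nuE size_altw.
have [k [s [o [so wk kw oddk wkE]]]] := reduce_word fi fj ij (supp w wE).
have [fs fo] : involutive (f s) /\ involutive (f o) by case: so => -[-> ->].
have [e|ne] := eqVneq k (size w).
  by have := wkE e; rewrite e sw; case: so => -[-> ->]; [left|right].
exfalso; have {ne kw}kw : (k < m i j)%N by rewrite -sw ltn_neqAle ne.
have eso v : foldr f v (altw (m i j) s o) = foldr f v w.
  apply: fw; rewrite wE word_altw; case: so => -[-> ->] //.
  by rewrite (artin_rel art ij).
have [p pE] : exists p, (m i j = k + p.*2)%N.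
  exists ((m i j - k)./2); have := odd_double_half (m i j - k); rewrite -sw oddB ?sw 1?ltnW //.
  by rewrite -sw -oddk addbb add0n sw => ->; rewrite subnKC // ltnW.
have p0 : (0 < p < m i j)%N by lia.
have h v : foldr f v (altw p.*2 (alt_letter k s o) (alt_letter k.+1 s o)) = v.
  apply: (foldr_altw_inj (k := k) fs fo); rewrite -foldr_cat -altw_cat -pE eso; exact: wk.
move: h; rewrite /alt_letter /=; case: (odd k) => /= h.
  have [v] : exists v, iter p (fun u => f o (f s u)) v <> v.
    by case: so => -[-> ->]; [exact: oj|exact: oi].
  by rewrite -foldr_altw_double h.
have [v] : exists v, iter p (fun u => f s (f o u)) v <> v.
  by case: so => -[-> ->]; [exact: oi|exact: oj].
by rewrite -foldr_altw_double h.
Qed.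

(** If the two words of length k were equal, one could replace the other in the doubled alternating
    word; everything would cancel, and the k-th power of the product of the involutions would act
    trivially. *)
Lemma braid_minimal i j k : i != j -> detects i j -> (0 < k < m i j)%N ->
  alternating k (a i) (a j) <> alternating k (a j) (a i).
Proof.
move=> ij [_ [T [f [fw [fi fj] oi oj]]]] km e.
have [v vn] := oi k km; apply: vn.
rewrite -foldr_altw_double -addnn altw_cat foldr_cat.
rewrite (fw (altw k i j) (altw k j i)) ?word_altw //.
exact: foldr_altw_cancel.
Qed.

End Words.

(** * Actions that detect braid words *)

Section Reflections.
Local Open Scope ring_scope.
Variable R : comNzRingType.
Implicit Types s r v : R.

Lemma iter_reflections k s r v :
  iter k (fun u => s - (r - u)) v = v + k%:R * (s - r).
Proof. by elim: k => [|k IH] /=; rewrite ?IH ?mulrS; ring. Qed.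

Lemma alternate_double (T : Type) k (f g : T -> T) (w : T) :
  alternate k.*2 f g w = iter k (fun u => f (g u)) w.
Proof. by elim: k => //= k ->. Qed.

Lemma alternate_reflections m s r v : m%:R = 0 :> R ->
  alternate m (fun u => s - u) (fun u => r - u) v = alternate m (fun u => r - u) (fun u => s - u) v.
Proof.
rewrite -(odd_double_half m) natrD -muln2 natrM muln2; case: (odd m) => /= m0;
  rewrite ?add0n ?add1n /= !alternate_double !iter_reflections; apply/eqP; rewrite -subr_eq0;
  apply/eqP; rewrite -[RHS](mul0r (s - r)) -m0; ring.
Qed.

End Reflections.

Lemma mem_altw (T : eqType) k (i j c : T) : c \in altw k i j -> c = i \/ c = j.
Proof.
elim: k i j => [|k IH] i j //=; rewrite inE => /predU1P[->|/IH [->|->]]; by [left|right].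
Qed.

Section Detection.
Variables (t : coxeter_type) (G : groupType) (a : 'I_(coxeter_rank t) -> G).
Hypothesis art : artin_tits a.
Local Notation I := 'I_(coxeter_rank t).
Local Notation m := (coxeter_matrix t).

(** The dihedral group acts on the integers modulo m by u -> 1 - u and u -> - u, whose product is a
    translation by 1 or -1, of order exactly m. This handles the labels of G_2 and I_2(p). *)
Lemma detects_dihedral (i j : I) : i != j -> (1 < m i j)%N ->
  (forall c : I, c = i \/ c = j) -> detects a i j.
Proof.
move=> ij m1 two; split => [w _ c _|]; first exact: two.
pose p := m i j.
pose f (c : I) (u : 'Z_p) : 'Z_p := ((c == i)%:R - u)%R.
have p0 : (p%:R = 0 :> 'Z_p)%R by apply: val_inj; rewrite /= val_Zp_nat ?modnn.
have fK c : involutive (f c) by move=> u; rewrite /f subKr.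
have fi u : f i u = (1 - u)%R by rewrite /f eqxx.
have fj u : f j u = (0 - u)%R by rewrite /f eq_sym (negbTE ij).
have nz k : (0 < k < m i j)%N -> (k%:R != 0 :> 'Z_p)%R.
  case/andP=> k0 kp; apply/eqP => /(congr1 val) /=; rewrite val_Zp_nat // modn_small // => k0'.
  by rewrite k0' in k0.
exists 'Z_p, f; split.
- apply: (word_action art fK fK) => i' j' v ij'.
  have -> : m i' j' = p.
    case: (two i') (two j') ij' => -> [] ->; rewrite ?eqxx // => _.
    exact: coxeter_matrix_sym.
  exact: alternate_reflections.
- by [].
- move=> k km; exists 0%R; under eq_iter do rewrite fi fj.
  rewrite iter_reflections; apply/eqP.
  by rewrite add0r subr0 mulr1; exact: nz.
- move=> k km; exists 0%R; under eq_iter do rewrite fi fj.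
  rewrite iter_reflections; apply/eqP.
  by rewrite add0r sub0r mulrN mulr1 oppr_eq0; exact: nz.
Qed.

Lemma detects_hecke (i j : I) : i != j ->
  (forall i j : I, i != j -> m i j \in [:: 2; 3; 4; 5]%N) -> detects a i j.
Proof.
(* This number is 4 cos^2 (pi / 5). *)
move=> ij small; pose tau : algC := ((3 + sqrtC 5) / 2)%R.
have tauE : (tau ^+ 2 = 3 * tau - 1)%R.
  have := sqrtCK (5 : algC)%R; rewrite /tau; move: (sqrtC 5) => s s2.
  have two : (2 != 0 :> algC)%R by rewrite pnatr_eq0.
  by field: s2.
have two : (2 != 0 :> algC)%R by rewrite pnatr_eq0.
have sym := @coxeter_matrix_sym t.
have act (q : algC) : q != 0%R -> forall w w', word a w = word a w' ->
    forall v, foldr (hecke m q tau) v w = foldr (hecke m q tau) v w'.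
  move=> q0; apply: (@word_action _ _ _ art _ (hecke m q tau) (hecke_inv m q tau)) => [i'|i'|i' j' v ij']; [exact: heckeK|exact: hecke_invK|].
  by apply: hecke_braid => //; exact: small.
split=> [w wE c cw|].
  have [-> //|/eqP ci] := eqVneq c i; first by left.
  have [-> //|/eqP cj] := eqVneq c j; first by right.
  exfalso; have e := act _ two w (altw (m i j) i j) _ (fun k => (k == c)%:R)%R.
  have := hecke_support m tauE w c; rewrite cw e ?word_altw //.
  have := hecke_support m tauE (altw (m i j) i j) c; case: (boolP (c \in altw _ _ _)) => [h|_ /= -> h].
    by case: (mem_altw h).
  exact: (tau_evenN1 tauE h).
exists ('I_(coxeter_rank t) -> algC), (hecke m 1%R tau); split.
- by apply: act; exact: oner_neq0.
- by split; exact: hecke1_invol.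
- by move=> p pm; apply: hecke1_order => //; exact: small.
- move=> p pm; apply: hecke1_order => //; rewrite 1?eq_sym //; last by rewrite sym.
  by rewrite sym; exact: small.
Qed.

End Detection.

Lemma coxeter_matrix_label t i j (s : seq nat) : i != j -> 2%N \in s ->
  {subset [seq e.2 | e <- coxeter_edges t] <= s} -> coxeter_matrix t i j \in s.
Proof.
move=> ij s2 es; rewrite /coxeter_matrix (negbTE ij).
case E : [seq _ | e <- _ & _] => [//|k l]; apply: es.
have : k \in [seq e.2 | e <- coxeter_edges t & (e.1 == (i, j)) || (e.1 == (j, i))] by rewrite E mem_head.
by case/mapP => e; rewrite mem_filter => /andP[_ ?] ->; apply: map_f.
Qed.

Lemma path_edges_label n : {subset [seq e.2 | e <- path_edges n] <= [:: 3%N]}.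
Proof. by move=> k /mapP[_ /mapP[i _ ->] ->]; rewrite mem_head. Qed.

Definition coxeter_labels (t : coxeter_type) : seq nat :=
  match t with CoxG2 => [:: 2; 6]%N | CoxI2 p => [:: 2; p]%N | _ => [:: 2; 3; 4; 5]%N end.

Lemma coxeter_edges_label t : {subset [seq e.2 | e <- coxeter_edges t] <= coxeter_labels t}.
Proof.
have h n : {subset [seq e.2 | e <- path_edges n] <= [:: 2; 3; 4; 5]%N}.
  by move=> k /path_edges_label; rewrite !inE => /eqP ->.
have hr n e : e.2 \in [:: 2; 3; 4; 5]%N -> {subset [seq e.2 | e <- rcons (path_edges n) e] <= [:: 2; 3; 4; 5]%N}.
  by move=> e2 k; rewrite map_rcons mem_rcons inE => /predU1P[-> //|/h].
case: t => [n|n|n||||||||p]; rewrite /coxeter_labels; try exact: h; try exact: hr;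
  by move=> k; rewrite !inE; do ?[case/orP => [/eqP ->|]; rewrite ?eqxx ?orbT //]; move=> /eqP ->; rewrite ?eqxx ?orbT.
Qed.

Section Presentation.
Variables (t : coxeter_type) (G : groupType) (a : 'I_(coxeter_rank t) -> G).
Hypothesis art : artin_tits a.
Hypothesis valid : coxeter_valid t.
Local Notation I := 'I_(coxeter_rank t).
Local Notation m := (coxeter_matrix t).

Lemma coxeter_matrix_gt1 (i j : I) : i != j -> (1 < m i j)%N.
Proof.
move=> ij; have : m i j \in coxeter_labels t.
  apply: coxeter_matrix_label => //; last exact: coxeter_edges_label.
  by rewrite /coxeter_labels; case: (t).
have : all (fun k => 1 < k)%N (coxeter_labels t).
  by case: (t) (valid) => //= p p3; rewrite andbT; exact: ltnW.
by move=> /allP h /h.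
Qed.

Lemma artin_detects (i j : I) : i != j -> detects a i j.
Proof.
move=> ij; have m1 := coxeter_matrix_gt1 ij.
have [r2|r2] := eqVneq (coxeter_rank t) 2.
  apply: detects_dihedral => // c.
  suff : c = i :> nat \/ c = j :> nat by case=> /val_inj ->; [left|right].
  have := ltn_ord c; have := ltn_ord i; have := ltn_ord j; move: ij.
  by rewrite -val_eqE /=; move: (c : nat) (i : nat) (j : nat); lia.
apply: detects_hecke => // {}i {}j {m1}ij.
have <- : coxeter_labels t = [:: 2; 3; 4; 5]%N by case: (t) r2.
apply: coxeter_matrix_label => //; last exact: coxeter_edges_label.
by rewrite /coxeter_labels; case: (t).
Qed.

End Presentation.

Lemma cat_altw (T : Type) k (i j : T) w w' :
  w ++ w' = altw k i j -> w = altw (size w) i j.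
Proof.
move=> e; rewrite -(@take_altw _ _ k); first by rewrite -e take_size_cat.
by rewrite -(size_altw k i j) -e size_cat leq_addr.
Qed.

(** * The standard Garside structure of an Artin group *)

Section Standard.
Variables (t : coxeter_type) (G : groupType) (a : 'I_(coxeter_rank t) -> G).
Variables (P : set G) (D : G).
Hypothesis valid : coxeter_valid t.
Hypothesis sg : standard_garside a P D.
Local Notation I := 'I_(coxeter_rank t).
Local Notation m := (coxeter_matrix t).
Local Notation "a <=| b" := (lediv P a b) (at level 70, no associativity).
Let art : artin_tits a := standard_artin sg.
Let gs : garside_structure P D := standard_garside_structure sg.

Lemma standard_posE X : P X <-> exists w, X = word a w.
Proof.
split=> [|[w ->]]; last first.
  rewrite (standard_pos sg) => S [[S1 SM] aS]; elim: w => [|i w IH].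
    by rewrite /word prods_nil.
  by rewrite word_cons; apply: SM => //; apply: aS; exists i.
rewrite (standard_pos sg) => /(_ [set X | exists w, X = word a w]); apply; split.
  split; first by exists [::]; rewrite /word prods_nil.
  by move=> _ _ [v ->] [w ->]; exists (v ++ w); rewrite word_cat.
by move=> _ [i _ <-]; exists [:: i]; rewrite word_cons /word prods_nil mulg1.
Qed.

Lemma word_pos w : P (word a w). Proof. by apply/standard_posE; exists w. Qed.

Lemma letter_word i : a i = word a [:: i].
Proof. by rewrite word_cons /word prods_nil mulg1. Qed.

Lemma letter_pos i : P (a i). Proof. by rewrite letter_word; exact: word_pos. Qed.

Lemma artin_gen_inj : injective a.
Proof.
move=> i j aij; apply/eqP; apply: contraT => ij; exfalso.
apply: (braid_minimal ij (artin_detects art valid ij) (k := 1)).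
  by rewrite (coxeter_matrix_gt1 valid ij).
by rewrite /= aij.
Qed.

Variable nu : G -> nat.
Hypothesis nuE : forall w, nu (word a w) = size w.

(** By G3 a generator conjugated by [D] is positive, and it has length one, so it is a generator.
    The resulting injective map of the finite set of generators is bijective, and its inverse is
    conjugation in the other direction. *)
Lemma standard_conjV X : P X -> P (D * X * D^-1).
Proof.
have [wD DE] : exists w, D = word a w by apply/standard_posE; exact: garside_delta gs.
have h i : exists j, D^-1 * a i * D = a j.
  have /standard_posE[w wE] := garside_conj gs (letter_pos i).
  have e : word a (i :: wD) = word a (wD ++ w).
    by rewrite word_cons word_cat -DE -wE !mulgA mulgV mul1g.
  have := congr1 nu e; rewrite !nuE size_cat /=.
  case: w wE {e} => [|j [|k w]] wE /=; try lia; move=> _.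
  by exists j; rewrite wE -letter_word.
have [s sE] := choice h.
have s_inj : injective s.
  move=> i j sij; apply: artin_gen_inj; apply: (mulgI D^-1); apply: (mulIg D).
  by rewrite !sE sij.
move=> /standard_posE[w ->]; elim: w => [|i w IH].
  by rewrite /word prods_nil mulg1 mulgV; exact: (garside_submonoid gs).1.
have [s' _ s'K] := injF_bij s_inj.
rewrite word_cons -(s'K i) -sE.
have -> : D * (D^-1 * a (s' i) * D * word a w) * D^-1 = a (s' i) * (D * word a w * D^-1).
  by rewrite !mulgA mulgV mul1g.
by apply: (garside_submonoid gs).2 => //; exact: letter_pos.
Qed.

Lemma standard_length : garside_length P D nu.
Proof.
split=> [//||_ _ /standard_posE[v ->] /standard_posE[w ->]|_ /standard_posE[w ->]].
- exact: standard_conjV.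
- by rewrite -word_cat !nuE size_cat.
- by rewrite nuE => /size0nil ->; rewrite /word prods_nil.
Qed.
Let gl := standard_length.

Lemma unit_letterE x : unit_length P nu x <-> exists i, x = a i.
Proof.
split=> [[/standard_posE[w ->]]|[i ->]]; last first.
  by split; [exact: letter_pos|rewrite letter_word nuE].
rewrite nuE; case: w => [|i [|//]] //= _.
by exists i; rewrite letter_word.
Qed.

(** The lcm given by the lattice divides the braid element, whose only words are the two alternating
    ones. So the lcm is an alternating word starting with [i] and also one of the same length
    starting with [j], and [braid_minimal] forces that length to be the label. *)
Lemma standard_dihedral (i j : I) : i != j -> dihedral_pair P (m i j) (a i) (a j).
Proof.
move=> ij; have m1 := coxeter_matrix_gt1 valid ij.
have det := artin_detects art valid ij.
have rel := artin_rel art ij.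
have bw w := braid_word art ij det (w := w).
have shape w : word a w = alternating (m i j) (a i) (a j) ->
    (forall v, w = i :: v -> w = altw (m i j) i j) /\ (forall v, w = j :: v -> w = altw (m i j) j i).
  move=> wE; split=> v vE; case: (bw w wE) => // e; move: (e); rewrite vE;
    by case: (m i j) m1 => // n _ [f _]; move: ij; rewrite f eqxx.
pose A := alternating (m i j) (a i) (a j).
have iA : a i <=| A.
  rewrite /A -word_altw; case: (m i j) m1 => // n _; rewrite /= word_cons.
  by apply: le_mulr; exact: word_pos.
have jA : a j <=| A.
  rewrite /A rel -word_altw; case: (m i j) m1 => // n _; rewrite /= word_cons.
  by apply: le_mulr; exact: word_pos.
pose L := join gl (a i) (a j).
have [c /standard_posE[wc ->] AE] := leE (le_join gl iA jA).
have [r1 /standard_posE[w1 ->] L1] := leE (joinl gl (a i) (a j)).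
have [r2 /standard_posE[w2 ->] L2] := leE (joinr gl (a i) (a j)).
have e1 : (i :: w1) ++ wc = altw (m i j) i j.
  by apply: (shape _ _).1 => //; rewrite word_cat word_cons -L1 -AE.
have e2 : (j :: w2) ++ wc = altw (m i j) j i.
  by apply: (shape _ _).2 => //; rewrite word_cat word_cons -L2 -AE.
have s12 : size w1 = size w2.
  by have := congr1 size e1; have := congr1 size e2; rewrite !size_altw !size_cat /=; lia.
have LE : join gl (a i) (a j) = A.
  rewrite L1 -word_cons (cat_altw e1) word_altw.
  have [->//|km] := eqVneq (size (i :: w1)) (m i j).
  case: (braid_minimal ij det (k := size (i :: w1))).
    by have := congr1 size e1; rewrite size_altw size_cat /=; move: km => /=; lia.
  rewrite -word_altw -(cat_altw e1) word_cons -L1 L2 -word_cons (cat_altw e2) word_altw.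
  by rewrite /= s12.
split=> // [w wi wj|p /standard_posE[w ->] /leE[_ /standard_posE[w' ->] pE]].
  by rewrite -/A -LE; exact: le_join.
have sw : (size w <= m i j)%N.
  have := congr1 nu pE; rewrite -word_altw -word_cat !nuE size_altw size_cat => ->.
  exact: leq_addr.
exists (size w) => //; rewrite -!word_altw.
case: (bw (w ++ w')) => [|e|e]; first by rewrite word_cat.
  by left; congr (word a _); exact: cat_altw e.
by right; congr (word a _); exact: cat_altw e.
Qed.

Lemma standard_artin_garside rev : (forall g h, rev (g * h) = rev h * rev g) ->
  (forall i, rev (a i) = a i) -> artin_garside P D nu rev.
Proof.
move=> revM rev1; split=> //.
- move=> _ /standard_posE[[|i w] ->]; first by rewrite /word prods_nil.
  move=> _; exists (a i); first by apply/unit_letterE; exists i.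
  by rewrite word_cons; apply: le_mulr; exact: word_pos.
- move=> _ _ /unit_letterE[i ->] /unit_letterE[j ->] aij.
  exists (m i j); apply: standard_dihedral; apply/eqP => ij; exact: (aij (congr1 a ij)).
- move=> w wu; apply: (standard_delta sg).2 => _ [i _ <-].
  by apply: wu; apply/unit_letterE; exists i.
- by move=> _ /unit_letterE[i ->].
Qed.

Lemma standard_atom x : atom P x -> unit_length P nu x.
Proof.
case=> /standard_posE[w xE] x1 xirr; apply/unit_letterE.
case: w xE => [|i w] xE; first by case: x1; rewrite xE /word prods_nil.
exists i; case: (xirr (a i) (word a w)); rewrite -?word_cons //; try exact: word_pos.
- exact: letter_pos.
- by move=> i1; have := nuE [:: i]; rewrite -letter_word i1 (nu1 gl).
- by move=> w1; rewrite xE word_cons w1 mulg1.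
Qed.

End Standard.

Theorem corollary3 :
  (forall (G : groupType) (P : set G) (delta : G)
      (k l : nat) (x y X : G),
    garside_structure P delta -> finite_type P delta ->
    symmetric_structure P delta -> homogeneous P ->
    (0 < k)%N -> (0 < l)%N ->
    ((2 <= maxn k l)%N -> square_free P delta) ->
    atom P x -> atom P y ->
    setmulg (cclass (x ^+ k)) (cclass (y ^+ l)) X ->
    (summit_inf P delta X < 0)%R ->
    Posz (summit_len P delta X) =
      (- 2 * summit_inf P delta X + Posz k + Posz l)%R)
  /\
  (forall (t : coxeter_type) (G : groupType) (a : 'I_(coxeter_rank t) -> G)
      (P : set G) (Delta : G) (k l : nat) (x y X : G),
    coxeter_valid t -> standard_garside a P Delta ->
    (0 < k)%N -> (0 < l)%N ->
    atom P x -> atom P y ->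
    setmulg (cclass (x ^+ k)) (cclass (y ^+ l)) X ->
    (summit_inf P Delta X < 0)%R ->
    Posz (summit_len P Delta X) =
      (- 2 * summit_inf P Delta X + Posz k + Posz l - 2)%R).
Proof.
split=> [G P D k l x y X gs _ sym hom k0 l0 sqf ax ay XE inf0|].
  exact: (summit_dual gs sym hom k0 l0 sqf ax ay XE inf0).
move=> t G a P D k l x y X valid sg k0 l0 ax ay XE inf0.
have [nu nuE] := artin_length (standard_artin sg).
have [rev [revM rev1]] := artin_rev (standard_artin sg).
have ag := standard_artin_garside valid sg nuE revM rev1.
have ux := standard_atom valid sg nuE ax.
apply: (summit_artin ag _ k0 l0 ux (standard_atom valid sg nuE ay) XE inf0) => D1.
have := unit_le_D ag ux; rewrite D1 => /(pos_inv_eq1 ag ux.1).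
exact: unit_neq1 ag _ ux.
Qed.
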